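(* Let $L/K$ be a finite abelian domestic extension of number fields and let $H$ be a commutative Hopf algebra giving a Hopf-Galois structure on $L/K$. Let $\mathfrak{A}_H = \{h \in H \mid h\cdot x \in \mathfrak{O}_L \text{ for all } x \in \mathfrak{O}_L\}$ be the associated order of $\mathfrak{O}_L$ in $H$. Then $\mathfrak{O}_L$ is a locally free $\mathfrak{A}_H$-module.
   Context: $\mathfrak{O}_L,\mathfrak{O}_K$ denote the rings of algebraic integers of the number fields $L,K$. A Galois extension $L/K$ of number fields is called domestic if no prime of $\mathfrak{O}_K$ lying above a prime number dividing $[L:K]$ ramifies in $\mathfrak{O}_L$. Locally free means: for each prime (nonzero prime ideal) $\mathfrak{p}$ of $\mathfrak{O}_K$, the completed ring of integers $\mathfrak{O}_{L,\mathfrak{p}}=\mathfrak{O}_{K,\mathfrak{p}}\otimes_{\mathfrak{O}_K}\mathfrak{O}_L$ is a free module over $\mathfrak{A}_{H,\mathfrak{p}}=\mathfrak{O}_{K,\mathfrak{p}}\otimes_{\mathfrak{O}_K}\mathfrak{A}_H$, where $\mathfrak{O}_{K,\mathfrak{p}}$ is the completion of $\mathfrak{O}_K$ at $\mathfrak{p}$. Hopf-Galois structures: let $L/K$ be a finite separable field extension and $H$ a finite-dimensional $K$-Hopf algebra with counit $\varepsilon$ and comultiplication $\Delta(h)=\sum_{(h)} h_{(1)}\otimes h_{(2)}$. $L$ is an $H$-module algebra if $L$ is an $H$-module with $h\cdot(st)=\sum_{(h)}(h_{(1)}\cdot s)(h_{(2)}\cdot t)$ and $h\cdot 1=\varepsilon(h)1$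 for all $h\in H$, $s,t\in L$. We say $H$ gives a Hopf-Galois structure on $L/K$ (or $L/K$ is $H$-Galois) if $L$ is an $H$-module algebra and the $K$-linear map $j: L\otimes_K H\to \mathrm{End}_K(L)$, $j(s\otimes h)(t)=s(h\cdot t)$, is an isomorphism. *)

(* Defs.v *)
From HB Require Import structures.
From mathcomp Require Import all_boot all_order all_algebra all_fingroup all_field.
From mathcomp Require Import generic_quotient ring_quotient.
From mathcomp Require Import boolp classical_sets functions.

Set Implicit Arguments.
Unset Strict Implicit.
Unset Printing Implicit Defensive.

Import GRing.Theory.

Local Open Scope classical_set_scope.
Local Open Scope ring_scope.
Local Open Scope quotient_scope.

(* Tensor products over a commutative ring, presented as the commutative
   monoid generated by the pairs (m, n) modulo the bilinearity relations:
   a formal sum is a list of pairs, and the opposite of a pair (m, n) is the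
   pair (- m, n). *)
Section Tensor.
Variables (R : comPzRingType) (M N : lmodType R).

Inductive tensor_rel : seq (M * N) -> seq (M * N) -> Prop :=
  | TensorRefl s : tensor_rel s s
  | TensorSym s t : tensor_rel s t -> tensor_rel t s
  | TensorTrans s t u : tensor_rel s t -> tensor_rel t u -> tensor_rel s u
  | TensorCatC s t : tensor_rel (s ++ t) (t ++ s)
  | TensorCat s s' t t' :
      tensor_rel s s' -> tensor_rel t t' -> tensor_rel (s ++ t) (s' ++ t')
  | Tensor0 n : tensor_rel [:: (0, n)] [::]
  | TensorDl m m' n : tensor_rel [:: (m + m', n)] [:: (m, n); (m', n)]
  | TensorDr m n n' : tensor_rel [:: (m, n + n')] [:: (m, n); (m, n')]
  | TensorZ a m n : tensor_rel [:: (a *: m, n)] [:: (m, a *: n)].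

Definition tensor_eqv (s t : seq (M * N)) : bool := `[< tensor_rel s t >].

Lemma tensor_eqv_class : equiv_class_of tensor_eqv.
Proof.
split=> [s | s t | t s u].
- exact/asboolP/TensorRefl.
- by apply/asboolP/asboolP=> /TensorSym.
- by move=> /asboolP st /asboolP tu; apply/asboolP; apply: TensorTrans st tu.
Qed.

Canonical tensor_eqv_equiv := EquivRelPack tensor_eqv_class.
Canonical tensor_encModRel := defaultEncModRel tensor_eqv.

Definition tensor := {eq_quot tensor_eqv}.
HB.instance Definition _ : EqQuotient _ tensor_eqv tensor := EqQuotient.on tensor.
HB.instance Definition _ := Choice.on tensor.

Definition tens (m : M) (n : N) : tensor := \pi_tensor [:: (m, n)].

Lemma tensor_eqP (s t : seq (M * N)) :
  reflect (tensor_rel s t) (s == t %[mod tensor]).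
Proof. by rewrite piE; apply: asboolP. Qed.

(* The additive map out of the tensor product induced by a balanced map f;
   meaningless when f is not balanced. *)
Definition tlift (P : zmodType) (f : M -> N -> P) (t : tensor) : P :=
  \sum_(x <- repr t) f x.1 x.2.

Record balanced (P : zmodType) (f : M -> N -> P) : Prop := Balanced {
  balancedDl : forall m m' n, f (m + m') n = f m n + f m' n;
  balancedDr : forall m n n', f m (n + n') = f m n + f m n';
  balancedZ : forall a m n, f (a *: m) n = f m (a *: n) }.

Section Lift.
Variables (P : zmodType) (f : M -> N -> P).
Hypothesis bal_f : balanced f.

Lemma balanced0l n : f 0 n = 0.
Proof. by apply: (addrI (f 0 n)); rewrite -(balancedDl bal_f) !addr0. Qed.

Lemma tensor_rel_sum s t : tensor_rel s t ->
  \sum_(x <- s) f x.1 x.2 = \sum_(x <- t) f x.1 x.2.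
Proof.
elim=> {s t}.
- by [].
- by move=> s t _ ->.
- by move=> s t u _ -> _ ->.
- by move=> s t; rewrite !big_cat /= addrC.
- by move=> s s' t t' _ E _ E'; rewrite !big_cat /= E E'.
- by move=> n; rewrite big_seq1 big_nil balanced0l.
- by move=> m m' n; rewrite big_seq1 big_cons big_seq1 (balancedDl bal_f).
- by move=> m n n'; rewrite big_seq1 big_cons big_seq1 (balancedDr bal_f).
- by move=> a m n; rewrite !big_seq1 (balancedZ bal_f).
Qed.

Lemma tlift_pi s : tlift f (\pi_tensor s) = \sum_(x <- s) f x.1 x.2.
Proof. by apply: tensor_rel_sum; apply/tensor_eqP; rewrite reprK. Qed.

Lemma tlift_tens m n : tlift f (tens m n) = f m n.
Proof. by rewrite tlift_pi big_seq1. Qed.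

End Lift.

Definition tensor_zero : tensor := \pi_tensor [::].
Definition tensor_add (x y : tensor) : tensor := \pi_tensor (repr x ++ repr y).
Definition tensor_opp (x : tensor) : tensor :=
  \pi_tensor [seq (- u.1, u.2) | u <- repr x].

Lemma pi_tensor_add s t :
  tensor_add (\pi_tensor s) (\pi_tensor t) = \pi_tensor (s ++ t).
Proof.
by apply/eqP/tensor_eqP/TensorCat; apply/tensor_eqP; rewrite reprK.
Qed.

Fact tensor_addA : associative tensor_add.
Proof.
move=> x y z; rewrite -[x]reprK -[y]reprK -[z]reprK.
rewrite (pi_tensor_add (repr y) (repr z)) (pi_tensor_add (repr x) (repr y)).
by rewrite (pi_tensor_add (repr x)) (pi_tensor_add (_ ++ _)) catA.
Qed.

Fact tensor_addC : commutative tensor_add.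
Proof. by move=> x y; apply/eqP/tensor_eqP/TensorCatC. Qed.

Fact tensor_add0 : left_id tensor_zero tensor_add.
Proof. by move=> x; rewrite -[x]reprK (pi_tensor_add [::]). Qed.

Fact tensor_addN : left_inverse tensor_zero tensor_opp tensor_add.
Proof.
move=> x; rewrite -{2}[x]reprK (pi_tensor_add [seq _ | u <- _]).
apply/eqP/tensor_eqP.
elim: (repr x) => [|[m n] s IHs] /=; first exact: TensorRefl.
set s' := map _ s in IHs *.
apply: (@TensorTrans _ ([:: (- m, n); (m, n)] ++ (s' ++ s))).
  rewrite -[_ :: _]/([:: (- m, n)] ++ (s' ++ ([:: (m, n)] ++ s))).
  rewrite -[[:: (- m, n); (m, n)]]/([:: (- m, n)] ++ [:: (m, n)]).
  rewrite -[X in tensor_rel _ X]catA; apply: TensorCat; first exact: TensorRefl.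
  by rewrite !catA; apply: TensorCat; [apply: TensorCatC | apply: TensorRefl].
rewrite -[X in tensor_rel _ X]cats0; apply: TensorCat => //.
apply: TensorTrans (Tensor0 n); rewrite -(addNr m).
exact/TensorSym/TensorDl.
Qed.

HB.instance Definition _ :=
  GRing.isZmodule.Build tensor tensor_addA tensor_addC tensor_add0 tensor_addN.

Lemma tensor_piD s t : \pi_tensor (s ++ t) = \pi_tensor s + \pi_tensor t.
Proof. by rewrite -[RHS]/(tensor_add _ _) pi_tensor_add. Qed.

Lemma tensor_piE s : \pi_tensor s = \sum_(x <- s) tens x.1 x.2.
Proof.
elim: s => [|[m n] s IHs]; first by rewrite big_nil.
by rewrite -cat1s tensor_piD IHs big_cons.
Qed.

Lemma tensorE x : x = \sum_(u <- repr x) tens u.1 u.2.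
Proof. by rewrite -tensor_piE reprK. Qed.

Lemma tensor_ind (P : tensor -> Prop) :
  P 0 -> (forall x y, P x -> P y -> P (x + y)) ->
  (forall m n, P (tens m n)) -> forall x, P x.
Proof.
move=> P0 PD Pt x; rewrite [x]tensorE.
by elim/big_ind: _ => // u _; apply: Pt.
Qed.

Lemma tens_balanced : balanced tens.
Proof.
split=> [m m' n | m n n' | a m n].
- by rewrite /tens -tensor_piD; apply/eqP/tensor_eqP/TensorDl.
- by rewrite /tens -tensor_piD; apply/eqP/tensor_eqP/TensorDr.
- by apply/eqP/tensor_eqP/TensorZ.
Qed.

Lemma tensDl m m' n : tens (m + m') n = tens m n + tens m' n.
Proof. exact: balancedDl tens_balanced _ _ _. Qed.

Lemma tensDr m n n' : tens m (n + n') = tens m n + tens m n'.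
Proof. exact: balancedDr tens_balanced _ _ _. Qed.

Lemma tensZlr a m n : tens (a *: m) n = tens m (a *: n).
Proof. exact: balancedZ tens_balanced _ _ _. Qed.

Lemma tliftD (P : zmodType) (f : M -> N -> P) : balanced f ->
  {morph tlift f : x y / x + y}.
Proof.
move=> bal_f x y; rewrite -[x]reprK -[y]reprK -tensor_piD.
by rewrite !(tlift_pi bal_f) big_cat.
Qed.

Lemma tlift0 (P : zmodType) (f : M -> N -> P) : balanced f -> tlift f 0 = 0.
Proof. by move=> bal_f; rewrite -[0]/(\pi_tensor [::]) tlift_pi // big_nil. Qed.

Lemma tlift_sum_fun (P : zmodType) (f g : M -> N -> P) x :
  tlift (fun m n => f m n + g m n) x = tlift f x + tlift g x.
Proof. exact: big_split. Qed.

Lemma eq_additive_tensor (P : zmodType) (f g : tensor -> P) :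
  {morph f : x y / x + y} -> {morph g : x y / x + y} ->
  (forall m n, f (tens m n) = g (tens m n)) -> f =1 g.
Proof.
move=> fD gD fg; apply: tensor_ind => [|x y|//].
  have f0 : f 0 = 0 by apply: (addrI (f 0)); rewrite -fD !addr0.
  by rewrite f0; apply: (addrI (g 0)); rewrite -gD !addr0.
by rewrite fD gD => -> ->.
Qed.

Definition tensor_scale a : tensor -> tensor := tlift (fun m n => tens (a *: m) n).

Fact tensor_scale_balanced a : balanced (fun m n => tens (a *: m) n).
Proof.
split=> [m m' n | m n n' | b m n].
- by rewrite scalerDr tensDl.
- by rewrite tensDr.
- by rewrite scalerA mulrC -scalerA tensZlr.
Qed.

Lemma tensor_scaleE a m n : tensor_scale a (tens m n) = tens (a *: m) n.
Proof. exact: tlift_tens (tensor_scale_balanced a) _ _. Qed.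

Fact tensor_scaleD a : {morph tensor_scale a : x y / x + y}.
Proof. exact: tliftD (tensor_scale_balanced a). Qed.

Fact tensor_scaleA a b x :
  tensor_scale a (tensor_scale b x) = tensor_scale (a * b) x.
Proof.
move: x; apply: eq_additive_tensor => [x y | x y | m n].
- by rewrite !tensor_scaleD.
- by rewrite tensor_scaleD.
- by rewrite !tensor_scaleE scalerA.
Qed.

Fact tensor_scale1 : left_id 1 tensor_scale.
Proof.
apply: eq_additive_tensor => [x y | x y // | m n].
- by rewrite tensor_scaleD.
- by rewrite tensor_scaleE scale1r.
Qed.

Fact tensor_scaleDl x : {morph tensor_scale^~ x : a b / a + b}.
Proof.
move=> a b; move: x; apply: eq_additive_tensor => [x y | x y | m n] /=.
- by rewrite tensor_scaleD.
- by rewrite !tensor_scaleD addrACA.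
- by rewrite !tensor_scaleE scalerDl tensDl.
Qed.

HB.instance Definition _ := GRing.Zmodule_isLmodule.Build R tensor
  tensor_scaleA tensor_scale1 tensor_scaleD tensor_scaleDl.

Lemma tensZl a m n : tens (a *: m) n = a *: tens m n.
Proof. by rewrite -tensor_scaleE. Qed.

Lemma tensZr a m n : tens m (a *: n) = a *: tens m n.
Proof. by rewrite -tensZlr tensZl. Qed.

End Tensor.

Arguments tens {R M N} m n.

Section TensorMap.
Variables (R : comPzRingType) (M N M' N' : lmodType R).

Definition tmap (f : M -> M') (g : N -> N') : tensor M N -> tensor M' N' :=
  tlift (fun m n => tens (f m) (g n)).

End TensorMap.

Definition tassoc (R : comPzRingType) (M N P : lmodType R) :
    tensor (tensor M N) P -> tensor M (tensor N P) :=
  tlift (fun t p => tlift (fun m n => tens m (tens n p)) t).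

Section TensorAction.
Variable R : comPzRingType.

Record bilinear_action (A M : lmodType R) (act : A -> M -> M) : Prop :=
  BilinearAction {
    actDl : forall a b m, act (a + b) m = act a m + act b m;
    actDr : forall a m n, act a (m + n) = act a m + act a n;
    actZl : forall c a m, act (c *: a) m = c *: act a m;
    actZr : forall c a m, act a (c *: m) = c *: act a m }.

Lemma mul_bilinear_action (A : algType R) : @bilinear_action A A *%R.
Proof.
split=> [a b m | a m n | c a m | c a m].
- exact: mulrDl.
- exact: mulrDr.
- by rewrite -scalerAl.
- by rewrite -scalerAr.
Qed.

Variables (A B M N : lmodType R) (actA : A -> M -> M) (actB : B -> N -> N).

(* (a (x) b) (m (x) n) = (a m) (x) (b n) *)
Definition tensor_act (x : tensor A B) (y : tensor M N) : tensor M N :=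
  tlift (fun a b => tmap (actA a) (actB b) y) x.

Hypotheses (biA : bilinear_action actA) (biB : bilinear_action actB).

Lemma tmap_act_balanced a b : balanced (fun m n => tens (actA a m) (actB b n)).
Proof.
split=> [m m' n | m n n' | c m n].
- by rewrite (actDr biA) tensDl.
- by rewrite (actDr biB) tensDr.
- by rewrite (actZr biA) (actZr biB) tensZlr.
Qed.

Lemma tensor_act_balanced y :
  balanced (fun a b => tmap (actA a) (actB b) y).
Proof.
split=> [a a' b | a b b' | c a b].
- rewrite /tmap -tlift_sum_fun; congr (tlift _ y).
  by apply/funext=> m; apply/funext=> n; rewrite (actDl biA) tensDl.
- rewrite /tmap -tlift_sum_fun; congr (tlift _ y).
  by apply/funext=> m; apply/funext=> n; rewrite (actDl biB) tensDr.
- congr (tlift _ y); apply/funext=> m; apply/funext=> n.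
  by rewrite (actZl biA) (actZl biB) tensZlr.
Qed.

Lemma tensor_act_tens a b m n :
  tensor_act (tens a b) (tens m n) = tens (actA a m) (actB b n).
Proof.
by rewrite /tensor_act (tlift_tens (tensor_act_balanced _))
           /tmap (tlift_tens (tmap_act_balanced _ _)).
Qed.

Lemma tensor_actDl x x' y :
  tensor_act (x + x') y = tensor_act x y + tensor_act x' y.
Proof. exact: (tliftD (tensor_act_balanced y)). Qed.

Lemma tensor_actDr x y y' :
  tensor_act x (y + y') = tensor_act x y + tensor_act x y'.
Proof.
rewrite /tensor_act -tlift_sum_fun; congr (tlift _ x).
apply/funext=> a; apply/funext=> b.
exact: (tliftD (tmap_act_balanced a b)).
Qed.

End TensorAction.

Section TensorActionAssoc.
Variables (R : comPzRingType) (A B : algType R) (M N : lmodType R).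
Variables (actA : A -> M -> M) (actB : B -> N -> N).
Hypotheses (biA : bilinear_action actA) (biB : bilinear_action actB).
Hypotheses (actA1 : forall m, actA 1 m = m) (actB1 : forall n, actB 1 n = n).
Hypotheses (actAM : forall a a' m, actA a (actA a' m) = actA (a * a') m).
Hypotheses (actBM : forall b b' n, actB b (actB b' n) = actB (b * b') n).

Local Notation tact := (tensor_act actA actB).
Local Notation tmul := (tensor_act (@GRing.mul A) (@GRing.mul B)).

Lemma tensor_act1 y : tact (tens 1 1) y = y.
Proof.
move: y; apply: eq_additive_tensor => [x y | x y // | m n].
- by rewrite tensor_actDr.
- by rewrite tensor_act_tens // actA1 actB1.
Qed.

Lemma tensor_actA x x' y : tact x (tact x' y) = tact (tmul x x') y.
Proof.
have bimA := mul_bilinear_action A; have bimB := mul_bilinear_action B.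
move: x; apply: eq_additive_tensor => [x1 x2 | x1 x2 | a b].
- by rewrite tensor_actDl.
- by rewrite !tensor_actDl.
move: x'; apply: eq_additive_tensor => [x1 x2 | x1 x2 | a' b'].
- by rewrite tensor_actDl // tensor_actDr.
- by rewrite tensor_actDr // tensor_actDl.
move: y; apply: eq_additive_tensor => [x1 x2 | x1 x2 | m n].
- by rewrite !tensor_actDr.
- by rewrite tensor_actDr.
- by rewrite !tensor_act_tens // actAM actBM.
Qed.

End TensorActionAssoc.

Section TensorRing.
Variables (R : comPzRingType) (A B : algType R).
Local Notation tmul := (tensor_act (@GRing.mul A) (@GRing.mul B)).

Fact tensor_mulA : associative tmul.
Proof.
by move=> x y z; apply: tensor_actA;
  do ?[exact: mul_bilinear_action | exact: mulrA].
Qed.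

Fact tensor_mul1 : left_id (tens 1 1) tmul.
Proof.
by move=> x; apply: tensor_act1; do ?[exact: mul_bilinear_action | exact: mul1r].
Qed.

Fact tensor_mulDl : left_distributive tmul +%R.
Proof. by move=> x y z; apply: tensor_actDl; apply: mul_bilinear_action. Qed.

Fact tensor_mulDr : right_distributive tmul +%R.
Proof. by move=> x y z; apply: tensor_actDr; apply: mul_bilinear_action. Qed.

Fact tensor_mulr1 : right_id (tens 1 1) tmul.
Proof.
apply: eq_additive_tensor => [x y | x y // | a b].
- by rewrite tensor_mulDl.
- by rewrite tensor_act_tens ?mulr1 //; apply: mul_bilinear_action.
Qed.

HB.instance Definition _ := GRing.Zmodule_isPzRing.Build (tensor A B)
  tensor_mulA tensor_mul1 tensor_mulr1 tensor_mulDl tensor_mulDr.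

End TensorRing.

HB.mixin Record Falgebra_isHopf (K : fieldType) H of Falgebra K H := {
  comul : H -> tensor H H;
  counit : H -> K;
  antipode : H -> H;
  comul_linear : linear comul;
  comul_monoid_morphism : monoid_morphism comul;
  counit_scalar : scalar counit;
  counit_monoid_morphism : monoid_morphism counit;
  antipode_linear : linear antipode;
  coassociativity : forall h,
    tassoc (tmap comul id (comul h)) = tmap id comul (comul h);
  counit_left : forall h, tlift (fun a b => counit a *: b) (comul h) = h;
  counit_right : forall h, tlift (fun a b => counit b *: a) (comul h) = h;
  antipode_left : forall h,
    tlift (fun a b => antipode a * b) (comul h) = (counit h)%:A;
  antipode_right : forall h,
    tlift (fun a b => a * antipode b) (comul h) = (counit h)%:A }.

#[short(type="hopfAlgType")]
HB.structure Definition HopfAlgebra (K : fieldType) :=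
  {H of Falgebra K H & Falgebra_isHopf K H}.

Section HopfGalois.
Variables (K : fieldType) (L : fieldExtType K) (H : hopfAlgType K).

(* j : L (x) H -> End_K(L), j (s (x) h) t = s (h . t) *)
Definition hopf_galois_map (act : H -> L -> L) : tensor L H -> 'End(L) :=
  tlift (fun s h => linfun (fun t => s * act h t)).

Record hopf_galois := HopfGalois {
  hact :> H -> L -> L;
  hact_linearl : forall x, linear (hact^~ x);
  hact_linearr : forall h, linear (hact h);
  hact1 : forall x, hact 1 x = x;
  hactM : forall h h' x, hact (h * h') x = hact h (hact h' x);
  hact_mul : forall h s t,
    hact h (s * t) = tlift (fun h1 h2 => hact h1 s * hact h2 t) (comul h);
  hact_one : forall h, hact h 1 = (counit h)%:A;
  hact_bij : bijective (hopf_galois_map hact) }.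

End HopfGalois.

Section RingOfIntegers.
Variable F : fieldType.

(* Integral closure of the image of Z in F: the ring of integers when F is a
   number field. *)
Definition algebraic_integer : {pred F} :=
  fun x => `[< integralOver (intmul 1 : int -> F) x >].

Fact algebraic_integer_subring : subring_closed algebraic_integer.
Proof.
split=> [|x y /asboolP xi /asboolP yi|x y /asboolP xi /asboolP yi];
  apply/asboolP.
- exact: integral1.
- exact: integral_sub.
- exact: integral_mul.
Qed.

HB.instance Definition _ :=
  GRing.isSubringClosed.Build F algebraic_integer algebraic_integer_subring.

Record ring_of_integers := RingOfIntegers {
  ring_of_integers_val :> F;
  _ : ring_of_integers_val \in algebraic_integer }.

HB.instance Definition _ := [isSub for ring_of_integers_val].
HB.instance Definition _ := [Choice of ring_of_integers by <:].
HB.instance Definition _ :=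
  [SubChoice_isSubComNzRing of ring_of_integers by <:].

End RingOfIntegers.

Notation "''O_' F" := (ring_of_integers F)
  (at level 8, F at level 2, format "''O_' F") : type_scope.

Section Integers.
Variables (K : fieldType) (L : fieldExtType K).

Fact algebraic_integer_alg (a : 'O_K) : (val a)%:A \in @algebraic_integer L.
Proof.
apply/asboolP; have /asboolP/(integral_rmorph (in_alg L)) := valP a.
case=> p mp rp; exists p => //.
suff <- : map_poly (in_alg L \o intmul 1) p = map_poly (intmul 1) p by [].
by apply: eq_map_poly => z /=; rewrite scaler_int.
Qed.

Fact algebraic_integer_scale (a : 'O_K) (x : 'O_L) :
  val a *: val x \in @algebraic_integer L.
Proof.
by rewrite -mulr_algl rpredM ?algebraic_integer_alg // (valP x).
Qed.

Definition int_scale (a : 'O_K) (x : 'O_L) : 'O_L :=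
  RingOfIntegers (algebraic_integer_scale a x).

Fact int_scaleA a b x : int_scale a (int_scale b x) = int_scale (a * b) x.
Proof. by apply: val_inj; rewrite /= scalerA. Qed.

Fact int_scale1 : left_id 1 int_scale.
Proof. by move=> x; apply: val_inj; rewrite /= scale1r. Qed.

Fact int_scaleDr : right_distributive int_scale +%R.
Proof. by move=> a x y; apply: val_inj; rewrite /= scalerDr. Qed.

Fact int_scaleDl x : {morph int_scale^~ x : a b / a + b}.
Proof. by move=> a b; apply: val_inj; rewrite /= scalerDl. Qed.

HB.instance Definition _ := GRing.Zmodule_isLmodule.Build ('O_K) ('O_L)
  int_scaleA int_scale1 int_scaleDr int_scaleDl.

Fact int_scaleAl (a : 'O_K) (x y : 'O_L) : a *: (x * y) = a *: x * y.
Proof. by apply: val_inj; rewrite /= scalerAl. Qed.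

HB.instance Definition _ :=
  GRing.Lmodule_isLalgebra.Build ('O_K) ('O_L) int_scaleAl.

End Integers.

Section Ideals.
Variable R : comNzRingType.

Definition ideal_span (X : set R) : set R :=
  [set x | exists2 s : seq (R * R),
     (forall u, u \in s -> X u.2) & x = \sum_(u <- s) u.1 * u.2].

Definition ideal_pow (I : {pred R}) (n : nat) : set R :=
  ideal_span [set x | exists2 t : n.-tuple R,
                        {subset t <= I} & x = \prod_(a <- t) a].

Lemma ideal_span0 X : ideal_span X 0.
Proof. by exists [::] => //; rewrite big_nil. Qed.

Lemma ideal_spanD X x y :
  ideal_span X x -> ideal_span X y -> ideal_span X (x + y).
Proof.
move=> [s Xs ->] [t Xt ->]; exists (s ++ t); last by rewrite big_cat.
by move=> u; rewrite mem_cat => /orP[/Xs|/Xt].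
Qed.

Lemma ideal_spanM X a x : ideal_span X x -> ideal_span X (a * x).
Proof.
move=> [s Xs ->]; exists [seq (a * u.1, u.2) | u <- s].
  by move=> _ /mapP[u /Xs Xu ->].
by rewrite big_map mulr_sumr; apply: eq_bigr => u _; rewrite mulrA.
Qed.

Lemma ideal_spanN X x : ideal_span X x -> ideal_span X (- x).
Proof. by move=> /(@ideal_spanM _ (-1)); rewrite mulN1r. Qed.

Lemma ideal_pow1 (I : idealr R) : ideal_pow I 1 `<=` [set` I].
Proof.
move=> _ [s Is ->] /=; rewrite big_seq; apply: rpred_sum => u /Is[t tI ->].
apply: idealMr; case: t tI => -[|a []] // sz; rewrite big_seq1; apply.
exact: mem_head.
Qed.

End Ideals.

(* The I-adic completion lim R / I^n, as the ring of sequences x with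
   x (n + 1) = x n mod I^n for all n, modulo those with x n in I^n for all n. *)
Section Completion.
Variables (R : comNzRingType) (I : idealr R).

Definition coherent : {pred (nat -> R)} :=
  fun x => `[< forall n, ideal_pow I n (x n.+1 - x n) >].

Fact coherent_subring : subring_closed coherent.
Proof.
split=> [|x y /asboolP xc /asboolP yc|x y /asboolP xc /asboolP yc];
  apply/asboolP => n.
- by rewrite /= subrr; apply: ideal_span0.
- rewrite [X in ideal_pow I n X](_ : _ = (x n.+1 - x n) - (y n.+1 - y n)).
    by apply: (ideal_spanD (xc n)); exact: ideal_spanN (yc n).
  by rewrite -[LHS]/((x n.+1 - y n.+1) - (x n - y n)) opprD addrACA -opprD.
- rewrite [X in ideal_pow I n X](_ : _ =
    x n.+1 * (y n.+1 - y n) + y n * (x n.+1 - x n)).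
    exact: ideal_spanD (ideal_spanM _ (yc n)) (ideal_spanM _ (xc n)).
  rewrite -[LHS]/(x n.+1 * y n.+1 - x n * y n) !mulrBr.
  by rewrite [y n * x n.+1]mulrC [y n * x n]mulrC addrA subrK.
Qed.

HB.instance Definition _ :=
  GRing.isSubringClosed.Build (nat -> R) coherent coherent_subring.

Record coherent_seq := CoherentSeq {
  coherent_val :> nat -> R;
  _ : coherent_val \in coherent }.

HB.instance Definition _ := [isSub for coherent_val].
HB.instance Definition _ := [Choice of coherent_seq by <:].
HB.instance Definition _ := [SubChoice_isSubComNzRing of coherent_seq by <:].

Definition null_seq : {pred coherent_seq} :=
  fun x => `[< forall n, ideal_pow I n (x n) >].

Fact null_seq_idealr : idealr_closed null_seq.
Proof.
split=> [||a x y /asboolP x0 /asboolP y0].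
- by apply/asboolP=> n; apply: ideal_span0.
- by apply/asboolP=> /(_ 1%N)/ideal_pow1; rewrite /= idealr1.
- by apply/asboolP=> n; exact: ideal_spanD (ideal_spanM _ (x0 n)) (y0 n).
Qed.

HB.instance Definition _ := isIdealr.Build coherent_seq null_seq null_seq_idealr.

Definition completion := {ideal_quot null_seq}.
HB.instance Definition _ := GRing.ComNzRing.on completion.

Fact const_coherent (a : R) : (fun=> a) \in coherent.
Proof. by apply/asboolP=> n; rewrite subrr; apply: ideal_span0. Qed.

Definition to_completion (a : R) : completion :=
  \pi_completion (CoherentSeq (const_coherent a)).

Fact to_completion_zmod_morphism : zmod_morphism to_completion.
Proof.
move=> a b; rewrite /to_completion.
rewrite -[RHS](rmorphB (\pi_{ideal_quot null_seq} : {rmorphism _ -> _})).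
by congr (\pi_completion _); apply: val_inj.
Qed.

Fact to_completion_monoid_morphism : monoid_morphism to_completion.
Proof.
pose pi : {rmorphism _ -> _} := \pi_{ideal_quot null_seq}.
split=> [|a b]; rewrite /to_completion.
  by rewrite -[RHS](rmorph1 pi); congr (\pi_completion _); apply: val_inj.
by rewrite -[RHS](rmorphM pi); congr (\pi_completion _); apply: val_inj.
Qed.

HB.instance Definition _ := GRing.isZmodMorphism.Build R completion
  to_completion to_completion_zmod_morphism.
HB.instance Definition _ := GRing.isMonoidMorphism.Build R completion
  to_completion to_completion_monoid_morphism.

Definition completion_scale (a : R) (x : completion) := to_completion a * x.

Fact completion_scaleA a b x :
  completion_scale a (completion_scale b x) = completion_scale (a * b) x.
Proof. by rewrite /completion_scale rmorphM mulrA. Qed.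

Fact completion_scale1 : left_id 1 completion_scale.
Proof. by move=> x; rewrite /completion_scale rmorph1 mul1r. Qed.

Fact completion_scaleDr : right_distributive completion_scale +%R.
Proof. by move=> a x y; rewrite /completion_scale mulrDr. Qed.

Fact completion_scaleDl x : {morph completion_scale^~ x : a b / a + b}.
Proof. by move=> a b; rewrite /completion_scale rmorphD mulrDl. Qed.

HB.instance Definition _ := GRing.Zmodule_isLmodule.Build R completion
  completion_scaleA completion_scale1 completion_scaleDr completion_scaleDl.

Fact completion_scaleAl (a : R) (x y : completion) : a *: (x * y) = a *: x * y.
Proof. exact: mulrA. Qed.

HB.instance Definition _ :=
  GRing.Lmodule_isLalgebra.Build R completion completion_scaleAl.

Fact completion_scaleAr (a : R) (x y : completion) : a *: (x * y) = x * (a *: y).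
Proof. exact: mulrCA. Qed.

HB.instance Definition _ :=
  GRing.Lalgebra_isAlgebra.Build R completion completion_scaleAr.

End Completion.

Section Ramification.
Variables (K : fieldType) (L : fieldExtType K).

Definition nonzero_ideal (R : nzRingType) (I : {pred R}) : Prop :=
  exists2 x, x \in I & x != 0.

Definition lies_above (R S : nzRingType) (f : R -> S)
    (P : {pred S}) (p : {pred R}) : Prop :=
  forall x, (f x \in P) = (x \in p).

Definition ideal_extension (p : {pred 'O_K}) : set 'O_L :=
  ideal_span [set y | exists2 x, x \in p & y = x%:A :> 'O_L].

(* The largest e such that p O_L is contained in P^e, i.e. the exponent of P in
   the prime factorization of p O_L when O_L is a Dedekind domain. *)
Definition is_ramification_index
    (p : {pred 'O_K}) (P : {pred 'O_L}) (e : nat) : Prop :=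
  ideal_extension p `<=` ideal_pow P e /\
  ~ (ideal_extension p `<=` ideal_pow P e.+1).

Definition ramifies (p : {pred 'O_K}) : Prop :=
  exists P : prime_idealr 'O_L,
    lies_above (in_alg 'O_L) P p /\
    exists2 e, is_ramification_index p P e & (1 < e)%N.

Definition domestic : Prop :=
  forall q : nat, prime q -> (q %| \dim {:L})%N ->
  forall p : prime_idealr 'O_K,
    lies_above (intmul 1 : int -> 'O_K) p (dvdz q) -> ~ ramifies p.

End Ramification.

Arguments domestic : clear implicits.

Section AssociatedOrder.
Variables (K : fieldType) (L : fieldExtType K) (H : hopfAlgType K).
Variable act : hopf_galois L H.

Definition stabilizes_integers : {pred H} :=
  fun h => `[< forall x : L,
     x \in @algebraic_integer L -> act h x \in @algebraic_integer L >].

Lemma hact_bilinear : @bilinear_action K H L act.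
Proof.
have D1 x := hact_linearl act x; have D2 h := hact_linearr act h.
split=> [a b m | a m n | c a m | c a m].
- by have := D1 m 1 a b; rewrite !scale1r.
- by have := D2 a 1 m n; rewrite !scale1r.
- have h0 : act 0 m = 0.
    by have := D1 m (-1) 0 0; rewrite scaler0 addr0 scaleN1r addNr.
  by have := D1 m c a 0; rewrite h0 !addr0.
- have h0 : act a 0 = 0.
    by have := D2 a (-1) 0 0; rewrite scaler0 addr0 scaleN1r addNr.
  by have := D2 a c m 0; rewrite h0 !addr0.
Qed.

Fact stabilizes_integers_subring : subring_closed stabilizes_integers.
Proof.
split=> [|h h' /asboolP hi /asboolP h'i|h h' /asboolP hi /asboolP h'i];
  apply/asboolP=> x xi.
- by rewrite hact1.
- rewrite -scaleN1r (actDl hact_bilinear) (actZl hact_bilinear) scaleN1r.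
  by rewrite rpredB ?hi ?h'i.
- by rewrite hactM hi ?h'i.
Qed.

HB.instance Definition _ := GRing.isSubringClosed.Build H
  stabilizes_integers stabilizes_integers_subring.

Record associated_order := AssociatedOrder {
  associated_order_val :> H;
  _ : associated_order_val \in stabilizes_integers }.

HB.instance Definition _ := [isSub for associated_order_val].
HB.instance Definition _ := [Choice of associated_order by <:].
HB.instance Definition _ := [SubChoice_isSubNzRing of associated_order by <:].

Fact order_scale_subproof (a : 'O_K) (h : associated_order) :
  val a *: val h \in stabilizes_integers.
Proof.
apply/asboolP=> x xi; rewrite (actZl hact_bilinear) -mulr_algl.
rewrite rpredM ?algebraic_integer_alg //.
by have /asboolP := valP h; apply.
Qed.

Definition order_scale (a : 'O_K) (h : associated_order) : associated_order :=
  AssociatedOrder (order_scale_subproof a h).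

Fact order_scaleA a b h : order_scale a (order_scale b h) = order_scale (a * b) h.
Proof. by apply: val_inj; rewrite /= scalerA. Qed.

Fact order_scale1 : left_id 1 order_scale.
Proof. by move=> h; apply: val_inj; rewrite /= scale1r. Qed.

Fact order_scaleDr : right_distributive order_scale +%R.
Proof. by move=> a h k; apply: val_inj; rewrite /= scalerDr. Qed.

Fact order_scaleDl h : {morph order_scale^~ h : a b / a + b}.
Proof. by move=> a b; apply: val_inj; rewrite /= scalerDl. Qed.

HB.instance Definition _ := GRing.Zmodule_isLmodule.Build ('O_K) associated_order
  order_scaleA order_scale1 order_scaleDr order_scaleDl.

Fact order_scaleAl (a : 'O_K) (h k : associated_order) :
  a *: (h * k) = a *: h * k.
Proof. by apply: val_inj; rewrite /= scalerAl. Qed.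

HB.instance Definition _ :=
  GRing.Lmodule_isLalgebra.Build ('O_K) associated_order order_scaleAl.

Fact order_scaleAr (a : 'O_K) (h k : associated_order) :
  a *: (h * k) = h * (a *: k).
Proof. by apply: val_inj; rewrite /= scalerAr. Qed.

HB.instance Definition _ :=
  GRing.Lalgebra_isAlgebra.Build ('O_K) associated_order order_scaleAr.

Fact order_act_subproof (h : associated_order) (x : 'O_L) :
  act (val h) (val x) \in @algebraic_integer L.
Proof. by have /asboolP := valP h; apply; apply: valP. Qed.

Definition order_act (h : associated_order) (x : 'O_L) : 'O_L :=
  RingOfIntegers (order_act_subproof h x).

Lemma order_act_bilinear : @bilinear_action 'O_K associated_order 'O_L order_act.
Proof.
have bi := hact_bilinear.
split=> [a b m | a m n | c a m | c a m]; apply: val_inj; rewrite /=.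
- exact: actDl.
- exact: actDr.
- exact: actZl.
- exact: actZr.
Qed.

Variable p : prime_idealr 'O_K.

Definition order_at := @tensor 'O_K (completion p) associated_order.
HB.instance Definition _ := GRing.PzRing.on order_at.

Definition integers_at := @tensor 'O_K (completion p) 'O_L.
HB.instance Definition _ := GRing.Zmodule.on integers_at.

(* (c (x) h) . (d (x) x) = (c d) (x) (h . x) *)
Definition local_act (a : order_at) (x : integers_at) : integers_at :=
  tensor_act *%R order_act a x.

Let bi := mul_bilinear_action (completion p).

Fact local_actA a b x : local_act a (local_act b x) = local_act (a * b) x.
Proof.
apply: tensor_actA => //.
- exact: order_act_bilinear.
- exact: mulrA.
- by move=> h k y; apply: val_inj; rewrite /= hactM.
Qed.

Fact local_act1 : left_id 1 local_act.
Proof.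
move=> x; apply: tensor_act1 => //.
- exact: order_act_bilinear.
- exact: mul1r.
- by move=> y; apply: val_inj; rewrite /= hact1.
Qed.

Fact local_actDr : right_distributive local_act +%R.
Proof. by move=> a x y; apply: tensor_actDr => //; apply: order_act_bilinear. Qed.

Fact local_actDl x : {morph local_act^~ x : a b / a + b}.
Proof. by move=> a b; apply: tensor_actDl => //; apply: order_act_bilinear. Qed.

HB.instance Definition _ := GRing.Zmodule_isLmodule.Build order_at integers_at
  local_actA local_act1 local_actDr local_actDl.

End AssociatedOrder.

(* A basis e may be indexed by any type I; linear combinations are finite. *)
Definition free_module (A : pzRingType) (M : lmodType A) : Prop :=
  exists (I : eqType) (e : I -> M),
    (forall x, exists (s : seq I) (c : I -> A), x = \sum_(i <- s) c i *: e i) /\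
    (forall (s : seq I) (c : I -> A), uniq s ->
       \sum_(i <- s) c i *: e i = 0 -> forall i, i \in s -> c i = 0).

Definition locally_free (K : fieldType) (L : fieldExtType K) (H : hopfAlgType K)
    (act : hopf_galois L H) : Prop :=
  forall p : prime_idealr 'O_K, nonzero_ideal p ->
    free_module (integers_at L p : lmodType (order_at act p)).

(* Main.v *)
(** Fix a nonzero prime p of O_K, let l be the prime number in p, and work with
    the integers prime to l inverted.  The action of H on L is described by its
    coefficients, h . x = sum_g a_g(h) g(x).  The a_g are orthogonal idempotents
    for convolution, so the Galois group permutes them.  For commutative H, let
    M be the order of all h with integral coefficients; it acts on O_L.  The
    trace form a_1(h k) turns a pair of elements of L into an H-linear map
    L -> H, and such maps send O_L into M.  If they are also onto, which holds
    when O_L has dual pairs sum_i y_i g(x_i) = u [g = 1] with u a unit, then O_L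
    is a free M-module of rank one.

    If l divides [L : K], then l is unramified by domesticity: an inertia element
    fixes a uniformizer, hence is congruent to 1 modulo every power of a prime
    above l and is trivial.  So for every g <> 1 the elements x - g x generate
    the unit ideal, which produces dual pairs.  If l does not divide [L : K],
    then every integral element of H lies in M, because [L : K] a_g(h) is a trace
    of algebraic integers; so finitely generated M-submodules of H, such as the
    image of O_L, are principal.  In both cases O_L = M x, and M agrees with the
    associated order up to integers prime to l, which are invertible in the
    completion at p. *)

Require Import Defs.
From HB Require Import structures.
From mathcomp Require Import all_boot all_order all_algebra all_fingroup all_field.
From mathcomp Require Import generic_quotient ring_quotient.
From mathcomp Require Import boolp classical_sets functions.
From mathcomp Require Import ring.

Set Implicit Arguments.
Unset Strict Implicit.
Unset Printing Implicit Defensive.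

Import GRing.Theory.
Local Open Scope ring_scope.
Local Open Scope quotient_scope.

(** * Pairings that take a unit value *)

(** The obstacle is to pass from a relation sum f_i(x_i) = 1 to a single map and a single vector
    with f(x) = 1: the rings involved need not be local, so no single term has to be a unit. In
    place of a finite set of maximal ideals, two properties are used: the ring is pi-regular modulo
    [l], and every 1 + l c is a unit. Pi-regularity comes from finite rank over Q alone, which gives
    each element an integer relation with some coefficient prime to [l]. This is also why integers
    prime to [l] are inverted instead of completing at once: everything stays inside L and H. The
    principle serves three purposes: multiplication maps, where it yields gcds in K, in L and, in
    the tame case, in H; H-linear maps over M at unramified primes; H-linear maps over H itself,
    with [l] replaced by 0, where it yields a generator up to denominators that a gcd in H then
    corrects. Commutativity of H lets H-linear maps be combined with coefficients in H. *)

Section UnitValue.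
Variables (V : comNzRingType) (S : subringClosed V) (d : V).
Hypothesis Sd : d \in S.
Hypothesis pi_regular : forall a, a \in S ->
  exists N : nat, exists b c, [/\ b \in S, c \in S & a ^+ N * (1 - a * b) = d * c].
Hypothesis unit1D : forall c, c \in S -> exists2 w, w \in S & (1 + d * c) * w = 1.
Variables (U : zmodType) (sm : V -> U -> U) (X : U -> Prop) (F : (U -> V) -> Prop).
Hypothesis XD : forall a b x y, a \in S -> b \in S -> X x -> X y ->
  X (sm a x + sm b y).
Hypothesis FD : forall a b f g, a \in S -> b \in S -> F f -> F g ->
  F (fun x => a * f x + b * g x).
Hypothesis FX : forall f x, F f -> X x -> f x \in S.
Hypothesis Flin : forall f a b x y, F f ->
  f (sm a x + sm b y) = a * f x + b * f y.

(** [a] lies in the radical of the ideal (g, d) of [S]. *)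
Definition rad_mod (g a : V) : Prop :=
  exists N : nat, exists u v, [/\ u \in S, v \in S & a ^+ N = g * u + d * v].

Lemma rad_modD g a b : a \in S -> b \in S ->
  rad_mod g a -> rad_mod g b -> rad_mod g (a + b).
Proof.
move=> Sa Sb [N [u [v [Su Sv Ea]]]] [M [u' [v' [Su' Sv' Eb]]]].
pose J x := exists u v, [/\ u \in S, v \in S & x = g * u + d * v].
exists (N + M)%N; rewrite -/(J _) exprDn.
have JD x y : J x -> J y -> J (x + y).
  move=> [p [q [Sp Sq ->]]] [p' [q' [Sp' Sq' ->]]].
  by exists (p + p'), (q + q'); split; rewrite ?rpredD //; ring.
have JM x y : x \in S -> J y -> J (x * y).
  move=> Sx [p [q [Sp Sq ->]]].
  by exists (x * p), (x * q); split; rewrite ?rpredM //; ring.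
have Ja : J (a ^+ N) by exists u, v.
have Jb : J (b ^+ M) by exists u', v'.
elim/big_ind: _ => [|//|i _].
  by exists 0, 0; split; rewrite ?rpred0 //; ring.
rewrite -mulr_natr mulrC; apply: (JM); first by rewrite rpred_nat.
(* Each binomial term contains b^M or a^N. *)
have [leM|ltM] := leqP M i.
  by rewrite -(subnK leM) exprD mulrA; apply: (JM); rewrite ?rpredM ?rpredX.
have leN : (N <= N + M - i)%N by rewrite -addnBA ?leq_addr // ltnW.
rewrite -(subnK leN) exprD mulrC mulrA; apply: (JM) => //.
by rewrite rpredM ?rpredX.
Qed.

(* e = (a c)^(N+1) is idempotent modulo d, and a is invertible modulo d on the
   e-component and nilpotent on the other one. *)
Lemma combine_values f x f' x' : F f -> X x -> F f' -> X x' ->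
  exists f'' x'', [/\ F f'', X x'',
    rad_mod (f'' x'') (f x) & rad_mod (f'' x'') (f' x')].
Proof.
move=> Ff Xx Ff' Xx'; set a := f x; set b := f' x'.
have Sa : a \in S by apply: FX.
have Sb : b \in S by apply: FX.
have [N [c [k [Sc Sk Ek]]]] := pi_regular Sa.
(* 1 - (a c)^M is a multiple of 1 - a c, so the relation of [pi_regular] passes to powers of a c. *)
have tele M : exists2 z, z \in S & a ^+ N * (1 - (a * c) ^+ M) = d * z.
  elim: M => [|M [z Sz Ez]].
    by exists 0; rewrite ?rpred0 // expr0 subrr !mulr0.
  exists (z + (a * c) ^+ M * k); first by rewrite rpredD ?rpredM ?rpredX ?rpredM.
  rewrite [RHS]mulrDr -Ez [d * (_ * k)]mulrCA -Ek exprS.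
  by move: (a ^+ N) ((a * c) ^+ M) => aN pM; ring.
pose e := (a * c) ^+ N.+1.
have Se : e \in S by rewrite rpredX // rpredM.
have Sf : 1 - e \in S by rewrite rpredB ?rpred1.
have [z Sz Ez] := tele N.+1; rewrite -/e in Ez.
have Eee : e * (1 - e) = d * (a * c ^+ N.+1 * z).
  have Ee : e = a * c ^+ N.+1 * a ^+ N.
    by rewrite /e exprMn [a ^+ N.+1]exprS mulrAC.
  by rewrite {1}Ee -mulrA Ez mulrCA.
exists (fun x => e * f x + (1 - e) * f' x), (sm e x + sm (1 - e) x').
set g := e * _ + _ * _.
have Sfx' : f x' \in S by apply: FX.
have Sf'x : f' x \in S by apply: FX.
(* As e (1 - e) lies in d S, the cross terms f x' and f' x matter only through a multiple of d. *)
have Eg : g = e * a + (1 - e) * b +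
    d * ((a * c ^+ N.+1 * z) * (f x' + f' x - a - b)).
  rewrite /g !Flin // -/a -/b mulrA -Eee; ring.
set Z := a * c ^+ N.+1 * z in Eee Eg.
set T := f x' + f' x - a - b in Eg.
have SZ : Z \in S by rewrite !rpredM ?rpredX.
have ST : T \in S by rewrite !rpredB ?rpredD.
pose q := a ^+ N * c ^+ N.+1.
have Sq : q \in S by rewrite rpredM ?rpredX.
have Eq : e = a * q by rewrite /e /q exprMn exprS mulrA.
pose Y := Z * (1 - q * b + a * q - q * e * T).
have SY : Y \in S.
  have Sqb : q * b \in S by apply: rpredM.
  have SqeT : q * e * T \in S by rewrite rpredM // rpredM.
  have S1qb : 1 - q * b \in S by apply: rpredB; rewrite ?rpred1.
  rewrite /Y -Eq; apply: rpredM => //; apply: rpredB => //; exact: rpredD.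
(* Modulo d, e g = e a and e is idempotent; with e = a q this puts e in the ideal (g, d). *)
have Ein : e = g * (e * q) + d * Y.
  have -> : g * (e * q) = e * (a * q) - e * (1 - e) * (a * q)
     + e * (1 - e) * (q * b) + d * Z * (T * (e * q)) by rewrite Eg; ring.
  rewrite Eee -Eq; have -> : e * e = e - e * (1 - e) by ring.
  by rewrite Eee /Y -Eq; ring.
split; [exact: FD | exact: XD | |].
- exists N, (a ^+ N * (e * q)), (z + a ^+ N * Y); split.
  + by apply: rpredM; rewrite ?rpredX // rpredM.
  + by rewrite rpredD // rpredM // rpredX.
  transitivity (a ^+ N * (1 - e) + a ^+ N * e); first by ring.
  by rewrite Ez {1}Ein; ring.
- exists 1%N, (1 - e + b * (e * q)), (b * Y - Z * (a - b) - (1 - e) * (Z * T)).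
  split.
  + by apply: rpredD => //; apply: rpredM => //; apply: rpredM.
  + have Sab : a - b \in S by apply: rpredB.
    by apply: rpredB; [apply: rpredB|]; apply: rpredM => //; apply: rpredM.
  have E1 : (1 - e) * g = (1 - e) * b + d * Z * (a - b) + (1 - e) * (d * Z * T).
    transitivity ((1 - e) * b + e * (1 - e) * (a - b) + (1 - e) * (d * Z * T)).
      by rewrite Eg; ring.
    by rewrite Eee.
  have -> : b ^+ 1 = (1 - e) * b + e * b by ring.
  have -> : (1 - e) * b = (1 - e) * g - d * Z * (a - b) - (1 - e) * (d * Z * T).
    by rewrite E1; ring.
  by rewrite {3}Ein; ring.
Qed.

(** Combining with one more pair keeps the old value in the radical of the new one modulo d, so
    values already absorbed stay absorbed. *)
Lemma value_family m (f : 'I_m -> U -> V) (x : 'I_m -> U) f0 x0 :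
  F f0 -> X x0 -> (forall i, F (f i)) -> (forall i, X (x i)) ->
  exists f' x', [/\ F f', X x' & forall i, rad_mod (f' x') (f i (x i))].
Proof.
move=> Ff0 Xx0; elim: m f x => [|m IHm] f x Ff Xx.
  by exists f0, x0; split=> // -[].
have [||f1 [x1 [Ff1 Xx1 r1]]] := IHm (fun i => f (lift ord0 i)) (fun i => x (lift ord0 i)).
- by move=> i; apply: Ff.
- by move=> i; apply: Xx.
have [f2 [x2 [Ff2 Xx2 [N [u [v [Su Sv E1]]]] r2]]] :=
  combine_values Ff1 Xx1 (Ff ord0) (Xx ord0).
exists f2, x2; split=> // i; have [j ->|->] := unliftP ord0 i; last exact: r2.
have [M [u' [v' [Su' Sv' E2]]]] := r1 j.
set a := f _ _ in E2 *; set g := f2 x2 in E1 *; set h := f1 x1 in E1 E2.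
have Sh : h \in S by apply: FX.
have radD y t : y \in S -> t \in S -> rad_mod g y -> rad_mod g t -> rad_mod g (y + t).
  exact: rad_modD.
have : rad_mod g (a ^+ M).
  rewrite E2; apply: radD.
  - by rewrite rpredM.
  - by rewrite rpredM.
  - exists N, (u * u' ^+ N), (v * u' ^+ N).
    split; rewrite ?rpredM ?rpredX // exprMn E1; ring.
  - by exists 1%N, 0, v'; split; rewrite ?rpred0 // expr1 mulr0 add0r.
by move=> [k [p [q [Sp Sq E3]]]]; exists (M * k)%N, p, q; rewrite exprM.
Qed.

(** The sum 1 lies in the radical of (g, d), so 1 = g u + d v for some u, v; then g u = 1 - d v is a
    unit and the map can be rescaled. *)
Lemma unit_value m (f : 'I_m -> U -> V) (x : 'I_m -> U) :
    (forall i, F (f i)) -> (forall i, X (x i)) -> \sum_i f i (x i) = 1 ->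
  exists f' x', [/\ F f', X x' & f' x' = 1].
Proof.
case: m f x => [|m] f x Ff Xx; first by rewrite big_ord0 => /esym/eqP; rewrite oner_eq0.
move=> sum1; have [f1 [x1 [Ff1 Xx1 r1]]] := value_family (Ff ord0) (Xx ord0) Ff Xx.
set g := f1 x1 in r1; have Sg : g \in S by apply: FX.
have : \sum_i f i (x i) \in S /\ rad_mod g (\sum_i f i (x i)).
  elim/big_ind: _ => [|y t [Sy ry] [St rt]|i _].
  - split; first exact: rpred0.
    by exists 1%N, 0, 0; split; rewrite ?rpred0 // !mulr0 addr0.
  - by split; [apply: rpredD | apply: rad_modD].
  - by split; [apply: FX | apply: r1].
rewrite sum1 => -[_ [N [u [v [Su Sv]]]]]; rewrite expr1n => E1.
have [|w Sw Ew] := unit1D (c := - v); first by rewrite rpredN.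
(* The zero term only gives the multiple of [f1] the shape required by [FD]. *)
exists (fun y => (w * u) * f1 y + 0 * f1 y), x1.
split=> //; first by apply: FD; rewrite ?rpred0 // rpredM.
have Eg : 1 + d * - v = g * u by rewrite mulrN {1}E1 addrK.
by rewrite mul0r addr0 -/g -Ew Eg; ring.
Qed.

End UnitValue.

(** * Integers prime to [l], and Horner tails of polynomials *)

Definition nondvd (l : nat) (m : int) : bool := ~~ (l %| m)%Z.

Lemma nondvdM l m n : prime l -> nondvd l (m * n) = nondvd l m && nondvd l n.
Proof. by move=> pl; rewrite /nondvd !dvdzE abszM Euclid_dvdM // negb_or. Qed.

Lemma nondvd1 l : prime l -> nondvd l 1.
Proof. by move=> pl; rewrite /nondvd dvdzE dvdn1; case: l pl => [|[]]. Qed.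

Lemma nondvdX l m k : prime l -> nondvd l m -> nondvd l (m ^+ k).
Proof.
by move=> pl fm; elim: k => [|k IHk]; rewrite ?nondvd1 // exprS nondvdM ?fm.
Qed.

Lemma nondvd_bezout l m : prime l -> nondvd l m ->
  exists u v : int, u * m = 1 + l%:Z * v.
Proof.
move=> pl fm; have : coprimez l%:Z m.
  by rewrite /coprimez -[_ == _]/(coprime l `|m|) prime_coprime.
move/coprimezP=> [[u v] /= uv1].
by exists v, (- u); rewrite -uv1; ring.
Qed.

Lemma drop_polyS (R : nzRingType) (p : {poly R}) i :
  drop_poly i p = 'X * drop_poly i.+1 p + (p`_i)%:P.
Proof.
apply/polyP=> j; rewrite coefD coefXM coefC !coef_drop_poly.
by case: j => [|j] /=; rewrite ?add0r // addr0 addSnnS.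
Qed.

Lemma pi_regular_step (R : comNzRingType) N (b Z c w T : R) :
  (b * Z + c) * b ^+ N = T -> c * w = 1 -> b ^+ N * (1 - b * - (w * Z)) = w * T.
Proof. by move=> <- cw; rewrite -[in LHS]cw; ring. Qed.

(** * Integral elements *)

Section IntEval.
Variable V : comNzRingType.

Definition zev (a : V) : {rmorphism {poly int} -> V} :=
  horner_morph (fun m : int => mulrC a m%:~R).

Lemma zevE a p : zev a p = (map_poly intr p).[a].
Proof. by []. Qed.

Lemma zevX a : zev a 'X = a.
Proof. by rewrite zevE map_polyX hornerX. Qed.

Lemma zevC a c : zev a c%:P = c%:~R.
Proof. by rewrite zevE map_polyC hornerC. Qed.

Lemma zevZ a c p : zev a (c *: p) = c%:~R * zev a p.
Proof. by rewrite -mul_polyC rmorphM /= zevC. Qed.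

Lemma zev_sum a n (p : {poly int}) : (size p <= n)%N ->
  zev a p = \sum_(i < n) (p`_i)%:~R * a ^+ i.
Proof.
move=> lepn; have -> : p = \sum_(i < n) p`_i *: 'X^i.
  rewrite -poly_def; apply/polyP=> i; rewrite coef_poly.
  by case: ltnP => // leni; rewrite nth_default // (leq_trans lepn).
rewrite rmorph_sum; apply: eq_bigr => i _ /=.
rewrite coef_sum (bigD1 i) //= big1 => [|j neji].
  by rewrite coefZ coefXn eqxx mulr1 addr0 zevZ rmorphXn zevX.
by rewrite coefZ coefXn eq_sym (inj_eq val_inj) (negbTE neji) mulr0.
Qed.

Lemma zev_in (S : subringClosed V) a p : a \in S -> zev a p \in S.
Proof.
move=> Sa; rewrite (zev_sum a (leqnn _)) rpred_sum // => i _.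
by rewrite rpredM ?rpredX // rpred_int.
Qed.

Definition integral_elt (a : V) : Prop :=
  exists2 q : {poly int}, q \is monic & zev a q = 0.

Definition primitive_root_at (l : nat) (a : V) : Prop :=
  exists2 p : {poly int}, (exists i, nondvd l p`_i) & zev a p = 0.

(** Determinant trick: the adjugate turns (b - A) w = 0 into det(b - A) w = 0, and the coordinate of
    [w] equal to 1 removes [w]. *)
Lemma eigen_integral n (A : 'M[int]_n) (w : 'cV[V]_n) (b : V) (i0 : 'I_n) :
  w i0 ord0 = 1 -> b *: w = map_mx intr A *m w -> integral_elt b.
Proof.
move=> w1 bw; exists (char_poly A); first exact: char_poly_monic.
have mapE : map_mx (zev b) (char_poly_mx A) = b%:M - map_mx intr A.
  apply/matrixP=> i j; rewrite !mxE rmorphB /= zevC rmorphMn /= zevX.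
  by [].
rewrite /char_poly -det_map_mx mapE.
set D := \det _; have: D *: w = 0.
  rewrite -mul_scalar_mx -mul_adj_mx -mulmxA mulmxBl mul_scalar_mx bw subrr.
  exact: mulmx0.
by move/matrixP/(_ i0 ord0); rewrite !mxE w1 mulr1.
Qed.

(** Multiplication by the Horner tail preserves the Z-span of 1, t, ..., t^(n-1): on t^i with i <= k
    the degree stays below n, and for i > k the relation p(t) = 0 trades the tail for the truncated
    part. *)
Lemma drop_poly_integral (t : V) (p : {poly int}) k : p != 0 ->
  zev t p = 0 -> integral_elt (zev t (drop_poly k p)).
Proof.
move=> nzp pt0; set n := size p; have n_gt0 : (0 < n)%N by rewrite size_poly_gt0.
have rep (i : 'I_n) : exists2 r : {poly int}, (size r <= n)%N &
    zev t (drop_poly k p) * t ^+ i = zev t r.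
  have [leik|ltki] := leqP i k.
    exists (drop_poly k p * 'X^i); last by rewrite rmorphM rmorphXn /= zevX.
    apply: leq_trans (size_polyMleq _ _) _; rewrite size_polyXn addnS /=.
    rewrite size_drop_poly; have [lekn|/ltnW ltnk] := leqP k n.
      by apply: leq_trans (leq_add (leqnn _) leik) _; rewrite subnK.
    by rewrite (_ : n - k = 0)%N ?add0n 1?ltnW //; apply/eqP; rewrite subn_eq0.
  exists (- (take_poly k p * 'X^(i - k))).
    rewrite size_polyN; apply: leq_trans (size_polyMleq _ _) _.
    rewrite size_polyXn addnS /=.
    apply: leq_trans (leq_add (size_take_poly _ _) (leqnn _)) _.
    by rewrite subnKC ?(ltnW ltki) // ltnW.
  have := pt0; rewrite -{1}(poly_take_drop k p) rmorphD rmorphM rmorphXn /= zevX.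
  move/eqP; rewrite addrC addr_eq0 => /eqP E.
  by rewrite -{1}(subnKC (ltnW ltki)) exprD mulrA E rmorphN rmorphM rmorphXn /= zevX mulNr.
have [r r_n rE] := fin_all_exists2 rep.
apply: (@eigen_integral n (\matrix_(i, j) (r i)`_j) (\col_i t ^+ i) _ (Ordinal n_gt0)).
  by rewrite mxE.
apply/matrixP=> i j; rewrite !mxE rE (zev_sum t (r_n i)).
by apply: eq_bigr => u _; rewrite !mxE.
Qed.

End IntEval.

(** * Gcds in rings localised at a prime number *)

Section LocalBezout.
Variables (V : comNzRingType) (S : subringClosed V) (l : nat).
Hypothesis unitS : forall m : int, nondvd l m ->
  exists2 w, w \in S & m%:~R * w = 1 :> V.
Hypothesis algV : forall t : V, primitive_root_at l t.

(** Let N be the least index with p_N prime to [l]. The terms below N vanish modulo [l], which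
    leaves a^N (p_N + a Z) in l S, with p_N a unit. *)
Lemma local_pi_regular (a : V) : a \in S ->
  exists N : nat, exists b c,
    [/\ b \in S, c \in S & a ^+ N * (1 - a * b) = l%:R * c].
Proof.
move=> Sa; have [p exp pa0] := algV a.
case: (ex_minnP exp) => N fN minN.
have [w Sw Ew] := unitS fN.
pose Z := zev a (drop_poly N.+1 p).
exists N, (- (w * Z)).
have /polyOver_dvdzP[t Et] : take_poly N p \is a polyOver (dvdz l).
  apply/polyOverP=> i; rewrite coef_take_poly; case: ltnP => [ltiN|_]; last exact: rpred0.
  by apply: contraLR ltiN => /minN; rewrite -leqNgt.
pose T := zev a t.
exists (- (w * T)); split; rewrite ?rpredN ?rpredM ?zev_in //.
have := pa0; rewrite -{1}(poly_take_drop N p) Et rmorphD zevZ rmorphM rmorphXn /=.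
rewrite drop_polyS rmorphD rmorphM /= zevX zevC => E.
have {}E : (a * Z + (p`_N)%:~R) * a ^+ N = - (l%:R * T).
  by apply/eqP; rewrite -addr_eq0 addrC E.
by rewrite (pi_regular_step E Ew); ring.
Qed.

Hypothesis integralS : forall b, integral_elt b -> b \in S.
Hypothesis unit1D : forall c, c \in S -> exists2 w, w \in S & (1 + l%:R * c) * w = 1.

(* For a primitive relation p(t) = 0 the partial Horner sums d_k of p at t and
   t d_(k+1) = d_k - p_k are integral, so that S + S t is invertible. *)
Lemma local_bezout (t : V) : exists c r a b,
  [/\ c = a + b * t, [/\ a \in S, b \in S, r \in S & r * t \in S] & r * c = 1].
Proof.
have [p [k fk] pt0] := algV t; have [w Sw Ew] := unitS fk.
have nzp : p != 0.
  by apply: contraTneq fk => ->; rewrite coef0 /nondvd dvdz0.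
pose D i := zev t (drop_poly i p).
have SD i : D i \in S by apply: integralS; apply: drop_poly_integral.
have DS i : D i = D i.+1 * t + (p`_i)%:~R.
  by rewrite /D mulrC drop_polyS rmorphD rmorphM /= zevX zevC.
have SDt i : D i * t \in S.
  case: i => [|i]; last first.
    have -> : D i.+1 * t = D i - (p`_i)%:~R by rewrite (DS i) addrK.
    by rewrite rpredB // rpred_int.
  by rewrite /D drop_poly0l pt0 mul0r rpred0.
pose X y := exists a b, [/\ a \in S, b \in S & y = a + b * t].
(* [X] is the fractional ideal S + S t, and [F] consists of the multiplications by elements of its
   inverse. *)
pose F (f : V -> V) := exists r, [/\ r \in S, r * t \in S & forall x, f x = r * x].
have XD a b x y : a \in S -> b \in S -> X x -> X y -> X (a * x + b * y).
  move=> Sa Sb [a1 [b1 [Sa1 Sb1 ->]]] [a2 [b2 [Sa2 Sb2 ->]]].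
  exists (a * a1 + b * a2), (a * b1 + b * b2).
  by split; rewrite ?rpredD ?rpredM //; ring.
have FD a b f g : a \in S -> b \in S -> F f -> F g ->
    F (fun x => a * f x + b * g x).
  move=> Sa Sb [r [Sr Srt fE]] [r' [Sr' Sr't gE]].
  exists (a * r + b * r'); split; first by rewrite rpredD ?rpredM.
    by rewrite mulrDl -!mulrA; apply: rpredD; apply: rpredM.
  by move=> x; rewrite fE gE; ring.
have FX f x : F f -> X x -> f x \in S.
  move=> [r [Sr Srt fE]] [a [b [Sa Sb ->]]]; rewrite fE mulrDr mulrCA.
  by apply: rpredD; apply: rpredM.
have Flin f a b x y : F f -> f (a * x + b * y) = a * f x + b * f y.
  by move=> [r [_ _ fE]]; rewrite !fE; ring.
(* The two values add up to w (D_k - D_(k+1) t) = w p_k = 1. *)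
pose fs (i : 'I_2) x := if val i == 0%N then w * D k * x else - (w * D k.+1) * x.
pose xs (i : 'I_2) := if val i == 0%N then 1 else t.
have [|||f [x]] := unit_value (rpred_nat _ _) local_pi_regular unit1D XD FD FX
  Flin (f := fs) (x := xs).
- move=> [[|[|//]] i]; rewrite /fs /=; [exists (w * D k) | exists (- (w * D k.+1))];
    split;
    by rewrite ?mulNr ?rpredN -?mulrA //; apply: rpredM.
- move=> [[|[|//]] i]; rewrite /xs /=.
    by exists 1, 0; rewrite rpred1 rpred0; split=> //; ring.
  by exists 0, 1; rewrite rpred1 rpred0; split=> //; ring.
- by rewrite big_ord_recl big_ord1 /fs /xs /= (DS k) -[RHS]Ew; ring.
move=> [[r [Sr Srt fE]] [a [b [Sa Sb xE]]] fx1].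
by exists x, r, a, b; split=> //; rewrite -fE.
Qed.

(** [c] generates the S-module spanned by 1 and [s]: the first clause puts [c] in that module, the
    other two put 1 and [s] in S c. The presence of 1 makes [c] invertible. *)
Lemma local_bezout_seq (s : seq V) : exists c : V,
  [/\ forall Y : V -> Prop,
        (forall a b x y, a \in S -> b \in S -> Y x -> Y y -> Y (a * x + b * y)) ->
        Y 1 -> (forall t, t \in s -> Y t) -> Y c,
      exists2 r, r \in S & r * c = 1
    & forall t, t \in s -> exists2 r, r \in S & t = r * c].
Proof.
elim: s => [|t s [c [cY [r Sr rc] cs]]].
  by exists 1; split=> //; exists 1; rewrite ?rpred1 ?mul1r.
(* [r] is the inverse of [c], so S c + S t is c times S + S (r t). *)
have [c' [r' [a [b [c'E [Sa Sb Sr' Sr't] rc'1]]]]] := local_bezout (r * t).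
exists (c' * c); split=> [Y YD Y1 Ys||t'].
- rewrite c'E; have -> : (a + b * (r * t)) * c = a * c + b * (r * c * t) by ring.
  rewrite rc mul1r; apply: (YD) => //; last by apply: Ys; rewrite mem_head.
  by apply: cY => // t' s_t'; apply: Ys; rewrite inE s_t' orbT.
- by exists (r' * r); rewrite ?rpredM // mulrACA rc'1 rc mulr1.
rewrite inE => /predU1P[->|/cs[q Sq ->]].
  exists (r' * (r * t)) => //.
  have -> : r' * (r * t) * (c' * c) = (r' * c') * (r * c) * t by ring.
  by rewrite rc'1 rc !mul1r.
exists (q * r'); rewrite ?rpredM //.
have -> : q * r' * (c' * c) = q * (r' * c') * c by ring.
by rewrite rc'1 mulr1.
Qed.

End LocalBezout.

(** * Torsion-free abelian groups of finite rank *)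

Definition finite_rank (V : zmodType) : Prop :=
  exists (D : nat) (f : V -> 'rV[rat]_D), {morph f : x y / x - y} /\ injective f.

Lemma morphB_intr (V W : zmodType) (f : V -> W) : {morph f : x y / x - y} ->
  (forall x m, f (x *~ m) = f x *~ m) /\ {morph f : x y / x + y}.
Proof.
move=> fB; have f0 : f 0 = 0 by rewrite -(subrr 0) fB subrr.
have fN x : f (- x) = - f x by rewrite -sub0r fB f0 sub0r.
have fD : {morph f : x y / x + y} by move=> x y; rewrite -{1}[y]opprK fB fN opprK.
split=> // x; elim/int_ind=> [|n IHn|n IHn]; rewrite ?mulr0z //.
- by rewrite intS !mulrzDr fD IHn !mulr1z.
- by rewrite intS opprD !mulrzDr fD IHn !mulrN1z fN.
Qed.

Lemma primitive_relation (V : zmodType) (l : nat) : prime l -> finite_rank V ->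
  exists D, forall x : 'I_D.+1 -> V, exists c : 'I_D.+1 -> int,
    (exists i, nondvd l (c i)) /\ \sum_i x i *~ c i = 0.
Proof.
move=> pl [D [f [fB f_inj]]]; exists D => x.
have [fZ fD] := morphB_intr fB.
have f0 : f 0 = 0 by rewrite -(subrr 0) fB subrr.
pose A : 'M[rat]_(D.+1, D) := \matrix_i f (x i).
have : kermx A != 0.
  by rewrite -mxrank_eq0 mxrank_ker subn_eq0 -ltnNge ltnS rank_leq_col.
rewrite -nz_row_eq0; set v := nz_row _ => nzv.
have vA : v *m A = 0 by apply/sub_kermxP; apply: nz_row_sub.
(* The vector of coefficients is read as a polynomial, so that dividing by the content makes the
   relation primitive. *)
have [q [a nza Dv]] := rat_poly_scale (rVpoly v).
have nzq : q != 0.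
  apply: contraNneq nzv => q0; rewrite -[v]rVpolyK Dv q0.
  by rewrite map_poly0 scaler0 raddf0.
pose k : rat := a%:~R^-1 * (zcontents q)%:~R.
have nzk : k != 0.
  by rewrite mulf_neq0 ?invr_eq0 ?intr_eq0 ?zcontents_eq0.
have vE i : v ord0 i = k * ((zprimitive q)`_i)%:~R.
  rewrite -[v in LHS]rVpolyK mxE Dv coefZ coef_map /= {1}[q]zpolyEprim coefZ.
  by rewrite intrM mulrA.
have sz_q : (size (zprimitive q) <= D.+1)%N.
  rewrite size_zprimitive -(size_map_inj_poly (@intr_inj rat)) //.
  have <- : size (rVpoly v) = size (map_poly (intr : int -> rat) q).
    by rewrite Dv size_scale ?invr_eq0 ?intr_eq0.
  exact: size_poly.
exists (fun i => (zprimitive q)`_i); split.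
  apply: contrapT => no_i.
  have : (l %| zcontents (zprimitive q))%Z.
    rewrite dvdz_contents; apply/polyOverP=> i.
    have [ltiD|leDi] := ltnP i D.+1; last by rewrite nth_default ?rpred0 // (leq_trans sz_q).
    by apply: contrapT => /negP fi; apply: no_i; exists (Ordinal ltiD).
  by rewrite zcontents_primitive nzq; apply/negP; apply: nondvd1.
apply: f_inj; rewrite f0 (big_morph f fD f0).
transitivity (k^-1 *: (v *m A)); last by rewrite vA scaler0.
rewrite mulmx_sum_row scaler_sumr; apply: eq_bigr => i _.
by rewrite rowK vE scalerA mulKf // fZ scaler_int.
Qed.

(* A subgroup of a rational vector space of finite dimension is generated
   modulo l by any maximal family that is independent modulo l. *)
Lemma generators_mod (V : zmodType) (l : nat) (Y : V -> Prop) :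
    prime l -> finite_rank V -> Y 0 -> (forall x y, Y x -> Y y -> Y (x - y)) ->
  exists r (z : 'I_r -> V), (forall i, Y (z i)) /\
    forall x, Y x -> exists (c : 'I_r -> int) (x' : V),
      Y x' /\ x = \sum_i z i *~ c i + x' *~ l.
Proof.
move=> pl fV Y0 YB; have [D rel] := primitive_relation pl fV.
have YN x : Y x -> Y (- x) by move=> Yx; rewrite -sub0r; apply: YB.
have YD x y : Y x -> Y y -> Y (x + y) by move=> Yx Yy; rewrite -[y]opprK; apply/YB/YN.
have YZ x m : Y x -> Y (x *~ m).
  move=> Yx; elim/int_ind: m => [|n IHn|n IHn]; first by rewrite mulr0z.
    by rewrite intS mulrzDr mulr1z; apply: YD.
  by rewrite intS opprD mulrzDr mulrN1z; apply: YD => //; apply: YN.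
pose indep r (z : 'I_r -> V) := forall (c : 'I_r -> int) x', Y x' ->
  \sum_i z i *~ c i = x' *~ l -> forall i, ~~ nondvd l (c i).
pose P r := `[< exists z : 'I_r -> V, (forall i, Y (z i)) /\ indep r z >].
have P0 : P 0%N by apply/asboolP; exists (fun=> 0); split=> [[]|c x' _ _ []].
have exP : exists r, ~~ P r.+1.
  exists D; apply/asboolPn=> -[z [Yz iz]].
  have [c [[i fi] c0]] := rel z.
  by have := iz c 0 Y0; rewrite mul0rz => /(_ c0 i)/negP.
have [r Pr nPr] : exists2 r, P r & ~~ P r.+1.
  case: (ex_minnP exP) => r nPr minr; exists r => //.
  case: r nPr minr => // r _ minr; apply: contraT => /minr.
  by rewrite ltnn.
move: Pr => /asboolP[z [Yz iz]].
exists r, z; split=> // x Yx.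
pose z' (i : 'I_r.+1) := if unlift ord0 i is Some j then z j else x.
have /existsNP[c /existsNP[x' /not_implyP[Yx' /not_implyP[cE /existsNP[i /negP/negPn fi]]]]] :
    ~ indep r.+1 z'.
  move=> iz'; move/asboolP: nPr; apply; exists z'; split=> // i; rewrite /z'.
  by case: unliftP => [j|] _.
move: cE; rewrite big_ord_recl {1}/z' unlift_none.
rewrite (eq_bigr (fun j : 'I_r => z j *~ c (lift ord0 j))); last first.
  by move=> j _; rewrite /z' liftK.
(* If [l] divided the coefficient of [x], that term could be moved into l Y, and the independence of
   [z] would contradict [fi]. *)
move=> cE; have f0 : nondvd l (c ord0).
  apply: contraT; rewrite negbK => /dvdzP[k ck].
  case: (unliftP ord0 i) fi => [j ->|->]; last by rewrite ck /nondvd dvdz_mull.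
  move=> fi; suff /negP : ~~ nondvd l (c (lift ord0 j)) by [].
  apply: (iz (fun j => c (lift ord0 j)) (x' - x *~ k)).
    by apply: YB => //; apply: YZ.
  by rewrite mulrzBl -mulrzA -ck -cE addrC addKr.
have [u [v uv]] := nondvd_bezout pl f0.
exists (fun j => - (u * c (lift ord0 j))), (x' *~ u - x *~ v).
split; first by apply: YB; apply: YZ.
have -> : x = x *~ (u * c ord0 - l%:Z * v) by rewrite uv addrK mulr1z.
have -> : \sum_j z j *~ (- (u * c (lift ord0 j))) =
    - ((x' *~ l - x *~ c ord0) *~ u).
  rewrite -cE addrC addKr mulrz_suml -sumrN; apply: eq_bigr => j _.
  by rewrite mulrNz mulrC mulrzA.
rewrite uv addrK mulr1z.
rewrite !mulrzBl opprB -!mulrzA.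
have -> : c ord0 * u = 1 + v * l by rewrite mulrC uv mulrC.
rewrite mulrzDr mulr1z [l%:Z * u]mulrC addrA subrK addrK.
by [].
Qed.

(** * Algebraic integers with the integers prime to [l] inverted *)

Definition local_integers (l : nat) (pl : prime l) (F : fieldType) : {pred F} :=
  fun x => `[< exists2 m : int, nondvd l m & m%:~R * x \in @algebraic_integer F >].

Arguments local_integers [l] pl F.

Section LocalIntegers.
Variables (l : nat) (pl : prime l) (F : fieldType).
Local Notation OF := (local_integers pl F).

Lemma local_integersP x : reflect
  (exists2 m : int, nondvd l m & m%:~R * x \in @algebraic_integer F)
  (x \in OF).
Proof. exact: asboolP. Qed.

Lemma algebraic_integerE (x : F) :
  (x \in @algebraic_integer F) <-> integral_elt x.
Proof.
split=> [/asboolP[q mq /eqP q0]|[q mq q0]]; first by exists q.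
by apply/asboolP; exists q => //; apply/eqP.
Qed.

Lemma algebraic_local x : x \in @algebraic_integer F -> x \in OF.
Proof.
by move=> xi; apply/local_integersP; exists 1; rewrite ?nondvd1 // mulr1z mul1r.
Qed.

Fact local_integers_subring : subring_closed OF.
Proof.
split=> [|x y /local_integersP[m fm mx] /local_integersP[n fn ny]
         |x y /local_integersP[m fm mx] /local_integersP[n fn ny]].
- exact/algebraic_local/rpred1.
- apply/local_integersP; exists (m * n); first by rewrite nondvdM // fm.
  have -> : (m * n)%:~R * (x - y) = n%:~R * (m%:~R * x) - m%:~R * (n%:~R * y).
    by rewrite intrM; ring.
  by rewrite rpredB // rpredM // rpred_int.
- apply/local_integersP; exists (m * n); first by rewrite nondvdM // fm.
  by rewrite intrM mulrACA rpredM.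
Qed.
HB.instance Definition _ := GRing.isSubringClosed.Build F
  OF local_integers_subring.

Hypothesis finF : finite_rank F.

Lemma finite_rank_intr_eq0 (m : int) : (m%:~R == 0 :> F) = (m == 0).
Proof.
apply/idP/eqP=> [/eqP m0|->//]; have [D [f [fB f_inj]]] := finF.
have [fZ _] := morphB_intr fB.
have f0 : f 0 = 0 by rewrite -(subrr 0) fB subrr.
have : m%:~R *: f 1 = 0 by rewrite scaler_int -fZ m0.
move/eqP; rewrite scaler_eq0 intr_eq0 => /orP[/eqP//|/eqP f1].
by have := oner_neq0 F; rewrite -(inj_eq f_inj) f1 f0 eqxx.
Qed.

Lemma nondvd_neq0 (m : int) : nondvd l m -> m%:~R != 0 :> F.
Proof. by rewrite finite_rank_intr_eq0; apply: contraTneq => ->; rewrite /nondvd dvdz0. Qed.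

Lemma nondvd_invr_local m : nondvd l m -> (m%:~R)^-1 \in OF.
Proof.
move=> fm; apply/local_integersP; exists m => //.
by rewrite divff ?nondvd_neq0 ?rpred1.
Qed.

Lemma nondvd_unit_local m : nondvd l m ->
  exists2 w, w \in OF & m%:~R * w = 1.
Proof. by move=> fm; exists (m%:~R)^-1; rewrite ?nondvd_invr_local // divff ?nondvd_neq0. Qed.

Lemma field_primitive_root (V : comNzRingType) : finite_rank V ->
  forall t : V, primitive_root_at l t.
Proof.
move=> fV t; have [D rel] := primitive_relation pl fV.
have [c [[i fi] c0]] := rel (fun i => t ^+ i).
exists (\poly_(j < D.+1) c (inord j)).
  by exists i; rewrite coef_poly ltn_ord inord_val.
rewrite (zev_sum _ (size_poly _ _)) -[RHS]c0; apply: eq_bigr => j _.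
by rewrite coef_poly ltn_ord inord_val mulrzl.
Qed.

Lemma integral_local b : integral_elt b -> b \in OF.
Proof. by move=> ib; apply/algebraic_local/algebraic_integerE. Qed.

(* If y has monic equation q of degree d, then m + l y is a root of
   l^d q((X - m)/l), whose constant term is prime to l. *)
Lemma local_unit1D c : c \in OF ->
  exists2 w, w \in OF & (1 + l%:R * c) * w = 1.
Proof.
move=> Sc; have /local_integersP[m fm /algebraic_integerE[q mq q0]] := Sc.
set y := _ * c in q0.
have [d sz_q] : exists d, size q = d.+1.
  by exists (size q).-1; rewrite prednK // lt0n size_poly_eq0 monic_neq0.
pose Q : {poly int} := \sum_(i < d.+1) (q`_i * l%:Z ^+ (d - i)) *: ('X - m%:P) ^+ i.
pose s : F := m%:~R + l%:R * y.
have Q0 : zev s Q = 0.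
  transitivity (l%:R ^+ d * zev y q); last by rewrite q0 mulr0.
  rewrite (zev_sum y (eq_leq sz_q)) mulr_sumr rmorph_sum; apply: eq_bigr => i _ /=.
  rewrite zevZ rmorphXn rmorphB /= zevX zevC /s addrC addKr exprMn intrM.
  have dE : l%:R ^+ d = l%:R ^+ (d - i) * l%:R ^+ i :> F.
    by rewrite -exprD subnK // -ltnS.
  by rewrite dE rmorphXn /=; ring.
(* Modulo [l] only the top term survives, so Q(0) is congruent to (-m)^d. *)
have fQ : nondvd l Q`_0.
  rewrite -horner_coef0 /Q horner_sum big_ord_recr /= subnn expr0 mulr1.
  have -> : q`_d = 1 by move/monicP: mq; rewrite /lead_coef sz_q.
  rewrite scale1r horner_exp hornerXsubC sub0r.
  have fmd : nondvd l ((- m) ^+ d) by rewrite nondvdX // /nondvd dvdzE abszN.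
  rewrite /nondvd; apply: contra fmd; rewrite rpredDl //.
  rewrite rpred_sum // => i _; rewrite hornerZ.
  have -> : (d - i = (d - i).-1.+1)%N by rewrite prednK // subn_gt0.
  rewrite -[_ \in _]/(l %| _)%Z; apply/dvdz_mulr/dvdz_mull.
  by rewrite exprS dvdz_mulr.
have Q_E : Q = 'X * drop_poly 1 Q + (Q`_0)%:P by rewrite -drop_polyS drop_poly0l.
have [v Sv vE] := nondvd_unit_local fQ.
have sE : s = m%:~R * (1 + l%:R * c) by rewrite /s /y; ring.
have Ss : s \in OF.
  by rewrite sE rpredM ?rpredD ?rpred_int ?rpred1 // rpredM // rpred_nat.
pose T := zev s (drop_poly 1 Q).
have E : s * T = - (Q`_0)%:~R.
  apply/eqP; rewrite -addr_eq0; apply/eqP; rewrite -[RHS]Q0 [in RHS]Q_E.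
  by rewrite rmorphD rmorphM /= zevX zevC.
exists (- (m%:~R * T * v)); first by rewrite rpredN !rpredM ?zev_in // rpred_int.
rewrite -[RHS]vE; transitivity (- (s * T) * v); first by rewrite sE; ring.
by rewrite E opprK.
Qed.

Lemma field_bezout_seq (s : seq F) : exists c : F,
  [/\ forall Y : F -> Prop,
        (forall a b x y, a \in OF -> b \in OF ->
           Y x -> Y y -> Y (a * x + b * y)) ->
        Y 1 -> (forall t, t \in s -> Y t) -> Y c,
      exists2 r, r \in OF & r * c = 1
    & forall t, t \in s -> exists2 r, r \in OF & t = r * c].
Proof.
apply: local_bezout_seq nondvd_unit_local (field_primitive_root finF) _ _ s.
- exact: integral_local.
- exact: local_unit1D.
Qed.

Lemma field_pi_regular a : a \in OF -> exists N : nat, exists b c,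
  [/\ b \in OF, c \in OF & a ^+ N * (1 - a * b) = l%:R * c].
Proof. exact: local_pi_regular nondvd_unit_local (field_primitive_root finF) _. Qed.

End LocalIntegers.

(** * Dual pairs *)

Section GaloisExpansion.
Variables (K : fieldType) (L : splittingFieldType K).
Hypothesis galL : galois 1 {:L}.
Local Notation gT := (gal_of {:L}).
Implicit Types (g s t : gT).

Lemma galMf g s x : (g * s)%g x = s (g x).
Proof. by rewrite galM ?memvf. Qed.

Lemma card_gal_full : \dim {:L} = #|{: gT}|.
Proof.
have := galois_dim galL; rewrite dimv1 divn1 => ->.
by apply: eq_card => g; rewrite (gal_kHom _ (sub1v _)) k1AHom.
Qed.

Lemma gal_scalar g (k : K) x : g (k *: x) = k *: g x.
Proof. exact: linearZ. Qed.

Lemma gal_fixed_scalar x : (forall g, g x = x) -> exists k : K, x = k%:A.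
Proof.
move=> gx; have /galois_fixedField fE := galL.
have : x \in fixedField 'Gal({:L} / 1)%g.
  by apply/fixedFieldP; rewrite ?memvf // => g _.
by rewrite fE => /vlineP[k ->]; exists k.
Qed.

Lemma gal_sum_fixed g (f : L) : g (\sum_(s : gT) s f) = \sum_(s : gT) s f.
Proof.
rewrite linear_sum [RHS](reindex_inj (mulIg g)) /=.
by apply: eq_bigr => s _; rewrite galMf.
Qed.

Definition gal_trace (x : L) : L := \sum_(s : gT) s x.

Lemma gal_trace_scalar x : exists k : K, gal_trace x = k%:A.
Proof. by apply: gal_fixed_scalar => g; apply: gal_sum_fixed. Qed.

Lemma gal_indep (c : gT -> L) :
  (forall x, \sum_g c g * g x = 0) -> forall g, c g = 0.
Proof.
move=> c0 g; apply: (@gal_independent _ _ _ xpredT) (isT : xpredT g) => x _.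
exact: c0.
Qed.

(** The list [r] stands for an element of L (x) L, evaluated by the ring morphism x (x) y |-> x
    g(y). *)
Definition pair_eval (r : seq (L * L)) g : L := \sum_(p <- r) p.1 * g p.2.

(** Evaluation at g is multiplicative in the tensor, so one multiplies, over s <> 1, tensors that
    vanish at s and take the value m s at 1. *)
Lemma separating_pairs (S : {pred L}) (m : gT -> L) :
    subring_closed S -> (forall g x, x \in S -> g x \in S) ->
    (forall g, g != 1%g -> exists2 r : seq (L * L),
       (forall p, p \in r -> p.1 \in S /\ p.2 \in S)
       & \sum_(p <- r) p.1 * (p.2 - g p.2) = m g) ->
  exists2 r : seq (L * L), (forall p, p \in r -> p.1 \in S /\ p.2 \in S)
    & forall g, pair_eval r g = if g == 1%g then \prod_(s | s != 1%g) m s else 0.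
Proof.
move=> [S1 SB SM] Sg Hm.
have S0 : 0 \in S by rewrite -(subrr 1) SB.
have SN x : x \in S -> - x \in S by move=> Sx; rewrite -sub0r SB.
have SD x y : x \in S -> y \in S -> x + y \in S.
  by move=> Sx Sy; rewrite -[y]opprK SB // SN.
suff [r rS rE] : exists2 r : seq (L * L),
    (forall p, p \in r -> p.1 \in S /\ p.2 \in S)
    & pair_eval r 1%g = \prod_(s <- index_enum gT | s != 1%g) m s /\
      forall g, g \in index_enum gT -> g != 1%g -> pair_eval r g = 0.
  exists r => // g; case: rE => r1 rg; case: eqVneq => [->|ng1].
    exact: r1.
  by rewrite rg // mem_index_enum.
elim: (index_enum _) => [|s e [r rS [r1 rg]]].
  exists [:: (1, 1)]; first by move=> p; rewrite inE => /eqP->.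
  by split=> //; rewrite /pair_eval big_seq1 big_nil mul1r gal_id.
have [s1|ns1] := eqVneq s 1%g.
  exists r => //; split=> [|g]; first by rewrite big_cons s1 eqxx /= r1.
  rewrite inE => /predU1P[->|eg]; first by rewrite s1 eqxx.
  exact: rg.
have [r' r'S r'E] := Hm s ns1.
(* The pair (c, 1) shifts the values of r' so that the one at [s] becomes 0. *)
pose c := - \sum_(p <- r') p.1 * s p.2.
have Sc : c \in S.
  apply: SN; rewrite big_seq; elim/big_ind: _ => // p /r'S[Sp1 Sp2].
  by apply: SM => //; apply: Sg.
pose r2 := (c, 1) :: r'.
have r2S p : p \in r2 -> p.1 \in S /\ p.2 \in S.
  by rewrite inE => /predU1P[->|/r'S].
have r2E g : pair_eval r2 g = \sum_(p <- r') p.1 * (g p.2 - s p.2).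
  rewrite /pair_eval big_cons /= rmorph1 mulr1 addrC /c -sumrB.
  by apply: eq_bigr => p _; rewrite mulrBr.
exists [seq (p.1 * q.1, p.2 * q.2) | p <- r, q <- r2].
  move=> _ /allpairsP[[p q] [/rS[p1 p2] /r2S[q1 q2] ->]] /=.
  by split; apply: SM.
have prodE g : pair_eval [seq (p.1 * q.1, p.2 * q.2) | p <- r, q <- r2] g =
    pair_eval r g * pair_eval r2 g.
  rewrite /pair_eval big_allpairs_dep big_distrlr /=.
  by apply: eq_bigr => p _; apply: eq_bigr => q _; rewrite rmorphM mulrACA.
split=> [|g].
  rewrite prodE big_cons ns1 r1 mulrC; congr (_ * _); rewrite r2E -r'E.
  by apply: eq_bigr => p _; rewrite gal_id.
rewrite inE prodE => /predU1P[-> _|eg ng]; last by rewrite rg ?mul0r.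
by rewrite r2E big1 ?mulr0 // => p _; rewrite subrr mulr0.
Qed.

Lemma dual_pairs : exists r, forall g, pair_eval r g = (g == 1%g)%:R.
Proof.
have [] := @separating_pairs xpredT (fun=> 1); [by [] | by [] | |].
  move=> g ng1; have /existsNP[x gx] : ~ (forall x, g x = x).
    move=> gx; case/eqP: ng1; apply/eqP/gal_eqP => x _.
    by rewrite gx gal_id.
  exists [:: ((x - g x)^-1, x)] => //.
  by rewrite big_seq1 mulVf // subr_eq0 eq_sym; apply/eqP.
by move=> r _ rE; exists r => g; rewrite rE big1 //; case: (g == 1%g).
Qed.

Lemma pair_eval_shift r g s :
  \sum_(p <- r) g p.1 * s p.2 = g (pair_eval r (s * g^-1)%g).
Proof.
rewrite /pair_eval raddf_sum; apply: eq_bigr => p _ /=.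
by rewrite rmorphM /= -galMf mulgKV.
Qed.

(** Dual pairs give x = sum Tr(p.1 x) p.2; apply f and expand the trace. *)
Lemma gal_expansion : exists coef : (L -> L) -> gT -> L,
  forall f : L -> L, linear f -> forall x, f x = \sum_g coef f g * g x.
Proof.
have [r rE] := dual_pairs.
exists (fun f g => \sum_(p <- r) g p.1 * f p.2) => f lf x.
have f_sum (I : Type) (e : seq I) (k : I -> K) (z : I -> L) :
    f (\sum_(i <- e) k i *: z i) = \sum_(i <- e) k i *: f (z i).
  have f0 : f 0 = 0 by have := lf (-1) 0 0; rewrite scaler0 addr0 scaleN1r addNr.
  by elim: e => [|i e IHe]; rewrite ?big_nil // !big_cons lf IHe.
have [tr trE] : {tr : L -> K | forall y, gal_trace y = (tr y)%:A}.
  exists (fun y => sval (cid (gal_trace_scalar y))) => y.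
  exact: svalP (cid (gal_trace_scalar y)).
have {1}-> : x = \sum_(p <- r) tr (p.1 * x) *: p.2.
  transitivity (\sum_(g : gT) (\sum_(p <- r) g p.1 * (1%g : gT) p.2) * g x).
    rewrite (bigD1 1%g) //= pair_eval_shift rE invg1 mulg1 eqxx !gal_id mul1r.
    rewrite big1 ?addr0 // => g ng; rewrite pair_eval_shift rE mul1g.
    by rewrite invg_eq1 (negbTE ng) rmorph0 mul0r.
  under eq_bigr do rewrite mulr_suml.
  rewrite exchange_big; apply: eq_bigr => p _ /=.
  rewrite -mulr_algl -trE /gal_trace mulr_suml; apply: eq_bigr => g _.
  by rewrite gal_id rmorphM /= mulrAC.
rewrite f_sum; under [RHS]eq_bigr do rewrite mulr_suml.
rewrite exchange_big; apply: eq_bigr => p _ /=.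
rewrite -mulr_algl -trE /gal_trace mulr_suml; apply: eq_bigr => g _.
by rewrite rmorphM /= mulrAC.
Qed.

End GaloisExpansion.

(** * Coefficients of a Hopf-Galois action *)

Section HopfCoefficients.
Variables (K : fieldType) (L : splittingFieldType K).
Hypothesis galL : galois 1 {:L}.
Variables (H : hopfAlgType K) (act : hopf_galois L H).
Local Notation gT := (gal_of {:L}).
Implicit Types (g : gT) (h k : H).

Definition hopf_coef h g : L := sval (cid (gal_expansion galL)) (act h) g.
Local Notation a := hopf_coef.

Lemma act_expand h x : act h x = \sum_(g : gT) a h g * g x.
Proof.
rewrite /hopf_coef; case: cid => /= coef coefE; apply: coefE.
exact: hact_linearr.
Qed.

Lemma hopf_coef_unique h (c : gT -> L) :
  (forall x, act h x = \sum_(g : gT) c g * g x) -> forall g, a h g = c g.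
Proof.
move=> hE g; apply/eqP; rewrite -subr_eq0; apply/eqP.
apply: (gal_indep (c := fun g => a h g - c g)) => x.
by under eq_bigr do rewrite mulrBl; rewrite sumrB -act_expand hE subrr.
Qed.

Lemma hopf_coefZD (c : K) h k g : a (c *: h + k) g = c *: a h g + a k g.
Proof.
apply: (hopf_coef_unique (c := fun g => c *: a h g + a k g)) => x.
rewrite hact_linearl !act_expand scaler_sumr -big_split /=.
by apply: eq_bigr => s _; rewrite mulrDl scalerAl.
Qed.

Lemma hopf_coef0 g : a 0 g = 0.
Proof. by have := hopf_coefZD (-1) 0 0 g; rewrite scaler0 addr0 scaleN1r addNr. Qed.

Lemma hopf_coefD h k g : a (h + k) g = a h g + a k g.
Proof. by rewrite -[h]scale1r hopf_coefZD !scale1r. Qed.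

Lemma hopf_coefZ (c : K) h g : a (c *: h) g = c *: a h g.
Proof. by rewrite -[c *: h]addr0 hopf_coefZD hopf_coef0 addr0. Qed.

Lemma hopf_coefB h k g : a (h - k) g = a h g - a k g.
Proof. by rewrite hopf_coefD -scaleN1r hopf_coefZ scaleN1r. Qed.

Lemma hopf_coef_sum (I : Type) (r : seq I) (P : pred I) (f : I -> H) g :
  a (\sum_(i <- r | P i) f i) g = \sum_(i <- r | P i) a (f i) g.
Proof. by apply: (big_morph (a^~ g)); [move=> x y; apply: hopf_coefD | apply: hopf_coef0]. Qed.

Lemma linfun_actE (s : L) h t :
  (linfun (fun t => s * act h t) : 'End(L)) t = s * act h t.
Proof.
have D := hact_bilinear act.
have lin : linear (fun t : L => s * act h t).
  by move=> c x y; rewrite (actDr D) (actZr D) mulrDr scalerAr.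
pose f := HB.pack_for {linear L -> L} (fun t : L => s * act h t)
  (GRing.isLinear.Build K L L *:%R _ lin).
by rewrite -[fun t => _]/(f : L -> L) lfunE.
Qed.

Lemma linfun_act_balanced :
  balanced (fun (s : L) h => linfun (fun t => s * act h t) : 'End(L)).
Proof.
have D := hact_bilinear act.
split=> [s s' h | s h h' | c s h]; apply/lfunP => t; rewrite ?add_lfunE !linfun_actE.
- by rewrite mulrDl.
- by rewrite (actDl D) mulrDr.
- by rewrite (actZl D) -scalerAl scalerAr.
Qed.

Lemma hopf_galois_mapE (x : tensor L H) t :
  hopf_galois_map act x t = \sum_(p <- repr x) p.1 * act p.2 t.
Proof.
rewrite /hopf_galois_map /tlift sum_lfunE.
by apply: eq_bigr => p _; rewrite linfun_actE.
Qed.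

(* The images of the Galois automorphisms under j^-1. *)
Lemma hopf_grouplike_exists g : exists x : tensor L H,
  forall s : gT, \sum_(p <- repr x) p.1 * a p.2 s = (g == s)%:R.
Proof.
have [j' j'K jK] := hact_bij act.
exists (j' (g : 'End(L))) => s.
have E t : \sum_(p <- repr (j' (g : 'End(L)))) p.1 * act p.2 t = g t.
  by rewrite -hopf_galois_mapE jK.
apply/eqP; rewrite -subr_eq0; apply/eqP.
apply: (gal_indep (c := fun s : gT =>
  \sum_(p <- repr (j' (g : 'End(L)))) p.1 * a p.2 s - (g == s)%:R)).
move=> t; under eq_bigr do rewrite mulrBl mulr_suml.
rewrite sumrB exchange_big /= [X in _ - X](bigD1 g) //= eqxx mul1r.
rewrite [X in g t + X]big1 ?addr0 => [|s' /negbTE]; last by rewrite eq_sym => ->; rewrite mul0r.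
rewrite -[X in _ - X]E -sumrB big1 // => p _.
rewrite act_expand mulr_sumr -sumrB big1 // => s' _.
by rewrite mulrA subrr.
Qed.

Definition hopf_grouplike g : tensor L H := sval (cid (hopf_grouplike_exists g)).
Local Notation u := hopf_grouplike.

Lemma hopf_grouplikeE g (s : gT) : \sum_(p <- repr (u g)) p.1 * a p.2 s = (g == s)%:R.
Proof. by rewrite /hopf_grouplike; case: cid. Qed.

(** Pairing the relation with u_g isolates c g. *)
Lemma hopf_coef_indep (c : gT -> L) :
  (forall h, \sum_(g : gT) c g * a h g = 0) -> forall g, c g = 0.
Proof.
move=> c0 g.
have <- : \sum_(p <- repr (u g)) p.1 * (\sum_(s : gT) c s * a p.2 s) = c g.
  under eq_bigr do rewrite mulr_sumr.
  rewrite exchange_big (bigD1 g) //= [X in _ + X]big1 ?addr0 => [|s ns].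
    under eq_bigr do rewrite mulrCA.
    by rewrite -mulr_sumr hopf_grouplikeE eqxx mulr1.
  under eq_bigr do rewrite mulrCA.
  by rewrite -mulr_sumr hopf_grouplikeE eq_sym (negbTE ns) mulr0.
by rewrite big1 // => p _; rewrite c0 mulr0.
Qed.

(* Every K-linear map from H to L is an L-combination of the coefficients,
   because 1 (x) h and sum_s a_s(h) u_s have the same image under j. *)
Lemma hopf_coef_span (theta : H -> L) : linear theta ->
  forall h, theta h = \sum_(g : gT) a h g * \sum_(p <- repr (u g)) p.1 * theta p.2.
Proof.
move=> lin h.
have tD k k' : theta (k + k') = theta k + theta k'.
  by have := lin 1 k k'; rewrite !scale1r.
have tZ c k : theta (c *: k) = c *: theta k.
  have t0 : theta 0 = 0 by have := lin (-1) 0 0; rewrite scaler0 addr0 scaleN1r addNr.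
  by have := lin c k 0; rewrite !addr0 t0 addr0.
have bal : balanced (fun (s : L) k => s * theta k).
  split=> [s s' k | s k k' | c s k].
  - exact: mulrDl.
  - by rewrite tD mulrDr.
  - by rewrite tZ -scalerAl scalerAr.
pose y : tensor L H := \sum_(g : gT) \sum_(p <- repr (u g)) tens (a h g * p.1) p.2.
have jinj : injective (hopf_galois_map act) by apply/bij_inj/hact_bij.
have jD := tliftD linfun_act_balanced.
have j0 := tlift0 linfun_act_balanced.
have yE : tens 1 h = y.
  apply: jinj; apply/lfunP=> t.
  rewrite {1}/hopf_galois_map (tlift_tens linfun_act_balanced) linfun_actE mul1r.
  rewrite /y /hopf_galois_map (big_morph _ jD j0) sum_lfunE act_expand.
  apply: eq_bigr => g _; rewrite (big_morph _ jD j0) sum_lfunE.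
  under eq_bigr do rewrite (tlift_tens linfun_act_balanced) linfun_actE -mulrA act_expand.
  rewrite -mulr_sumr; congr (_ * _).
  under eq_bigr do rewrite mulr_sumr.
  rewrite exchange_big (bigD1 g) //= [X in _ + X]big1 ?addr0 => [|s ns].
    under eq_bigr do rewrite mulrA.
    by rewrite -mulr_suml hopf_grouplikeE eqxx mul1r.
  under eq_bigr do rewrite mulrA.
  by rewrite -mulr_suml hopf_grouplikeE eq_sym (negbTE ns) mul0r.
have := congr1 (tlift (fun (s : L) k => s * theta k)) yE.
rewrite (tlift_tens bal) mul1r => ->.
rewrite /y (big_morph _ (tliftD bal) (tlift0 bal)); apply: eq_bigr => g _.
rewrite (big_morph _ (tliftD bal) (tlift0 bal)) mulr_sumr; apply: eq_bigr => p _.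
by rewrite (tlift_tens bal) mulrA.
Qed.

(** By [hopf_coef_span], the coordinate functions of H are L-combinations of the coefficients. *)
Lemma hopf_coef_inj0 h : (forall g, a h g = 0) -> h = 0.
Proof.
move=> ah0; rewrite (coord_vbasis (memvf h)) big1 // => i _.
have lin : linear (fun k : H => (coord (vbasis {:H}) i k)%:A : L).
  by move=> c x y; rewrite linearP scalerDl scalerA.
have := hopf_coef_span lin h; rewrite big1 => [|g _]; last by rewrite ah0 mul0r.
by move/eqP; rewrite scaler_eq0 oner_eq0 orbF => /eqP->; rewrite scale0r.
Qed.

Lemma gal_indep2 (D : gT -> gT -> L) :
  (forall x y, \sum_(s : gT) \sum_(t : gT) D s t * (s x * t y) = 0) ->
  forall s t, D s t = 0.
Proof.
move=> D0 s t; move: t; apply: gal_indep => y; move: s.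
apply: gal_indep => x; rewrite -[RHS](D0 x y).
by apply: eq_bigr => s _; rewrite mulr_suml; apply: eq_bigr => t _; rewrite mulrA mulrAC.
Qed.

(** Compare the coefficients of s(x) t(y) in the module algebra law for h . (x y). *)
Lemma hopf_coef_convolution h (s t : gT) :
  \sum_(q <- repr (comul h)) a q.1 s * a q.2 t = (s == t)%:R * a h s.
Proof.
apply/eqP; rewrite -subr_eq0; apply/eqP; move: s t.
apply: gal_indep2 => x y.
have := hact_mul act h x y; rewrite /tlift => /eqP; rewrite eq_sym -subr_eq0 => /eqP E.
rewrite -[RHS]E act_expand.
under eq_bigr => s _ do under eq_bigr => t _ do rewrite mulrBl.
under eq_bigr => s _ do rewrite sumrB.
rewrite sumrB; congr (_ - _).
  under [RHS]eq_bigr do rewrite !act_expand big_distrlr /=.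
  rewrite [RHS]exchange_big; apply: eq_bigr => s _ /=.
  rewrite [RHS]exchange_big; apply: eq_bigr => t _ /=.
  by rewrite mulr_suml; apply: eq_bigr => q _; rewrite mulrACA.
apply: eq_bigr => s _; rewrite (bigD1 s) //= eqxx mul1r rmorphM.
by rewrite big1 ?addr0 // => t; rewrite eq_sym => /negbTE->; rewrite !mul0r.
Qed.

Lemma hopf_coef_counit h : \sum_(g : gT) a h g = (counit h)%:A.
Proof.
rewrite -(hact_one act) act_expand; apply: eq_bigr => g _.
by rewrite rmorph1 mulr1.
Qed.

(* The coefficients are the minimal idempotents of the convolution algebra
   Hom_K(H, L), so that every Galois automorphism permutes them. *)
Lemma gal_permutes_coef g : exists f : gT -> gT, injective f /\
  forall s h, g (a h s) = a h (f s).
Proof.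
pose C s t := \sum_(p <- repr (u t)) p.1 * g (a p.2 s).
have CE s h : g (a h s) = \sum_(t : gT) a h t * C s t.
  apply: (hopf_coef_span (theta := fun h => g (a h s))) => c x y.
  by rewrite hopf_coefZD linearP.
(* The maps g o a_s are again orthogonal idempotents for convolution; this is the relation in
   coordinates. *)
have CC s s' t : C s t * C s' t = (s == s')%:R * C s t.
  apply/eqP; rewrite -subr_eq0; apply/eqP; move: t.
  apply: hopf_coef_indep => h; under eq_bigr do rewrite mulrBl.
  rewrite sumrB; apply/eqP; rewrite subr_eq0; apply/eqP.
  transitivity (\sum_(q <- repr (comul h)) g (a q.1 s) * g (a q.2 s')).
    under [RHS]eq_bigr do rewrite !CE big_distrlr /=.
    rewrite [RHS]exchange_big; apply: eq_bigr => t _ /=.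
    rewrite [RHS]exchange_big (bigD1 t) //= [X in _ + X]big1 ?addr0 => [|t' nt].
      under [RHS]eq_bigr do rewrite mulrACA.
      by rewrite -mulr_suml hopf_coef_convolution eqxx mul1r mulrC.
    under eq_bigr do rewrite mulrACA.
    by rewrite -mulr_suml hopf_coef_convolution eq_sym (negbTE nt) !mul0r.
  under eq_bigr do rewrite -rmorphM.
  rewrite -rmorph_sum hopf_coef_convolution rmorphM rmorph_nat /= CE mulr_sumr.
  by apply: eq_bigr => t _; rewrite -mulrA [C s t * _]mulrC.
have C1 t : \sum_(s : gT) C s t = 1.
  apply/eqP; rewrite -subr_eq0; apply/eqP; move: t.
  apply: hopf_coef_indep => h; under eq_bigr do rewrite mulrBl mul1r mulr_suml.
  rewrite sumrB hopf_coef_counit exchange_big /=.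
  transitivity (\sum_(s : gT) g (a h s) - (counit h)%:A).
    congr (_ - _); apply: eq_bigr => s _; rewrite CE; apply: eq_bigr => t _.
    by rewrite mulrC.
  by rewrite -rmorph_sum /= hopf_coef_counit gal_scalar rmorph1 subrr.
(* A zero row would make a_s vanish, against its pairing with u_s. *)
have exC s : exists t, C s t != 0.
  apply: contrapT => noC.
  have a0 h : a h s = 0.
    apply: (fmorph_inj (g : {rmorphism L -> L})).
    rewrite [LHS]CE rmorph0 big1 // => t _.
    have [->|nz] := eqVneq (C s t) 0; first by rewrite mulr0.
    by case: noC; exists t.
  have := hopf_grouplikeE s s; rewrite eqxx big1 => [/esym/eqP|p _].
    by rewrite oner_eq0.
  by rewrite a0 mulr0.
pose f s := xchoose (exC s).
have Cf s : C s (f s) = 1.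
  have nz := xchooseP (exC s); apply: (mulIf nz).
  by rewrite mul1r [LHS]CC eqxx mul1r.
have fI : injective f.
  move=> s s' ff; apply/eqP; apply: contraT => ns.
  have := CC s s' (f s); rewrite {2}ff !Cf (negbTE ns) mul0r mulr1 => /eqP.
  by rewrite oner_eq0.
exists f; split=> // s h; rewrite CE (bigD1 (f s)) //= Cf mulr1.
rewrite big1 ?addr0 // => t nt; have [s' tE] : exists s', t = f s'.
  by have [f' _ fK] := injF_bij fI; exists (f' t); rewrite fK.
have := CC s' s t; rewrite tE Cf mul1r.
have [ss'|_ ->] := eqVneq s' s; last by rewrite mul0r mulr0.
by rewrite tE ss' eqxx in nt.
Qed.

Definition coef_star g : gT -> gT := sval (cid (gal_permutes_coef g)).

Lemma coef_star_inj g : injective (coef_star g).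
Proof. by rewrite /coef_star; case: cid => f []. Qed.

Lemma gal_coef g s h : g (a h s) = a h (coef_star g s).
Proof. by rewrite /coef_star; case: cid => f []. Qed.

(* kap s t = sigma when eta_sigma, as a permutation of the Galois group, maps s
   to t, so that the coefficient of t in s h is a_(kap s t)(h). *)
Definition kap (s t : gT) : gT := coef_star s (t * s^-1)%g.

Lemma gal_act g h x : g (act h x) = \sum_(t : gT) a h (kap g t) * t x.
Proof.
rewrite act_expand rmorph_sum (reindex_inj (mulIg g^-1%g)) /=.
apply: eq_bigr => t _; rewrite rmorphM /= gal_coef; congr (_ * _).
by rewrite -galMf mulgKV.
Qed.

Lemma gal_act_unique g h (c : gT -> L) :
  (forall x, g (act h x) = \sum_(t : gT) c t * t x) ->
  forall t, a h (kap g t) = c t.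
Proof.
move=> cE t; apply/eqP; rewrite -subr_eq0; apply/eqP; move: t.
apply: gal_indep => x; under eq_bigr do rewrite mulrBl.
by rewrite sumrB -gal_act cE subrr.
Qed.

Lemma hopf_coef_sep (s t : gT) : (forall h, a h s = a h t) -> s = t.
Proof.
move=> st; apply/eqP; apply: contraT => ns.
have /eqP : \sum_(p <- repr (u s)) p.1 * a p.2 s = \sum_(p <- repr (u s)) p.1 * a p.2 t.
  by apply: eq_bigr => p _; rewrite st.
by rewrite !hopf_grouplikeE eqxx (negbTE ns) oner_eq0.
Qed.

Lemma kap_inj g : injective (kap g).
Proof. by move=> s t /coef_star_inj/mulIg. Qed.

(** Both sides are the coefficient of t in x |-> g(h . (k . x)). Thus the matrices (a_(kap s t)(h))
    form a representation of H. *)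
Lemma hopf_coefM_kap g t h k :
  a (h * k) (kap g t) = \sum_(s : gT) a h (kap g s) * a k (kap s t).
Proof.
apply: (gal_act_unique (c := fun t => \sum_(s : gT) a h (kap g s) * a k (kap s t))).
move=> x; rewrite hactM gal_act.
under eq_bigr do rewrite gal_act mulr_sumr.
rewrite exchange_big; apply: eq_bigr => s _ /=.
by rewrite mulr_suml; apply: eq_bigr => r _; rewrite mulrA.
Qed.

Lemma hopf_coef1_kap g t : a 1 (kap g t) = (g == t)%:R.
Proof.
apply: (gal_act_unique (c := fun t => (g == t)%:R)) => x.
rewrite hact1 (bigD1 g) //= eqxx mul1r big1 ?addr0 // => s.
by rewrite eq_sym => /negbTE->; rewrite mul0r.
Qed.

Lemma kap1g g : kap 1%g g = g.
Proof. by apply: hopf_coef_sep => h; rewrite -gal_coef gal_id invg1 mulg1. Qed.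

Lemma hopf_coef1 g : a 1 g = (g == 1%g)%:R.
Proof. by rewrite -{1}[g]kap1g hopf_coef1_kap eq_sym. Qed.

Lemma kapgg g : kap g g = 1%g.
Proof.
have := hopf_coef1_kap g g; rewrite hopf_coef1 eqxx; case: eqP => // _ /eqP.
by rewrite eq_sym oner_eq0.
Qed.

Lemma hopf_coefM t h k : a (h * k) t = \sum_(s : gT) a h s * a k (kap s t).
Proof. by rewrite -{1}[t]kap1g hopf_coefM_kap; under eq_bigr do rewrite kap1g. Qed.

(** Expand a (h * k) (kap g t) from the base point g and from the base point 1, and compare by
    independence of the coefficients of [h]. *)
Lemma kap_translate g s t : kap (kap g s) (kap g t) = kap s t.
Proof.
apply: hopf_coef_sep => k; apply/eqP; rewrite -subr_eq0; apply/eqP.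
move: s; pose c s := a k (kap (kap g s) (kap g t)) - a k (kap s t).
have bij_kap : bijective (kap g) := injF_bij (@kap_inj g).
have [f fK Kf] := bij_kap.
suff c0 s : c (f (kap g s)) = 0 by move=> s; have := c0 s; rewrite fK.
apply: (hopf_coef_indep (c := fun s => c (f s))) => h.
rewrite (reindex_inj (@kap_inj g)) /=.
have E : \sum_(s : gT) a h (kap g s) * a k (kap (kap g s) (kap g t)) =
    \sum_(s : gT) a h (kap g s) * a k (kap s t).
  by rewrite -hopf_coefM_kap hopf_coefM [RHS](reindex_inj (@kap_inj g)).
transitivity (\sum_(s : gT) a h (kap g s) * a k (kap (kap g s) (kap g t)) -
   \sum_(s : gT) a h (kap g s) * a k (kap s t)); last by rewrite E subrr.
by rewrite -sumrB; apply: eq_bigr => r _; rewrite fK /c -mulrBr mulrC.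
Qed.

Lemma kap_sym s t : kap (kap t s) 1%g = kap s t.
Proof. by rewrite -(kapgg t) kap_translate. Qed.

(** [kap g 1] is the label of the inverse of eta_g. *)
Lemma kap1K g : kap (kap g 1%g) 1%g = g.
Proof. by rewrite kap_sym kap1g. Qed.

Lemma kap_eq1 g : (kap g 1%g == 1%g) = (g == 1%g).
Proof. by rewrite -{2}(kapgg g) (inj_eq (@kap_inj g)) eq_sym. Qed.

Lemma hopf_coef1_scalar h : exists c : K, a h 1%g = c%:A.
Proof.
apply: (gal_fixed_scalar galL) => g; rewrite gal_coef.
by rewrite -(mulgV g) -/(kap g g) kapgg mulgV.
Qed.

Definition hopf_trace h : K := sval (cid (hopf_coef1_scalar h)).

Lemma hopf_traceE h : (hopf_trace h)%:A = a h 1%g.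
Proof. by rewrite /hopf_trace; case: cid. Qed.

Lemma scalar_inj : injective (fun c : K => c%:A : L).
Proof. exact: (fmorph_inj (in_alg L)). Qed.

Lemma hopf_trace_linear (k : H) :
  linear (fun h => hopf_trace (k * h) : K^o) /\ linear (fun h => hopf_trace (h * k) : K^o).
Proof.
by split=> c x y; apply: scalar_inj;
  rewrite hopf_traceE ?mulrDl ?mulrDr -?scalerAl -?scalerAr hopf_coefZD
    -!hopf_traceE scalerDl scalerA.
Qed.

(* The form a_1(k l) is nondegenerate: pairing l with the inverse of eta_g
   recovers the coefficient a_g(l). *)
Lemma hopf_coef_of_trace g l :
  a l g = \sum_(p <- repr (u (kap g 1%g))) p.1 * (hopf_trace (p.2 * l))%:A.
Proof.
under eq_bigr do rewrite hopf_traceE hopf_coefM mulr_sumr.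
rewrite exchange_big (bigD1 (kap g 1%g)) //= [X in _ + X]big1 ?addr0 => [|s ns].
  under eq_bigr do rewrite mulrA.
  by rewrite -mulr_suml hopf_grouplikeE eqxx mul1r kap1K.
under eq_bigr do rewrite mulrA.
by rewrite -mulr_suml hopf_grouplikeE eq_sym (negbTE ns) mul0r.
Qed.

Lemma hopf_trace_nondeg l : (forall k, hopf_trace (k * l) = 0) -> l = 0.
Proof.
move=> l0; apply: hopf_coef_inj0 => g; rewrite hopf_coef_of_trace big1 // => p _.
by rewrite l0 scale0r mulr0.
Qed.

Lemma hopf_trace_represents (phi : H -> K) : linear (phi : H -> K^o) ->
  exists l, forall k, hopf_trace (k * l) = phi k.
Proof.
move=> phi_lin.
pose e := vbasis {:H}; pose n := \dim {:H}.
pose B : 'M[K]_n := \matrix_(i, j) hopf_trace (e`_j * e`_i).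
have trD k (v : 'I_n -> K) : hopf_trace (k * \sum_i v i *: e`_i) =
    \sum_i v i * hopf_trace (k * e`_i).
  have [lin _] := hopf_trace_linear k.
  pose f := HB.pack_for {linear H -> K^o} (fun h => hopf_trace (k * h) : K^o)
    (GRing.isLinear.Build K H K^o *:%R _ lin).
  rewrite -[hopf_trace _]/(f _) linear_sum; apply: eq_bigr => i _.
  by rewrite linearZ.
have ext (phi1 phi2 : H -> K^o) : linear phi1 -> linear phi2 ->
    (forall j : 'I_n, phi1 e`_j = phi2 e`_j) -> phi1 =1 phi2.
  move=> lin1 lin2 E k.
  pose f1 := HB.pack_for {linear H -> K^o} phi1 (GRing.isLinear.Build K H K^o *:%R _ lin1).
  pose f2 := HB.pack_for {linear H -> K^o} phi2 (GRing.isLinear.Build K H K^o *:%R _ lin2).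
  rewrite -[phi1]/(f1 : H -> _) -[phi2]/(f2 : H -> _).
  rewrite (coord_vbasis (memvf k)) !linear_sum; apply: eq_bigr => j _.
  by rewrite !linearZ /=; congr (_ *: _); apply: E.
have unitB : B \in unitmx.
  suff ker0 (v : 'rV_n) : v *m B = 0 -> v = 0.
    rewrite -row_free_unit -kermx_eq0; apply/eqP/row_matrixP=> i; rewrite row0.
    exact/ker0/sub_kermxP/row_sub.
  move=> vB; have l0 : \sum_i v ord0 i *: e`_i = 0.
    apply: hopf_trace_nondeg; have [_ lin] := hopf_trace_linear (\sum_i v ord0 i *: e`_i).
    apply: (ext _ (fun=> 0)) => //; first by move=> c x y; rewrite scaler0 addr0.
    move=> j; rewrite trD; transitivity ((v *m B) ord0 j); last by rewrite vB mxE.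
    by rewrite [RHS]mxE; apply: eq_bigr => r _; rewrite [in RHS]mxE.
  have /freeP fr := basis_free (vbasisP {:H}).
  by apply/rowP=> j; rewrite [RHS]mxE; apply: fr.
pose w := (\row_j phi e`_j) *m invmx B.
exists (\sum_i w ord0 i *: e`_i).
have [_ lin] := hopf_trace_linear (\sum_i w ord0 i *: e`_i).
apply: ext => // j; rewrite trD.
transitivity ((w *m B) ord0 j); last by rewrite mulmxKV // mxE.
by rewrite [RHS]mxE; apply: eq_bigr => r _; rewrite [B _ _]mxE.
Qed.

Lemma hopf_pairing_exists y x : exists l, forall k,
  (hopf_trace (k * l))%:A = gal_trace (y * act k x).
Proof.
pose phi k := sval (cid (gal_trace_scalar galL (y * act k x))).
have phiE k : (phi k)%:A = gal_trace (y * act k x).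
  by rewrite /phi; case: cid.
have [c h k|l lE] := @hopf_trace_represents phi; last by exists l => k; rewrite lE.
apply: scalar_inj; rewrite phiE hact_linearl mulrDr -scalerAr scalerDl.
rewrite -scalerA !phiE /gal_trace scaler_sumr -big_split; apply: eq_bigr => g _ /=.
by rewrite linearP.
Qed.

Definition hopf_pairing y x : H := sval (cid (hopf_pairing_exists y x)).

Lemma hopf_pairingE y x k : (hopf_trace (k * hopf_pairing y x))%:A =
  gal_trace (y * act k x).
Proof. by rewrite /hopf_pairing; case: cid. Qed.

Lemma hopf_pairing_unique y x l :
  (forall k, (hopf_trace (k * l))%:A = gal_trace (y * act k x)) ->
  hopf_pairing y x = l.
Proof.
move=> lE; apply/eqP; rewrite -subr_eq0; apply/eqP.
apply: hopf_trace_nondeg => k; have [lin _] := hopf_trace_linear k.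
pose f := HB.pack_for {linear H -> K^o} (fun h => hopf_trace (k * h) : K^o)
    (GRing.isLinear.Build K H K^o *:%R _ lin).
rewrite -[hopf_trace _]/(f _) linearB; apply/eqP; rewrite subr_eq0; apply/eqP.
by apply: scalar_inj; rewrite /= hopf_pairingE lE.
Qed.

Lemma hopf_pairing_act y h x : hopf_pairing y (act h x) = h * hopf_pairing y x.
Proof.
apply: hopf_pairing_unique => k.
by rewrite mulrA hopf_pairingE hactM.
Qed.

Lemma hopf_pairingDr y x x' :
  hopf_pairing y (x + x') = hopf_pairing y x + hopf_pairing y x'.
Proof.
apply: hopf_pairing_unique => k.
rewrite mulrDr hopf_traceE hopf_coefD -!hopf_traceE !hopf_pairingE.
rewrite (actDr (hact_bilinear act)) mulrDr /gal_trace -big_split.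
by apply: eq_bigr => g _; rewrite rmorphD.
Qed.

(** For each t the inner sum has the single term g = eta_s^-1(t). Integrality of the pairing is
    visible on this formula. *)
Lemma hopf_coef_pairing y x s : a (hopf_pairing y x) s =
  \sum_(t : gT) \sum_(g : gT | kap t g == kap s 1%g) t y * g x.
Proof.
rewrite hopf_coef_of_trace.
under eq_bigr do rewrite hopf_pairingE /gal_trace mulr_sumr.
rewrite exchange_big; apply: eq_bigr => t _ /=.
under eq_bigr do rewrite rmorphM /= gal_act !mulr_sumr.
rewrite exchange_big [RHS]big_mkcond; apply: eq_bigr => g _ /=.
transitivity (t y * g x * \sum_(p <- repr (u (kap s 1%g))) p.1 * a p.2 (kap t g)).
  by rewrite mulr_sumr; apply: eq_bigr => p _; ring.
by rewrite hopf_grouplikeE eq_sym; case: ifP; rewrite ?mulr1 ?mulr0.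
Qed.

(** In the coefficient at s the tensor [r] is evaluated at g t^-1, which leaves g = t; then kap t t
    = 1 forces s = 1, and the sum over t is a trace. *)
Lemma sum_hopf_pairing (r : seq (L * L)) (v m : L) :
  (forall g, pair_eval r g = if g == 1%g then m else 0) ->
  forall c : K, gal_trace (v * m) = c%:A ->
  \sum_(p <- r) hopf_pairing (v * p.1) p.2 = c%:A.
Proof.
move=> rE c trc; apply/eqP; rewrite -subr_eq0; apply/eqP/hopf_coef_inj0 => s.
rewrite hopf_coefB hopf_coef_sum hopf_coefZ hopf_coef1.
under eq_bigr do rewrite hopf_coef_pairing.
rewrite exchange_big /=.
transitivity (\sum_(t : gT | kap t t == kap s 1%g) t (v * m) - c *: (s == 1%g)%:R : L).
  congr (_ - _); rewrite [RHS]big_mkcond; apply: eq_bigr => t _ /=.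
  rewrite exchange_big /= big_mkcond (bigD1 t) //= [X in _ + X]big1 ?addr0 => [|g ng].
    case: ifP => // _; under eq_bigr do rewrite rmorphM -mulrA.
    by rewrite -mulr_sumr pair_eval_shift rE mulgV eqxx rmorphM.
  case: ifP => // _; under eq_bigr do rewrite rmorphM -mulrA.
  rewrite -mulr_sumr pair_eval_shift rE -eq_mulgV1 (negbTE ng).
  by rewrite rmorph0 mulr0.
under eq_bigl do rewrite kapgg eq_sym kap_eq1.
case: eqP => _; last by rewrite big_pred0_eq scaler0 subrr.
by rewrite -trc subrr.
Qed.

Definition coef_in (S : {pred L}) : {pred H} := fun h => `[< forall g, a h g \in S >].

Lemma coef_inP (S : {pred L}) h : reflect (forall g, a h g \in S) (h \in coef_in S).
Proof. exact: asboolP. Qed.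

Lemma coef_in_subring (S : subringClosed L) : subring_closed (coef_in S).
Proof.
split=> [|h k /coef_inP Sh /coef_inP Sk|h k /coef_inP Sh /coef_inP Sk];
  apply/coef_inP=> g.
- by rewrite hopf_coef1 rpred_nat.
- by rewrite hopf_coefB rpredB.
- by rewrite hopf_coefM rpred_sum // => s _; rewrite rpredM.
Qed.

Lemma hopf_pairing_in (S : subringClosed L) y x :
  (forall g z, z \in S -> g z \in S) -> y \in S -> x \in S ->
  hopf_pairing y x \in coef_in S.
Proof.
move=> Sg Sy Sx; apply/coef_inP=> s; rewrite hopf_coef_pairing.
by apply: rpred_sum => t _; apply: rpred_sum => g _; rewrite rpredM ?Sg.
Qed.

Lemma act_in (S : subringClosed L) h x :
  (forall g z, z \in S -> g z \in S) -> h \in coef_in S -> x \in S -> act h x \in S.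
Proof.
move=> Sg /coef_inP Sh Sx; rewrite act_expand.
by apply: rpred_sum => g _; rewrite rpredM ?Sg.
Qed.

(** The elements u_g supply a left inverse of the matrix of coefficients on a basis of H. *)
Lemma leq_dim_hopf : (\dim {:L} <= \dim {:H})%N.
Proof.
rewrite (card_gal_full galL).
pose e := vbasis {:H}; pose n := \dim {:H}.
pose A : 'M[L]_(n, #|{: gT}|) := \matrix_(i, j) a e`_i (enum_val j).
pose S : 'M[L]_(#|{: gT}|, n) := \matrix_(j, i)
  \sum_(p <- repr (u (enum_val j))) p.1 * (coord e i p.2)%:A.
apply: (@mulmx1_min _ _ _ S A); apply/matrixP=> i j; rewrite !mxE.
rewrite -(inj_eq enum_val_inj) -hopf_grouplikeE.
under eq_bigr do rewrite !mxE mulr_suml.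
rewrite exchange_big; apply: eq_bigr => p _ /=.
rewrite [p.2 in RHS](coord_vbasis (memvf p.2)) hopf_coef_sum mulr_sumr.
apply: eq_bigr => r _; rewrite hopf_coefZ -[in RHS]mulr_algl.
by rewrite mulrA.
Qed.

End HopfCoefficients.

(** * Change of field, and determinants over subrings *)

Lemma finite_rank_vect (F : fieldType) (V : vectType F) : finite_rank F -> finite_rank V.
Proof.
move=> [D [f [fB f_inj]]]; pose e := vbasis {:V}.
exists (\dim {:V} * D)%N, (fun v => mxvec (\matrix_(i, j) f (coord e i v) ord0 j)); split.
  move=> x y; rewrite -linearB; congr mxvec; apply/matrixP=> i j.
  by rewrite !mxE linearB fB !mxE.
move=> x y /(can_inj mxvecK)/matrixP E.
rewrite (coord_vbasis (memvf x)) (coord_vbasis (memvf y)).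
apply: eq_bigr => i _; congr (_ *: _); apply: f_inj; apply/rowP=> j.
by have := E i j; rewrite !mxE.
Qed.

Lemma finite_rank_rat : finite_rank rat.
Proof.
exists 1%N, (fun q => const_mx q); split; first by move=> x y; apply/rowP=> i; rewrite !mxE.
by move=> x y /rowP/(_ ord0); rewrite !mxE.
Qed.

Lemma zev_rmorph (V W : comNzRingType) (f : {rmorphism V -> W}) x q :
  zev (f x) q = f (zev x q).
Proof.
rewrite !(zev_sum _ (leqnn _)) rmorph_sum; apply: eq_bigr => i _.
by rewrite rmorphM rmorphXn /= rmorph_int.
Qed.

Lemma algebraic_integer_rmorph (E F : fieldType) (f : {rmorphism E -> F}) x :
  (f x \in @algebraic_integer F) = (x \in @algebraic_integer E).
Proof.
apply/idP/idP=> /algebraic_integerE[q mq q0]; apply/algebraic_integerE; exists q => //.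
  by apply: (fmorph_inj f); rewrite -zev_rmorph q0 rmorph0.
by rewrite zev_rmorph q0 rmorph0.
Qed.

Lemma local_integers_rmorph l (pl : prime l) (E F : fieldType) (f : {rmorphism E -> F}) x :
  (f x \in local_integers pl F) = (x \in local_integers pl E).
Proof.
apply/local_integersP/local_integersP=> -[m fm mx]; exists m => //.
  by rewrite -(algebraic_integer_rmorph f) rmorphM /= rmorph_int.
by rewrite -[m%:~R](rmorph_int f) -rmorphM /= algebraic_integer_rmorph.
Qed.

Section SubringMatrices.
Variables (R : comNzRingType) (S : subringClosed R).

Lemma det_in n (A : 'M[R]_n) : (forall i j, A i j \in S) -> \det A \in S.
Proof.
move=> SA; rewrite rpred_sum // => s _.
by rewrite rpredMsign rpred_prod.
Qed.

Lemma adj_in n (A : 'M[R]_n) : (forall i j, A i j \in S) ->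
  forall i j, \adj A i j \in S.
Proof.
move=> SA i j; rewrite mxE /cofactor rpredMsign; apply: det_in => i' j'.
by rewrite !mxE.
Qed.

End SubringMatrices.

(** det(1 + X B) is a polynomial over [S] with constant term 1; evaluate it at d. *)
Lemma det_1D_in (R : comNzRingType) (S : subringClosed R) (d : R) n (B : 'M[R]_n) :
    d \in S -> (forall i j, B i j \in S) ->
  exists2 c, c \in S & \det (1%:M + d *: B) = 1 + d * c.
Proof.
move=> Sd SB; pose P : 'M[{poly R}]_n := 1%:M + 'X *: map_mx polyC B.
have evP x : (\det P).[x] = \det (1%:M + x *: B).
  rewrite -[LHS]/(horner_eval x (\det P)) -det_map_mx; congr (\det _).
  apply/matrixP=> i j; rewrite !mxE rmorphD rmorphM rmorphMn rmorph1 /=.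
  by rewrite /horner_eval hornerX hornerC.
have SP : \det P \is a polyOver S.
  apply: det_in => i j; rewrite !mxE rpredD ?rpredMn ?rpred1 //.
  by rewrite rpredM ?polyOverX // polyOverC.
exists (drop_poly 1 (\det P)).[d].
  apply: rpred_horner => //; apply/polyOverP=> i; rewrite coef_drop_poly.
  exact/polyOverP.
have P0 : (\det P)`_0 = 1 by rewrite -horner_coef0 evP scale0r addr0 det1.
rewrite -evP -[in LHS](drop_poly0l (\det P)) drop_polyS P0.
by rewrite hornerD hornerM hornerX hornerC addrC.
Qed.

(** Commutativity of H is a hypothesis, not part of its type; the alias carries the commutative ring
    structure that [unit_value] and [zev] expect. *)
Definition com_alias (R : nzRingType) (mulC : commutative (@GRing.mul R)) : Type := R.
HB.instance Definition _ (R : nzRingType) (mulC : commutative (@GRing.mul R)) :=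
  GRing.NzRing.on (com_alias mulC).
HB.instance Definition _ (R : nzRingType) (mulC : commutative (@GRing.mul R)) :=
  GRing.PzRing_hasCommutativeMul.Build (com_alias mulC) mulC.

(** * The order of elements with integral coefficients *)

Section LocalOrder.
Variables (K : fieldExtType rat) (L : splittingFieldType K).
Hypothesis galL : galois 1 {:L}.
Variables (H : hopfAlgType K) (act : hopf_galois L H).
Hypothesis mulHC : commutative (@GRing.mul H).
Variables (l : nat) (pl : prime l).
Local Notation gT := (gal_of {:L}).
Local Notation a := (hopf_coef galL act).
Local Notation kap := (kap galL act).
Local Notation OL := (local_integers pl L).
Local Notation OK := (local_integers pl K).
Local Notation V := (com_alias mulHC).

Lemma finite_rankK : finite_rank K.
Proof. exact: finite_rank_vect finite_rank_rat. Qed.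

Lemma finite_rankL : finite_rank L.
Proof. exact: finite_rank_vect finite_rankK. Qed.

Lemma finite_rankH : finite_rank H.
Proof. exact: finite_rank_vect finite_rankK. Qed.

Lemma gal_local (g : gT) x : x \in OL -> g x \in OL.
Proof. by rewrite (local_integers_rmorph pl (g : {rmorphism L -> L})). Qed.

Lemma local_scalar (c : K) : (c%:A \in OL) = (c \in OK).
Proof. exact: (local_integers_rmorph pl (in_alg L)). Qed.

Definition local_order : {pred V} := coef_in galL act OL.
HB.instance Definition _ := GRing.isSubringClosed.Build V local_order
  (coef_in_subring galL act OL).

Lemma local_orderP (h : V) : reflect (forall g, a h g \in OL) (h \in local_order).
Proof. exact: coef_inP. Qed.

Lemma scalar_local_order (c : K) : c \in OK -> (c%:A : H) \in local_order.
Proof.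
move=> Oc; apply/local_orderP=> g; rewrite hopf_coefZ hopf_coef1.
by rewrite -mulr_algl rpredM ?rpred_nat // local_scalar.
Qed.

Lemma local_order_unit (m : int) : nondvd l m ->
  exists2 w : V, w \in local_order & m%:~R * w = 1.
Proof.
move=> fm; exists ((m%:~R^-1 : K)%:A : H).
  by apply: scalar_local_order; apply: nondvd_invr_local fm; apply: finite_rankK.
rewrite -[_ * _]/((m%:~R : H) * ((m%:~R^-1)%:A : H)).
have -> : m%:~R = (m%:~R : K)%:A :> H by rewrite scaler_int.
rewrite mulr_algr scalerA mulVf ?scale1r //.
by apply: nondvd_neq0 fm; apply: finite_rankK.
Qed.

Lemma local_order_primitive (t : V) : primitive_root_at l t.
Proof. exact: (field_primitive_root pl (V := V) finite_rankH t). Qed.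

(** The representation of [hopf_coefM_kap]; the row of index 1 lists all the coefficients of [h]. *)
Definition coef_mx (h : H) : 'M[L]_#|{: gT}| :=
  \matrix_(i, j) a h (kap (enum_val i) (enum_val j)).

Lemma coef_mxM h k : coef_mx (h * k) = coef_mx h *m coef_mx k.
Proof.
apply/matrixP=> i j; rewrite !mxE hopf_coefM_kap (reindex _ (onW_bij _ (@enum_val_bij gT))) /=.
by apply: eq_bigr => r _; rewrite !mxE.
Qed.

Lemma coef_mx1 : coef_mx 1 = 1%:M.
Proof.
by apply/matrixP=> i j; rewrite !mxE hopf_coef1_kap (inj_eq enum_val_inj).
Qed.

Lemma coef_mxD h k : coef_mx (h + k) = coef_mx h + coef_mx k.
Proof. by apply/matrixP=> i j; rewrite !mxE hopf_coefD. Qed.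

Lemma coef_mx_nat (n : nat) h : coef_mx (n%:R * h) = n%:R *: coef_mx h.
Proof.
apply/matrixP=> i j; rewrite !mxE mulr_natl -scaler_nat hopf_coefZ.
by rewrite scaler_nat mulr_natl.
Qed.

Lemma coef_mx_in (S : {pred L}) h : h \in coef_in galL act S <->
  forall i j, coef_mx h i j \in S.
Proof.
split=> [/coef_inP hS i j|hS]; first by rewrite mxE.
apply/coef_inP=> g; have := hS (enum_rank 1%g) (enum_rank g).
by rewrite mxE !enum_rankK kap1g.
Qed.

Lemma coef_mx_eq0 h : coef_mx h = 0 -> h = 0.
Proof.
move/matrixP=> h0; apply: (hopf_coef_inj0 (galL := galL) (act := act)) => g.
have := h0 (enum_rank 1%g) (enum_rank g).
by rewrite !mxE !enum_rankK kap1g.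
Qed.

(** The matrix of 1 + l c has determinant 1 + l d, a unit, so the adjugate gives an integral inverse
    matrix. It comes from H because multiplication by 1 + l c is injective on a finite-dimensional
    space. *)
Lemma local_order_unit1D (c : V) : c \in local_order ->
  exists2 w, w \in local_order & (1 + l%:R * c) * w = 1.
Proof.
move=> /coef_mx_in Oc; pose x : H := 1 + l%:R * c.
have xE : coef_mx x = 1%:M + l%:R *: coef_mx c.
  by rewrite coef_mxD coef_mx1 coef_mx_nat.
have [d Od dE] := det_1D_in (rpred_nat OL l) Oc; rewrite -xE in dE.
have [w Ow wE] := local_unit1D finite_rankL Od; rewrite -dE in wE.
pose B := w *: \adj (coef_mx x).
have BE : B *m coef_mx x = 1%:M.
  by rewrite -scalemxAl mul_adj_mx scale_scalar_mx mulrC wE.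
have [k kE] : exists k, x * k = 1.
  have : lker (amull x) == 0%VS.
    apply/lker0P=> y z; rewrite !lfunE /= => E.
    apply/eqP; rewrite -subr_eq0; apply/eqP/coef_mx_eq0.
    rewrite -[coef_mx _]mul1mx -BE -mulmxA -coef_mxM mulrBr E subrr.
    have -> : coef_mx 0 = 0 by apply/matrixP=> i j; rewrite !mxE hopf_coef0.
    by rewrite mulmx0.
  move/lker0_limgf => E; have : (1 : H) \in limg (amull x) by rewrite E memvf.
  by move/memv_imgP=> [k _ ->]; exists k; rewrite lfunE.
exists k; last exact: kE.
apply/coef_mx_in => i j.
have -> : coef_mx k = B.
  by rewrite -[coef_mx k]mul1mx -BE -mulmxA -coef_mxM kE coef_mx1 mulmx1.
rewrite mxE rpredM //; apply: adj_in => i' j'.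
have -> : coef_mx x i' j' = (i' == j')%:R + l%:R * coef_mx c i' j'.
  by rewrite xE; move: (coef_mx c) => C; rewrite !mxE.
by rewrite rpredD ?rpred_nat // rpredM ?rpred_nat.
Qed.

Lemma local_order_pi_regular (b : V) : b \in local_order ->
  exists N : nat, exists c d,
    [/\ c \in local_order, d \in local_order & b ^+ N * (1 - b * c) = l%:R * d].
Proof. exact: local_pi_regular local_order_unit local_order_primitive b. Qed.

End LocalOrder.

(** * H-linear maps, and generators at unramified primes *)

Section Generators.
Variables (K : fieldExtType rat) (L : splittingFieldType K).
Hypothesis galL : galois 1 {:L}.
Variables (H : hopfAlgType K) (act : hopf_galois L H).
Hypothesis mulHC : commutative (@GRing.mul H).
Variables (l : nat) (pl : prime l).
Local Notation gT := (gal_of {:L}).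
Local Notation OL := (local_integers pl L).
Local Notation OK := (local_integers pl K).
Local Notation V := (com_alias mulHC).
Local Notation O := (local_order galL act (mulHC := mulHC) pl).
Local Notation pairing := (hopf_pairing galL act).

Definition hopf_linear (f : L -> V) : Prop :=
  {morph f : x y / x + y} /\ forall h x, f (act h x) = (h : V) * f x.

Lemma act_scalar (c : K) x : act c%:A x = c *: x.
Proof. by rewrite (actZl (hact_bilinear act)) hact1. Qed.

(** f(h . x) = h makes f surjective, and dim L <= dim H leaves no room for a kernel. *)
Lemma hopf_linear_inj f x : hopf_linear f -> f x = 1 -> injective f.
Proof.
move=> [fD fH] fx1.
have f0 : f 0 = 0 by apply: (addrI (f 0)); rewrite -fD !addr0.
have lin : linear (f : L -> H).
  by move=> c y z; rewrite fD -act_scalar fH -[_ * _]/((c%:A : H) * f y) mulr_algl.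
pose F := HB.pack_for {linear L -> H} (f : L -> H)
    (GRing.isLinear.Build K L H *:%R _ lin).
have imF : limg (linfun F) = fullv.
  apply/vspaceP=> h; rewrite memvf; apply/memv_imgP.
  by exists (act h x); rewrite ?memvf // lfunE /= fH fx1 mulr1.
have : lker (linfun F) == 0%VS.
  have := limg_ker_dim (linfun F) fullv; rewrite imF capfv => E.
  rewrite -dimv_eq0 -leqn0 -(leq_add2r (\dim {:H})) E add0n.
  exact: (leq_dim_hopf galL act).
by move/lker0P=> Finj y z E; apply: Finj; rewrite !lfunE.
Qed.

Lemma hopf_linear_pairing y : hopf_linear (pairing y).
Proof.
split=> [x x'|h x]; first exact: hopf_pairingDr.
exact: hopf_pairing_act.
Qed.

Lemma hopf_linearD a b f g : hopf_linear f -> hopf_linear g ->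
  hopf_linear (fun x => a * f x + b * g x).
Proof.
move=> [fD fH] [gD gH]; split=> [x y|h x]; first by rewrite fD gD; ring.
by rewrite fH gH; ring.
Qed.

Lemma gal_trace_comb (a b : K) x y :
  gal_trace (a *: x + b *: y : L) = a%:A * gal_trace x + b%:A * gal_trace y.
Proof.
rewrite /gal_trace !mulr_algl !scaler_sumr -big_split; apply: eq_bigr => g _ /=.
by rewrite linearD /= !gal_scalar.
Qed.

Lemma scale_local (c : K) (x : L) : c \in OK -> x \in OL -> c *: x \in OL.
Proof. by move=> Oc Ox; rewrite -mulr_algl; apply: rpredM => //; rewrite local_scalar. Qed.

(** Summing [rE] over the group gives mu = sum p.1 Tr(p.2). A gcd of the Tr(p.2) and n that is
    itself a trace then divides the unit [mu]. *)
Lemma trace_one (r : seq (L * L)) (mu w : L) :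
    (forall p, p \in r -> p.1 \in OL /\ p.2 \in OL) ->
    (forall g, pair_eval r g = if g == 1%g then mu else 0) ->
    w \in OL -> mu * w = 1 ->
  exists2 v, v \in OL & gal_trace (v * mu) = 1.
Proof.
move=> rO rE Ow muw.
have [tr trE] : {tr : L -> K | forall y, gal_trace y = (tr y)%:A}.
  exists (fun y => sval (cid (gal_trace_scalar galL y))) => y.
  exact: svalP (cid (gal_trace_scalar galL y)).
pose n : K := #|{: gT}|%:R.
have nz_n : n != 0.
  rewrite /n pmulrn (finite_rank_intr_eq0 (finite_rankK K)) eqz_nat -lt0n.
  by apply/card_gt0P; exists 1%g.
have tr1 : gal_trace 1 = n%:A :> L.
  rewrite /gal_trace; under eq_bigr do rewrite rmorph1.
  by rewrite big_const iter_addr_0 scaler_nat.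
(* Traces are divided by n = Tr 1 because the gcd of [field_bezout_seq] always takes 1 into
   account. *)
pose Y (z : K) := exists2 v, v \in OL & gal_trace v = (n * z)%:A :> L.
pose s := [seq tr p.2 / n | p <- r].
have [c [cY _ sc]] := field_bezout_seq pl (finite_rankK K) s.
have [|||v Ov trv] := cY Y.
- move=> a b x y Oa Ob [v Ov vE] [v' Ov' v'E].
  exists (a *: v + b *: v').
    by apply: rpredD; apply: scale_local.
  by rewrite gal_trace_comb vE v'E -!in_algE -!rmorphM -rmorphD /=; congr (_%:A); ring.
- by exists 1; rewrite ?rpred1 // mulr1.
- move=> _ /mapP[p rp ->]; exists p.2; first by case: (rO p rp).
  by rewrite trE mulrC divfK.
have muE : mu = \sum_(p <- r) p.1 * gal_trace p.2.
  transitivity (\sum_(g : gT) pair_eval r g).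
    by rewrite (bigD1 1%g) //= rE eqxx big1 ?addr0 // => g ng; rewrite rE (negbTE ng).
  by rewrite exchange_big; apply: eq_bigr => p _; rewrite -mulr_sumr.
have [q Oq qE] : exists2 q, q \in OL & mu = gal_trace v * q.
  rewrite muE big_seq; elim/big_ind: _ => [|x y [q Oq ->] [q' Oq' ->]|p rp].
  - by exists 0; rewrite ?rpred0 ?mulr0.
  - by exists (q + q'); rewrite ?rpredD ?mulrDr.
  have [|k Ok kE] := sc (tr p.2 / n); first by apply/mapP; exists p.
  have [Op1 _] := rO p rp; exists (p.1 * k%:A).
    by rewrite rpredM ?local_scalar.
  rewrite trv trE mulrCA; congr (_ * _).
  rewrite -!in_algE -rmorphM /=; congr (_ %:A).
  by rewrite -mulrA [c * k]mulrC -kE mulrC divfK.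
have D1 : (n * c)%:A * (q * w) = 1 by rewrite mulrA -trv -qE.
have nz_nc : n * c != 0.
  by apply: contra_eq_neq D1 => ->; rewrite scale0r mul0r eq_sym oner_neq0.
have dE : ((n * c)^-1)%:A = q * w.
  have nzD : (n * c)%:A != 0 :> L by rewrite scaler_eq0 oner_eq0 orbF.
  by apply: (mulfI nzD); rewrite D1 mulr_algl scalerA mulfV ?scale1r.
exists ((n * c)^-1 *: v * w).
  by rewrite -mulr_algl dE !rpredM.
rewrite -mulrA [w * mu]mulrC muw mulr1.
have := gal_trace_comb (n * c)^-1 0 v 0; rewrite scaler0 addr0 => ->.
by rewrite scale0r mul0r addr0 dE trv mulrC D1.
Qed.

Definition local_free_generator (x : L) : Prop :=
  [/\ x \in OL, forall h, act h x = 0 -> h = 0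
    & forall y, y \in OL -> exists2 h : V, h \in O & y = act h x].

(** The pairings of v p.1 with p.2 add up to Tr(v mu) = 1, so [unit_value] yields an integral
    H-linear f with f x = 1; injectivity of f gives y = f(y) . x. *)
Lemma unramified_local_generator (r : seq (L * L)) (mu w : L) :
    (forall p, p \in r -> p.1 \in OL /\ p.2 \in OL) ->
    (forall g, pair_eval r g = if g == 1%g then mu else 0) ->
    w \in OL -> mu * w = 1 ->
  exists x, local_free_generator x.
Proof.
move=> rO rE Ow muw; have [v Ov v1] := trace_one rO rE Ow muw.
pose F f := hopf_linear f /\ forall y, y \in OL -> f y \in O.
pose X x := x \in OL.
have actO (h : V) x : h \in O -> X x -> X (act h x).
  move=> Oh; apply: act_in => //; exact: gal_local.
have XD (a b : V) x y : a \in O -> b \in O -> X x -> X y -> X (act a x + act b y).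
  by move=> Oa Ob Xx Xy; rewrite /X rpredD //; apply: actO.
have FD (a b : V) f g : a \in O -> b \in O -> F f -> F g ->
    F (fun x => a * f x + b * g x).
  move=> Oa Ob [fH fO] [gH gO]; split; first exact: hopf_linearD.
  by move=> y Oy; rewrite rpredD // rpredM ?fO ?gO.
have FX f x : F f -> X x -> f x \in O by move=> [_ fO]; apply: fO.
have Flin f (a b : V) x y : F f -> f (act a x + act b y) = a * f x + b * f y.
  by move=> [[fD fH] _]; rewrite fD !fH.
have [|||f [x [[fH fO] Ox fx1]]] := @unit_value V O l%:R (rpred_nat _ _)
  (local_order_pi_regular (galL := galL) (act := act) (mulHC := mulHC) (pl := pl))
  (local_order_unit1D (galL := galL) (act := act) (mulHC := mulHC) (pl := pl))
  L act X F XD FD FX Flin (size r) (fun i => pairing (v * (tnth (in_tuple r) i).1))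
  (fun i => (tnth (in_tuple r) i).2).
- move=> i; split; first exact: hopf_linear_pairing.
  move=> y Oy; apply: hopf_pairing_in => //; first exact: gal_local.
  by rewrite rpredM //; case: (rO _ (mem_tnth i (in_tuple r))).
- by move=> i; case: (rO _ (mem_tnth i (in_tuple r))).
- have E : gal_trace (v * mu) = 1%:A by rewrite v1 scale1r.
  have := sum_hopf_pairing galL act rE E; rewrite scale1r => <-.
  by rewrite [RHS]big_tnth.
have f_inj := hopf_linear_inj fH fx1; have [fD fM] := fH.
have f0 : f 0 = 0 by apply: (addrI (f 0)); rewrite -fD !addr0.
exists x; split=> // [h hx0|y Oy].
  by have := fM h x; rewrite hx0 f0 fx1 mulr1.
by exists (f y); [apply: fO | apply: f_inj; rewrite fM fx1 mulr1].
Qed.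

End Generators.

(** * Integrality of traces of matrices *)

Lemma closed_extension (F : fieldType) : finite_rank F ->
  exists (C : closedFieldType) (f : {rmorphism F -> C}), True.
Proof.
move=> [D [f [_ f_inj]]].
(* The embedding in rational vectors makes [F] countable, as [countable_algebraic_closure]
   requires. *)
have [g gK] : exists g, pcancel (fun x : F => pickle (f x)) g.
  exists (fun n => if pselect (exists x, pickle (f x) = n) is left ex
                   then Some (projT1 (cid ex)) else None) => x.
  case: pselect => [ex|]; last by case; exists x.
  congr Some; apply: f_inj; apply: (pcan_inj pickleK).
  exact: (projT2 (cid ex)).
pose Fc : countFieldType := HB.pack_for countFieldType (GRing.Field.sort F)
  (isCountable.Build (GRing.Field.sort F) gK).
have [C [phi _]] := countable_algebraic_closure Fc.
by exists C, phi.
Qed.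

Lemma algebraic_integer_root (F : fieldType) m (z : F) : (0 < m)%N ->
  z ^+ m \in @algebraic_integer F -> z \in @algebraic_integer F.
Proof.
move=> m_gt0 /asboolP zm; apply/asboolP.
apply: (@integral_root_monic _ _ (intr : {rmorphism int -> F}) z ('X^m - (z ^+ m)%:P)).
- exact: monicXnsubC.
- by rewrite /root !hornerE subrr.
apply/integral_poly => i; rewrite coefB coefXn coefC.
apply: integral_sub; first exact: integral_nat.
by case: eqP => _ //; apply: integral0.
Qed.

(** For an eigenvalue z of [U] in an algebraically closed extension, z^m is a root of [q], so z is
    an algebraic integer; the trace is the sum of the eigenvalues. *)
Lemma trace_integral (F : fieldType) n (U : 'M[F]_n) (q : {poly int}) m :
    finite_rank F -> (0 < m)%N -> q \is monic ->
    \sum_(i < size q) (q`_i)%:~R *: (U ^+ m) ^+ i = 0 ->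
  \tr U \in @algebraic_integer F.
Proof.
move=> fF m_gt0 mq qU0; have [C [phi _]] := closed_extension fF.
rewrite -(algebraic_integer_rmorph phi) -trace_map_mx.
set U' := map_mx phi U.
have [n0|n_gt0] := posnP n.
  rewrite /mxtrace big_pred0 ?rpred0 // => i.
  by case: i => i lti; exfalso; move: lti; rewrite n0.
have [r rE] := closed_field_poly_normal (char_poly U').
rewrite (monicP (char_poly_monic U')) scale1r in rE.
have sz_r : size r = n.
  by have := size_char_poly U'; rewrite rE size_prod_XsubC => -[].
have trE : \tr U' = \sum_(z <- r) z.
  apply: oppr_inj; rewrite -char_poly_trace // rE -coefPn_prod_XsubC sz_r //.
  by rewrite -lt0n.
rewrite trE big_seq rpred_sum // => z rz.
apply: (algebraic_integer_root m_gt0); apply/algebraic_integerE.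
exists q => //.
have /eigenvalueP[v vU nzv] : eigenvalue U' z.
  by rewrite eigenvalue_root_char rE root_prod_XsubC.
have vUi i : v *m U' ^+ i = z ^+ i *: v.
  elim: i => [|i IHi]; first by rewrite !expr0 mulmx1 scale1r.
  by rewrite !exprS -[U' * _]/(U' *m _) mulmxA vU -scalemxAl IHi scalerA.
have mapU i : map_mx phi (U ^+ i) = U' ^+ i.
  elim: i => [|i IHi]; first by rewrite !expr0 map_mx1.
  by rewrite !exprS -IHi -[U * _]/(U *m _) map_mxM.
have : zev (z ^+ m) q *: v = 0.
  have := congr1 (fun A => v *m map_mx phi A) qU0.
  rewrite map_mx0 mulmx0 => E; rewrite -[RHS]E (zev_sum _ (leqnn _)).
  rewrite (big_morph (map_mx phi) (@map_mxD _ _ phi n n) (map_mx0 phi n n)) mulmx_sumr scaler_suml.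
  apply: eq_bigr => i _; rewrite map_mxZ rmorph_int -!exprM mapU -scalemxAr vUi.
  by rewrite scalerA.
by move/eqP; rewrite scaler_eq0 (negbTE nzv) orbF => /eqP.
Qed.

(** * Primes not dividing the degree *)

Section MaximalOrder.
Variables (K : fieldExtType rat) (L : splittingFieldType K).
Hypothesis galL : galois 1 {:L}.
Variables (H : hopfAlgType K) (act : hopf_galois L H).
Hypothesis mulHC : commutative (@GRing.mul H).
Variables (l : nat) (pl : prime l).
Local Notation gT := (gal_of {:L}).
Local Notation a := (hopf_coef galL act).
Local Notation kap := (kap galL act).
Local Notation W := (coef_mx galL act).
Local Notation OL := (local_integers pl L).
Local Notation OK := (local_integers pl K).
Local Notation V := (com_alias mulHC).
Local Notation O := (local_order galL act (mulHC := mulHC) pl).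
Local Notation N := #|{: gT}|.

(** Permutation matrix of eta_s, the image of u_s under the representation [coef_mx] extended to L
    (x) H. *)
Definition grouplike_mx (s : gT) : 'M[L]_N :=
  \matrix_(i, j) (kap (enum_val i) (enum_val j) == s)%:R.

Lemma kap_injl (y s t : gT) : kap s y = kap t y -> s = t.
Proof.
rewrite -(kap_sym galL act s y) -(kap_sym galL act t y) => E.
apply: (@kap_inj _ _ galL _ act y).
by rewrite -[LHS](kap1K galL act) E kap1K.
Qed.

Lemma grouplike_mx_perm s : exists p : {perm 'I_N}, grouplike_mx s = perm_mx p.
Proof.
have ex (i : 'I_N) : exists j : 'I_N, kap (enum_val i) (enum_val j) = s.
  have [f _ fK] := injF_bij (@kap_inj _ _ galL _ act (enum_val i)).
  by exists (enum_rank (f s)); rewrite enum_rankK fK.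
have [f fE] := fin_all_exists ex.
have f_inj : injective f.
  move=> i j E; apply: enum_val_inj; apply: (@kap_injl (enum_val (f i))).
  by rewrite fE E fE.
exists (perm f_inj); apply/matrixP=> i j; rewrite !mxE permE.
rewrite -(inj_eq enum_val_inj (f i)).
rewrite -(inj_eq (@kap_inj _ _ galL _ act (enum_val i)) (enum_val (f i))).
by rewrite fE eq_sym.
Qed.

Lemma grouplike_mx_order s : exists2 m, (0 < m)%N & grouplike_mx s ^+ m = 1.
Proof.
have [p ->] := grouplike_mx_perm s; exists #[p]%g; first exact: order_gt0.
have -> : perm_mx p ^+ #[p]%g = perm_mx (p ^+ #[p])%g :> 'M[L]_N.
  elim: #[p]%g => [|m IHm]; first by rewrite expr0 expg0 perm_mx1.
  by rewrite exprS expgS perm_mxM IHm.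
by rewrite expg_order perm_mx1.
Qed.

Lemma grouplike_mx_comm s h : GRing.comm (W h) (grouplike_mx s).
Proof.
have -> : grouplike_mx s = \sum_(p <- repr (hopf_grouplike galL act s)) p.1 *: W p.2.
  apply/matrixP=> i j; rewrite !mxE summxE eq_sym -(hopf_grouplikeE galL act).
  by apply: eq_bigr => p _; rewrite !mxE.
apply: commr_sum => p _; rewrite /GRing.comm -[LHS]/(_ *m _) -[RHS]/(_ *m _).
by rewrite -scalemxAr -scalemxAl -!coef_mxM mulHC.
Qed.

(** Each index j contributes a_s(h) once, through the only i0 with kap j i0 = kap s 1. *)
Lemma trace_grouplike_mx s h :
  \tr (W h *m grouplike_mx (kap s 1%g)) = #|{: gT}|%:R * a h s.
Proof.
rewrite /mxtrace; under eq_bigr do rewrite !mxE.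
rewrite exchange_big /= mulr_natl -[X in _ *+ X](card_ord N) -sumr_const.
apply: eq_bigr => j _.
have [f _ fK] := injF_bij (@kap_inj _ _ galL _ act (enum_val j)).
pose i0 := enum_rank (f (kap s 1%g)).
have i0E : kap (enum_val j) (enum_val i0) = kap s 1%g by rewrite enum_rankK fK.
rewrite (bigD1 i0) //= big1 ?addr0 => [|i ni].
  by rewrite !mxE i0E eqxx mulr1 -kap_sym i0E kap1K.
rewrite !mxE -i0E (inj_eq (@kap_inj _ _ galL _ act _)) (inj_eq enum_val_inj).
by rewrite (negbTE ni) mulr0.
Qed.

Lemma coef_mx_int (m : int) h : W (m%:~R * h) = m%:~R *: W h.
Proof.
apply/matrixP=> i j; rewrite !mxE mulrzl -scaler_int hopf_coefZ.
by rewrite scaler_int mulrzl.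
Qed.

(** The permutation matrix P has some finite order m and commutes with the matrix of [b], so the
    m-th power of their product is the matrix of b^m, to which [trace_integral] applies. *)
Lemma integral_coef (b : V) s : integral_elt b ->
  #|{: gT}|%:R * a b s \in @algebraic_integer L.
Proof.
move=> ib; rewrite -trace_grouplike_mx; set P := grouplike_mx _.
have [m m_gt0 Pm] := grouplike_mx_order (kap s 1%g).
have [q mq q0] : integral_elt (b ^+ m).
  suff [q mq /eqP q0] : integralOver (intr : int -> V) (b ^+ m) by exists q.
  have {ib}ib : integralOver (intr : int -> V) b.
    by case: ib => q mq q0; exists q => //; apply/eqP.
  elim: (m) => [|k IHk]; first exact: integral1.
  by rewrite exprS; apply: integral_mul.
have WX k : W (b ^+ k) = W b ^+ k.
  elim: k => [|k IHk]; first exact: coef_mx1.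
  by rewrite !exprS -IHk; apply: coef_mxM.
apply: (trace_integral (finite_rankL L) m_gt0 mq).
have -> : (W b *m P) ^+ m = W (b ^+ m).
  by rewrite -[_ *m _]/(W b * P) exprMn_comm ?Pm ?mulr1 ?WX //; apply: grouplike_mx_comm.
transitivity (W (zev (b ^+ m) q)); last first.
  by rewrite q0; apply/matrixP=> i j; rewrite !mxE hopf_coef0.
rewrite (zev_sum _ (leqnn _)).
have W0 : W 0 = 0 by apply/matrixP=> i j; rewrite !mxE hopf_coef0.
rewrite (big_morph _ (coef_mxD galL act) W0); apply: eq_bigr => i _.
rewrite -[_ * _]/((q`_i)%:~R * ((b ^+ m) ^+ i : H)) coef_mx_int.
by rewrite -exprM !WX exprM.
Qed.

Hypothesis tame : ~~ (l %| #|{: gT}|)%N.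

Lemma integral_local_order (b : V) : integral_elt b -> b \in O.
Proof.
move=> ib; apply/coef_inP=> s; apply/local_integersP.
exists #|{: gT}|%:Z; first by rewrite /nondvd dvdzE.
by rewrite -pmulrn; apply: integral_coef.
Qed.

Lemma intr_neq0_unit (m : int) : m != 0 -> exists w : V, m%:~R * w = 1.
Proof.
move=> nz_m; exists ((m%:~R^-1 : K)%:A : H).
have -> : m%:~R = (m%:~R : K)%:A :> H by rewrite scaler_int.
rewrite -[LHS]/(((m%:~R : K)%:A : H) * ((m%:~R^-1 : K)%:A : H)).
rewrite mulr_algr scalerA mulVf ?scale1r //.
by rewrite (finite_rank_intr_eq0 (finite_rankK K)).
Qed.

Lemma hopf_pi_regular (h : V) : exists N : nat, exists b, h ^+ N * (1 - h * b) = 0.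
Proof.
have [p [i0 fi0] p0] := field_primitive_root pl (V := V) (finite_rankH H) h.
have exi : exists i, p`_i != 0.
  by exists i0; apply: contraTneq fi0 => ->; rewrite /nondvd dvdz0.
case: (ex_minnP exi) => n nz_n minn.
have [w wE] := intr_neq0_unit nz_n.
pose Z := zev h (drop_poly n.+1 p); exists n, (- (w * Z)).
have take0 : take_poly n p = 0.
  apply/polyP=> i; rewrite coef_take_poly coef0; case: ltnP => // ltin.
  by apply: contraTeq ltin => /minn; rewrite -leqNgt.
have := p0; rewrite -{1}(poly_take_drop n p) take0 add0r drop_polyS.
rewrite rmorphM rmorphD rmorphM rmorphXn /= zevX zevC -/Z => E.
by rewrite (@pi_regular_step V n h Z _ w 0 E wE) mulr0.
Qed.

(** The leading coefficient works: its product with [x] differs by an integer from a Horner tail,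
    which is integral. *)
Lemma denominator (x : L) : exists2 m : int, m != 0 & m%:~R * x \in OL.
Proof.
have [p [i fi] p0] := field_primitive_root pl (finite_rankL L) x.
have nzp : p != 0 by apply: contraTneq fi => ->; rewrite coef0 /nondvd dvdz0.
exists (lead_coef p); first by rewrite lead_coef_eq0.
apply/algebraic_local/algebraic_integerE.
suff [q mq /eqP q0] : integralOver (intr : int -> L) ((lead_coef p)%:~R * x) by exists q.
have [sz1|sz_gt1] := leqP (size p) 1.
  move: p0 nzp; rewrite (size1_polyC sz1) zevC polyC_eq0 => /eqP.
  by rewrite (finite_rank_intr_eq0 (finite_rankL L)) => ->.
pose k := (size p).-2; have kE : size p = k.+2 by rewrite /k; case: size sz_gt1 => [|[]].
have dropE : drop_poly k.+1 p = (lead_coef p)%:P.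
  by rewrite drop_polyS drop_poly_eq0 ?kE // mulr0 add0r lead_coefE kE.
have -> : (lead_coef p)%:~R * x = zev x (drop_poly k p) - (p`_k)%:~R.
  by rewrite drop_polyS dropE rmorphD rmorphM /= zevX !zevC addrK mulrC.
apply: integral_sub; last exact: integral_id.
have [q mq q0] := drop_poly_integral k nzp p0.
by exists q => //; apply/eqP.
Qed.

Lemma hopf_denominator (h : V) : exists2 m : int, m != 0 & m%:~R * h \in O.
Proof.
have /fin_all_exists2[m nzm mE] (g : gT) := denominator (a h g).
exists (\prod_g m g); first by apply/prodf_neq0 => g _; apply: nzm.
apply/coef_inP=> g; rewrite -[_ * _]/((\prod_g m g)%:~R * (h : H)) mulrzl -scaler_int hopf_coefZ.
rewrite scaler_int -mulrzl (bigD1 g) //= intrM mulrAC rpredM //.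
by rewrite rpred_int.
Qed.

Lemma lpart_split (m : int) : m != 0 ->
  exists k (m' : int), nondvd l m' /\ m = m' * l%:Z ^+ k.
Proof.
rewrite -absz_gt0 => m_gt0; have [m' cm' mE] := pfactor_coprime pl m_gt0.
exists (logn l `|m|), (sgz m * m'%:Z); split.
  have -> : nondvd l (sgz m * m'%:Z) = ~~ (l %| m')%N.
    rewrite /nondvd dvdzE abszM.
    by have -> : `|sgz m|%N = 1%N; [case: sgzP m_gt0 => // ->|rewrite mul1n].
  by rewrite -prime_coprime.
have lX j : (l ^ j)%N%:Z = l%:Z ^+ j by rewrite -[LHS]natz natrX natz.
by rewrite {1}[m]intEsg {1}mE PoszM mulrA lX.
Qed.

Lemma separating_integers : exists (r : seq (L * L)) (mu : L),
  [/\ forall p, p \in r -> p.1 \in OL /\ p.2 \in OL, mu != 0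
    & forall g, pair_eval r g = if g == 1%g then mu else 0].
Proof.
have ex (g : gT) : exists x : L, x \in OL /\ (g != 1%g -> x - g x != 0).
  have [->|ng] := eqVneq g 1%g; first by exists 0; rewrite rpred0.
  have /existsNP[x gx] : ~ (forall x, g x = x).
    move=> gx; case/eqP: ng; apply/eqP/gal_eqP => x _.
    by rewrite gx gal_id.
  have [m nzm mx] := denominator x; exists (m%:~R * x); split=> // _.
  rewrite rmorphM rmorph_int /= -mulrBr mulf_neq0 //.
    by rewrite (finite_rank_intr_eq0 (finite_rankL L)).
  by rewrite subr_eq0; apply/eqP=> E; apply: gx.
have [z zE] := fin_all_exists ex.
have [|g ng|r rO rE] :=
  @separating_pairs _ _ OL (fun g => z g - g (z g)) (local_integers_subring pl L).
- exact: gal_local.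
- exists [:: (1, z g)]; last by rewrite big_seq1 mul1r.
  by move=> p; rewrite inE => /eqP-> /=; rewrite rpred1; split=> //; case: (zE g).
exists r, (\prod_(s : gT | s != 1%g) (z s - s (z s))); split=> //.
by apply/prodf_neq0 => g ng; case: (zE g) => _; apply.
Qed.

(** Lets [unit_value] be applied with H as a subring of itself and d = 0. *)
Definition full_pred (R : Type) : {pred R} := predT.

Fact full_pred_subring (R : pzRingType) : subring_closed (@full_pred R).
Proof. by []. Qed.
HB.instance Definition _ (R : pzRingType) := GRing.isSubringClosed.Build R
  (@full_pred R) (full_pred_subring R).

(** Over H the trace n of v mu only has to be nonzero. The class [F] records a common denominator
    for the values on integers, which [tame_local_generator] needs in order to stop its descent. *)
Lemma generic_generator : exists (f : L -> V) (x : L) (m : int),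
  [/\ hopf_linear act f, x \in OL, f x = 1, m != 0
    & forall y, y \in OL -> m%:~R * f y \in O].
Proof.
pose F (f : L -> V) := hopf_linear act f /\
  exists2 m : int, m != 0 & forall y, y \in OL -> m%:~R * f y \in O.
have FD (b c : V) f g : b \in @full_pred V -> c \in @full_pred V -> F f -> F g ->
    F (fun x => b * f x + c * g x).
  move=> _ _ [fH [m nzm fO]] [gH [m' nzm' gO]]; split; first exact: hopf_linearD.
  have [k nzk kO] := hopf_denominator b; have [k' nzk' k'O] := hopf_denominator c.
  exists (m * m' * (k * k')); first by rewrite !mulf_neq0.
  move=> y Oy; have -> : (m * m' * (k * k'))%:~R * (b * f y + c * g y) =
      m'%:~R * k'%:~R * ((k%:~R * b) * (m%:~R * f y)) +
      m%:~R * k%:~R * ((k'%:~R * c) * (m'%:~R * g y)) by rewrite !intrM; ring.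
  have Oint (i j : int) : i%:~R * j%:~R \in O by rewrite rpredM ?rpred_int.
  apply: rpredD; apply: rpredM => //; apply: rpredM => //; first exact: fO.
  exact: gO.
have [r [mu [rO nzmu rE]]] := separating_integers.
have [d nzd dmu] := denominator mu^-1.
pose v := d%:~R * mu^-1; pose n := #|{: gT}|%:R * d%:~R : K.
have vE : gal_trace (v * mu) = n%:A :> L.
  rewrite /v mulfVK // /gal_trace; under eq_bigr do rewrite rmorph_int.
  by rewrite sumr_const -in_algE rmorphM rmorph_nat rmorph_int /= mulr_natl.
have nz_n : n != 0.
  rewrite mulf_neq0 ?(finite_rank_intr_eq0 (finite_rankK K)) //.
  rewrite pmulrn (finite_rank_intr_eq0 (finite_rankK K)) eqz_nat -lt0n.
  by apply/card_gt0P; exists 1%g.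
pose c : V := ((n^-1)%:A : H).
pose f (p : L * L) x :=
  c * (hopf_pairing galL act (v * p.1) x : V) + 0 * (hopf_pairing galL act (v * p.1) x : V).
have Ff p : p \in r -> F (f p).
  move=> rp; suff Fp : F (hopf_pairing galL act (v * p.1)) by apply: FD.
  split; first exact: hopf_linear_pairing.
  exists 1 => // y Oy; rewrite mul1r; apply: hopf_pairing_in => //.
    exact: gal_local.
  by rewrite rpredM //; case: (rO p rp).
have [||||||f0 [x0 [[f0H [m nzm f0O]] _ f0x0]]] := @unit_value V (@full_pred V) 0 isT _ _
  L act (fun=> True) F (fun _ _ _ _ _ _ _ _ => I) FD (fun _ _ _ _ => isT) _ (size r)
  (fun i => f (tnth (in_tuple r) i)) (fun i => (tnth (in_tuple r) i).2).
- move=> b _; have [N [w E]] := hopf_pi_regular b.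
  by exists N, w, 0; rewrite mulr0.
- by move=> b _; exists 1; rewrite // mul0r addr0 mulr1.
- by move=> g b b' x y [[gD gH] _]; rewrite gD !gH.
- by move=> i; apply: Ff; apply: (mem_tnth i (in_tuple r)).
- by [].
- have := sum_hopf_pairing galL act rE vE => E.
  transitivity (\sum_(p <- r) f p p.2); first by rewrite [RHS]big_tnth.
  transitivity (c * \sum_(p <- r) (hopf_pairing galL act (v * p.1) p.2 : V)).
    by rewrite mulr_sumr; apply: eq_bigr => p _; rewrite /f mul0r addr0.
  have -> : \sum_(p <- r) (hopf_pairing galL act (v * p.1) p.2 : V) = n%:A :> H by [].
  rewrite -[LHS]/(((n^-1)%:A : H) * (n%:A : H)) mulr_algl scalerA mulVf ?scale1r //.
have [k nzk kO] := denominator x0.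
have nz_k : (k%:~R : K) != 0 by rewrite (finite_rank_intr_eq0 (finite_rankK K)).
have [k' k'E] := intr_neq0_unit nzk.
have [f0D f0M] := f0H.
(* The integer [k] makes the vector integral, and dividing the map by [k] restores the value 1. *)
exists (fun y => k' * f0 y + 0 * f0 y), (k%:~R * x0).
have [fH [m' nzm' fO]] : F (fun y => k' * f0 y + 0 * f0 y).
  by apply: FD => //; split=> //; exists m.
exists m'; split=> //; rewrite mul0r addr0.
have -> : k%:~R * x0 = act (k%:~R%:A : H) x0 by rewrite act_scalar -mulr_algl scaler_int.
rewrite f0M f0x0 mulr1 mulrC -[RHS]k'E; congr (_ * _).
by rewrite scaler_int.
Qed.

(** The generic generator x1 is corrected by the gcd [c] of 1 and the f1(z_i). Tameness enters
    through [integral_local_order], which makes gcds available over [O]. *)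
Lemma tame_local_generator : exists x, local_free_generator galL act mulHC pl x.
Proof.
have [f1 [x1 [m1 [f1H Ox1 f1x1 nzm1 f1O]]]] := generic_generator.
have f1_inj := hopf_linear_inj galL f1H f1x1; have [f1D f1M] := f1H.
have [r [z [Oz genz]]] := generators_mod pl (finite_rankL L) (Y := fun y => y \in OL)
  (rpred0 _) (fun x y => @rpredB _ _ x y).
have [c [cY [w Ow wc] cs]] := local_bezout_seq
  (@local_order_unit K L galL H act mulHC l pl)
  (field_primitive_root pl (V := V) (finite_rankH H)) integral_local_order
  (@local_order_unit1D K L galL H act mulHC l pl)
  [seq f1 (z i) | i <- enum 'I_r].
pose x := act c x1; pose f y := w * f1 y + 0 * f1 y.
have fH : hopf_linear act f by apply: hopf_linearD.
have [fD fM] := fH.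
have fE y : f y = w * f1 y by rewrite /f mul0r addr0.
have fx : f x = 1 by rewrite fE f1M f1x1 mulr1 wc.
have f_inj := hopf_linear_inj galL fH fx.
have f0 : f 0 = 0 by apply: (addrI (f 0)); rewrite -fD !addr0.
have fB : {morph f : y t / y - t}.
  move=> y t; rewrite fD; congr (_ + _).
  by apply: (addrI (f t)); rewrite -fD !subrr.
have [fZ _] := morphB_intr fB.
have actO (h : V) y : h \in O -> y \in OL -> act h y \in OL.
  move=> Oh; apply: act_in => //; exact: gal_local.
have f1K y : act (f1 y) x1 = y by apply: f1_inj; rewrite f1M f1x1 mulr1.
have Ox : x \in OL.
  apply: (cY (fun h => act h x1 \in OL)) => [b b' h h' Ob Ob' Oh Oh'||_ /mapP[i _ ->]].
  - rewrite (actDl (hact_bilinear act)) -[b * h]/((b : H) * (h : H)).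
    by rewrite -[b' * h']/((b' : H) * (h' : H)) !hactM rpredD // actO.
  - by rewrite hact1.
  - by rewrite f1K.
have fz i : f (z i) \in O.
  have [|q Oq qE] := cs (f1 (z i)); first by apply/mapP; exists i; rewrite ?mem_enum.
  by rewrite fE qE mulrCA wc mulr1.
(* The z_i generate only modulo [l]; iterating pushes the error into l^k f(y') for every k. *)
have fmod k y : y \in OL -> exists2 y', y' \in OL & f y - f y' *~ (l%:Z ^+ k) \in O.
  move=> Oy; elim: k => [|k [y' Oy' E]]; first by exists y; rewrite // expr0 subrr rpred0.
  have [e [y2 [Oy2 y'E]]] := genz y' Oy'; exists y2 => //.
  pose T := \sum_i f (z i) *~ e i.
  have y'T : f y' = T + f y2 *~ l.
    by rewrite y'E fD fZ (big_morph f fD f0); congr (_ + _); apply: eq_bigr => i _; apply: fZ.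
  have -> : f y - f y2 *~ (l%:Z ^+ k.+1) = (f y - f y' *~ (l%:Z ^+ k)) + T *~ (l%:Z ^+ k).
    rewrite y'T [(T + _) *~ _]mulrzDl exprS mulrzA.
    have grp (W : zmodType) (p q t : W) : p - t = p - (q + t) + q.
      by rewrite opprD addrA addrAC subrK.
    exact: grp.
  by rewrite rpredD // rpredMz // rpred_sum // => i _; rewrite rpredMz.
have fO y : y \in OL -> f y \in O.
  (* With k the exponent of [l] in the common denominator m1, the error l^k f(y') itself lies in
     [O]. *)
  have [k [m' [fm' m1E]]] := lpart_split nzm1.
  move=> Oy; have [y' Oy' E] := fmod k y Oy.
  suff Ok : f y' *~ (l%:Z ^+ k) \in O by rewrite -[f y](subrK (f y' *~ (l%:Z ^+ k))) rpredD.
  have [u Ou uE] := @local_order_unit K L galL H act mulHC l pl _ fm'.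
  have -> : f y' *~ (l%:Z ^+ k) = w * u * (m1%:~R * f1 y').
    rewrite fE m1E intrM -mulrzl.
    transitivity ((m'%:~R * u) * ((l%:Z ^+ k)%:~R * (w * f1 y'))); last by ring.
    by rewrite uE mul1r.
  by apply: rpredM; [apply: rpredM | apply: f1O].
exists x; split=> // [h hx0|y Oy].
  by have := fM h x; rewrite hx0 f0 fx mulr1.
by exists (f y); [apply: fO | apply: f_inj; rewrite fM fx mulr1].
Qed.

End MaximalOrder.

(** * Inertia and ramification *)

Lemma exists_prime_over (R : comNzRingType) (I : R -> Prop) :
    I 0 -> (forall x y, I x -> I y -> I (x + y)) -> (forall c x, I x -> I (c * x)) ->
    ~ I 1 ->
  exists P : prime_idealr R, forall x, I x -> x \in (P : {pred R}).
Proof.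
move=> I0 ID IM nI1.
pose closed (J : set R) := [/\ forall x, I x -> J x,
  forall x y, J x -> J y -> J (x + y), forall c x, J x -> J (c * x) & ~ J 1].
(* Adjoining [I] makes the union of the empty chain admissible in Zorn's lemma. *)
pose span (J : set R) : set R := fun x => I x \/ J x.
have [J [cJ maxJ]] : exists J : set R, closed (span J) /\
    forall B, (J `<` B)%classic -> ~ closed (span B).
  apply: (@Zorn_bigcup _ (fun J => closed (span J))) => C CP Ctot.
  have [->|/set0P[J0 CJ0]] := eqVneq C set0.
    rewrite bigcup_set0; split; first by left.
    - by move=> x y [Ix|//] [Iy|//]; left; apply: ID.
    - by move=> c x [Ix|//]; left; apply: IM.
    - by case.
  split; first by left.
  - move=> x y [Ix|[J1 CJ1 Jx]] [Iy|[J2 CJ2 Jy]].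
    + by left; apply: ID.
    + have [_ SD _ _] := CP _ CJ2.
      have [|Jxy] := SD x y (or_introl Ix) (or_intror Jy); first by left.
      by right; exists J2.
    + have [_ SD _ _] := CP _ CJ1.
      have [|Jxy] := SD x y (or_intror Jx) (or_introl Iy); first by left.
      by right; exists J1.
    + have [sub|sub] := Ctot _ _ CJ1 CJ2.
        have [_ SD _ _] := CP _ CJ2.
        have [|Jxy] := SD x y (or_intror (sub _ Jx)) (or_intror Jy); first by left.
        by right; exists J2.
      have [_ SD _ _] := CP _ CJ1.
      have [|Jxy] := SD x y (or_intror Jx) (or_intror (sub _ Jy)); first by left.
      by right; exists J1.
  - move=> c x [Ix|[J1 CJ1 Jx]]; first by left; apply: IM.
    have [_ _ SM _] := CP _ CJ1; have [|Jcx] := SM c x (or_intror Jx); first by left.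
    by right; exists J1.
  - case=> // -[J1 CJ1 J11]; have [_ _ _] := CP _ CJ1; apply.
    by right.
set S := span J in cJ maxJ *; have [SI SD SM nS1] := cJ.
pose P : {pred R} := fun x => `[< S x >].
have PP x : reflect (S x) (x \in P) by apply: asboolP.
have S0 : S 0 by left.
have P_ideal : idealr_closed P.
  split=> [||c x y /PP Sx /PP Sy]; first exact/PP.
    by apply/negP=> /PP.
  by apply/PP; apply: SD => //; apply: SM.
have P_prime : prime_idealr_closed P.
  move=> x y /PP Sxy; have [|/PP nSx] := boolP (x \in P); first by [].
  have [//|/PP nSy] := boolP (y \in P); exfalso.
  have ext z : ~ S z -> exists c s, S s /\ 1 = c * z + s.
    move=> nSz; apply: contrapT => no.
    pose B : set R := fun t => exists c s, S s /\ t = c * z + s.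
    have SB t : S t -> B t by exists 0, t; rewrite mul0r add0r.
    apply: (maxJ B).
      split=> [t Jt|BJ]; first by apply: SB; right.
      by apply: nSz; right; apply: BJ; exists 1, 0; rewrite mul1r addr0.
    have spanB t : span B t -> B t by case=> // It; apply: SB; left.
    split=> [t It|t t' /spanB[c [s [Ss ->]]] /spanB[c' [s' [Ss' ->]]]
      |c t /spanB[c' [s [Ss ->]]]|/spanB[c [s [Ss E]]]].
    - by left.
    - right; exists (c + c'), (s + s'); split; first exact: SD.
      by rewrite mulrDl addrACA.
    - right; exists (c * c'), (c * s); split; first exact: SM.
      by rewrite mulrDr mulrA.
    - by apply: no; exists c, s.
  have [c [s [Ss E]]] := ext x nSx; have [c' [s' [Ss' E']]] := ext y nSy.
  apply: nS1; have -> : 1 = (c * c') * (x * y) + ((c * x) * s' + (c' * y + s') * s).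
    by rewrite -[LHS]mulr1 {1}E E'; ring.
  by apply: (SD); [apply: (SM) | apply: (SD); apply: (SM)].
pose isP := isIdealr.Build R P P_ideal.
pose isPP := isPrimeIdealrClosed.Build R P P_prime.
pose Q : prime_idealr R := HB.pack P isP isPP.
exists Q => x Ix; apply/PP; exact: SI.
Qed.

(** There are finitely many remainders modulo q and [l], so two of the X^(l^n) agree there. Arguing
    on polynomials makes i, j, t independent of the ring. *)
Lemma integral_pigeonhole (l : nat) (q : {poly int}) : prime l -> q \is monic ->
  exists i j (t : {poly int}), [/\ (i < j)%N, (0 < j)%N &
     forall (R : comNzRingType) (x : R), zev x q = 0 ->
       x ^+ (l ^ j) = x ^+ (l ^ i) + l%:R * zev x t].
Proof.
move=> pl mq; pose d := (size q).-1.
have sz_q : size q = d.+1 by rewrite prednK // lt0n size_poly_eq0 monic_neq0.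
pose r n := Pdiv.Ring.rmodp ('X^n : {poly int}) q.
have sz_r n : (size (r n) <= d)%N.
  by rewrite -ltnS -sz_q Pdiv.Ring.ltn_rmodp monic_neq0.
have evr (R : comNzRingType) (x : R) n : zev x q = 0 -> x ^+ n = zev x (r n).
  move=> q0; have := Pdiv.RingMonic.rdivp_eq mq 'X^n; rewrite -/(r n) => E.
  by rewrite -[x in LHS](zevX x) -rmorphXn E rmorphD rmorphM /= q0 mulr0 add0r.
pose T : finType := {ffun 'I_d -> 'I_l}.
have l_gt0 := prime_gt0 pl.
pose f n : T := [ffun i : 'I_d => Ordinal (ltn_pmod `|(((r (l ^ n)%N)`_i) %% l)%Z|%N l_gt0)].
have [i [j [ltij fij]]] : exists i j, (i < j)%N /\ f i = f j.
  have /injectivePn[i [j nij fij]] : ~~ injectiveb (fun i : 'I_#|T|.+1 => f i).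
    by apply/injectiveP => /leq_card; rewrite card_ord ltnn.
  have [lt|lt|E] := ltngtP (val i) (val j); [by exists i, j | by exists j, i |].
  by rewrite (val_inj E) eqxx in nij.
have lC (a b : int) : (`|(a %% l)%Z| %% l)%N = (`|(b %% l)%Z| %% l)%N -> (l %| a - b)%Z.
  have l_neq0 : l%:Z != 0 by rewrite eqz_nat -lt0n.
  have lt c : (`|(c %% l)%Z| < l)%N.
    by rewrite -ltz_nat gez0_abs ?modz_ge0 // ltz_pmod.
  rewrite !modn_small // => E; rewrite -eqz_mod_dvd.
  by rewrite -(gez0_abs (modz_ge0 a l_neq0)) E gez0_abs ?modz_ge0.
have /polyOver_dvdzP[t tE] : r (l ^ j)%N - r (l ^ i)%N \is a polyOver (dvdz l).
  apply/polyOverP=> k; rewrite coefB; have [ltkd|ledk] := ltnP k d.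
    apply: lC; have /ffunP/(_ (Ordinal ltkd)) := fij; rewrite !ffunE => /(congr1 val) /= ->.
    by [].
  by rewrite !nth_default ?subr0 ?rpred0 // (leq_trans (sz_r _)).
exists i, j, t; split=> // [|R x q0]; first exact: leq_ltn_trans ltij.
rewrite !(evr _ _ _ q0) -[l%:R]/(l%:Z%:~R) -zevZ -tE rmorphB /=.
by rewrite addrC subrK.
Qed.

Lemma ring_integers_mulI (F : fieldType) (x y z : 'O_F) : x != 0 -> x * y = x * z -> y = z.
Proof.
move=> nzx E; apply: val_inj; have nzvx : val x != 0.
  by apply: contra nzx => /eqP x0; apply/eqP/val_inj.
apply: (mulfI nzvx); exact: (congr1 val E).
Qed.

Section Inertia.
Variables (K : fieldExtType rat) (L : splittingFieldType K).
Hypothesis galL : galois 1 {:L}.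
Variables (l : nat) (pl : prime l).
Local Notation gT := (gal_of {:L}).
Local Notation OL := (local_integers pl L).
Local Notation R := ('O_L).

Lemma local_fraction (x : L) : x \in OL ->
  exists (m : int) (y : R), nondvd l m /\ m%:~R * x = val y.
Proof.
by move=> /local_integersP[m fm mx]; exists m, (RingOfIntegers mx).
Qed.

Lemma val_local (x : R) : val x \in OL.
Proof. exact/algebraic_local/(valP x). Qed.

Lemma val_int (m : int) : val (m%:~R : R) = m%:~R :> L.
Proof. exact: (rmorph_int (val : {rmorphism R -> L})). Qed.

Lemma val_nat (n : nat) : val (n%:R : R) = n%:R :> L.
Proof. exact: (rmorph_nat (val : {rmorphism R -> L})). Qed.

Lemma gal_integral (g : gT) (x : R) : g (val x) \in @algebraic_integer L.
Proof. by rewrite (algebraic_integer_rmorph (g : {rmorphism L -> L})) (valP x). Qed.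

Definition gal_int (g : gT) (x : R) : R := RingOfIntegers (gal_integral g x).

Lemma gal_intD g x y : gal_int g (x + y) = gal_int g x + gal_int g y.
Proof. by apply: val_inj; rewrite /= rmorphD. Qed.

Lemma gal_intM g x y : gal_int g (x * y) = gal_int g x * gal_int g y.
Proof. by apply: val_inj; rewrite /= rmorphM. Qed.

Lemma gal_int_int g (m : int) : gal_int g m%:~R = m%:~R.
Proof. by apply: val_inj; rewrite /= val_int rmorph_int. Qed.

Variable P : prime_idealr R.
Hypothesis Pl : (l%:R : R) \in P.

Lemma nondvd_notin_prime (m : int) : nondvd l m -> (m%:~R : R) \notin P.
Proof.
move=> fm; apply/negP=> Pm; have [u [v uv]] := nondvd_bezout pl fm.
have : (1 : R) \in P.
  have -> : (1 : R) = u%:~R * m%:~R - v%:~R * l%:R.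
    by rewrite -intrM uv rmorphD rmorphM /= mulrC addrK.
  by rewrite rpredB // idealMr.
by rewrite idealr1.
Qed.

Lemma local_prime_principal : exists2 w : R, w \in P &
  forall x, x \in P -> exists (m : int) (y : R), nondvd l m /\ m%:~R * x = w * y.
Proof.
pose Y (z : L) := exists2 x : R, x \in P & val x = z.
have Y0 : Y 0 by exists 0; rewrite ?rpred0.
have YB x y : Y x -> Y y -> Y (x - y).
  by move=> [x' Px' <-] [y' Py' <-]; exists (x' - y'); rewrite ?rpredB.
have [r [z [Yz genz]]] := generators_mod pl (finite_rankL L) Y0 YB.
have nz_l : l%:R != 0 :> L.
  by rewrite pmulrn (finite_rank_intr_eq0 (finite_rankL L)) eqz_nat -lt0n prime_gt0.
pose s := [seq z i / l%:R | i <- enum 'I_r].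
have [c [cY [r0 Or0 r0c] cs]] := field_bezout_seq pl (finite_rankL L) s.
(* [c] is the gcd of 1 and the z_i / l, so l c is that of [l] and the z_i; [Y'] places it in [P] up
   to an integer prime to [l]. *)
pose Y' (t : L) := exists (m : int) (x : R), [/\ nondvd l m, x \in P & m%:~R * l%:R * t = val x].
have [|||m [w [fm Pw wE]]] := cY Y'.
- move=> a b x y Oa Ob [m [x' [fm Px' mx]]] [n [y' [fn Py' ny]]].
  have [ma [a' [fma aE]]] := local_fraction Oa; have [mb [b' [fmb bE]]] := local_fraction Ob.
  exists (ma * mb * (m * n)), ((mb * n)%:~R * a' * x' + (ma * m)%:~R * b' * y').
  split; first by rewrite !nondvdM // fma fmb fm.
    by rewrite rpredD // idealMr.
  transitivity (val ((mb * n)%:~R : R) * val a' * val x' +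
    val ((ma * m)%:~R : R) * val b' * val y').
    by rewrite !val_int -mx -ny -aE -bE !intrM; ring.
  by [].
- by exists 1, l%:R; split; rewrite ?nondvd1 // mul1r mulr1 val_nat.
- move=> _ /mapP[i _ ->]; have [x Px xE] := Yz i; exists 1, x.
  by split; rewrite ?nondvd1 // mul1r mulrC divfK.
exists w => // x Px; have [|e [_ [[x' Px' <-] xE]]] := genz (val x); first by exists x.
have [q Oq qE] : exists2 q, q \in OL & val x = l%:R * c * q.
  have [q1 Oq1 q1E] : exists2 q, q \in OL & \sum_i z i *~ e i = l%:R * c * q.
    elim/big_ind: _ => [|y t [q Oq ->] [q' Oq' ->]|i _].
    - by exists 0; rewrite ?rpred0 ?mulr0.
    - by exists (q + q'); rewrite ?rpredD ?mulrDr.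
    have [|k Ok kE] := cs (z i / l%:R); first by apply/mapP; exists i; rewrite ?mem_enum.
    exists (k * (e i)%:~R); first by rewrite rpredM ?rpred_int.
    rewrite -mulrzr mulrA; congr (_ * _).
    by rewrite -mulrA [c * k]mulrC -kE mulrC divfK.
  exists (q1 + r0 * val x'); first by rewrite rpredD ?rpredM ?val_local.
  rewrite xE q1E mulrDr; congr (_ + _).
  transitivity (l%:R * (r0 * c) * val x'); last by ring.
  rewrite r0c mulr1. by rewrite [RHS]mulr_natl.
have [m' [q' [fm' q'E]]] := local_fraction Oq.
exists (m' * m), q'; split; first by rewrite nondvdM // fm'.
apply: val_inj; transitivity (val ((m' * m)%:~R : R) * val x); first by [].
transitivity (val w * val q'); last by [].
by rewrite val_int -wE -q'E qE intrM; ring.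
Qed.

Definition prime_gen : R := sval (cid2 local_prime_principal).
Local Notation w := prime_gen.

Lemma prime_genP : w \in P.
Proof. by rewrite /prime_gen; case: cid2. Qed.

(* Membership in the k-th power of P after inverting the integers prime to l;
   P then becomes principal, generated by w. *)
Definition local_pow (k : nat) (x : R) : Prop :=
  exists (m : int) (y : R), nondvd l m /\ m%:~R * x = w ^+ k * y.
Local Notation Q := local_pow.

Lemma local_pow1 x : Q 1 x <-> x \in P.
Proof.
split=> [[m [y [fm E]]]|Px].
  have : m%:~R * x \in P by rewrite E mulrC idealMr // prime_genP.
  by rewrite prime_idealrM (negbTE (nondvd_notin_prime fm)).
rewrite /Q /prime_gen; case: cid2 => /= w' _ wE; rewrite expr1; exact: wE.
Qed.

Lemma local_powM j k x y : Q j x -> Q k y -> Q (j + k) (x * y).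
Proof.
move=> [m [x' [fm mx]]] [n [y' [fn ny]]]; exists (m * n), (x' * y').
by split; rewrite ?nondvdM ?fm // intrM exprD mulrACA mx ny mulrACA.
Qed.

Lemma local_powMl k c x : Q k x -> Q k (c * x).
Proof.
by move=> [m [x' [fm mx]]]; exists m, (c * x'); split=> //; rewrite mulrCA mx mulrCA.
Qed.

Lemma local_powD k x y : Q k x -> Q k y -> Q k (x + y).
Proof.
move=> [m [x' [fm mx]]] [n [y' [fn ny]]]; exists (m * n), (n%:~R * x' + m%:~R * y').
split; first by rewrite nondvdM ?fm.
rewrite intrM [in RHS]mulrDr [w ^+ k * (n%:~R * _)]mulrCA [w ^+ k * (m%:~R * _)]mulrCA -mx -ny.
by ring.
Qed.

Lemma local_powN k x : Q k x -> Q k (- x).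
Proof. by rewrite -mulN1r; apply: local_powMl. Qed.

Lemma local_pow_le j k x : (j <= k)%N -> Q k x -> Q j x.
Proof.
move=> lejk [m [y [fm E]]]; exists m, (w ^+ (k - j) * y); split=> //.
by rewrite mulrA -exprD subnKC.
Qed.

Lemma local_pow_nondvd k (m : int) x : nondvd l m -> Q k (m%:~R * x) -> Q k x.
Proof.
move=> fm [n [y [fn E]]]; exists (n * m), y; split; first by rewrite nondvdM ?fn.
by rewrite intrM -mulrA.
Qed.

Lemma prime_gen_neq0 : w != 0.
Proof.
have /local_pow1[m [y [fm E]]] := Pl; apply: contraTneq fm => w0.
have nzl : l%:R != 0 :> L.
  by rewrite pmulrn (finite_rank_intr_eq0 (finite_rankL L)) eqz_nat -lt0n prime_gt0.
have /(congr1 val) : m%:~R * l%:R = 0 :> R by rewrite E w0 expr1 mul0r.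
move=> E1; have /eqP : m%:~R * l%:R = 0 :> L by rewrite -val_int -val_nat; exact: E1.
rewrite mulf_eq0 (negbTE nzl) orbF (finite_rank_intr_eq0 (finite_rankL L)) => /eqP->.
by rewrite /nondvd dvdz0.
Qed.

Lemma prime_genX_neq0 k : w ^+ k != 0.
Proof.
apply/eqP=> /(congr1 val); rewrite rmorphXn rmorph0 => /eqP; apply/negP/expf_neq0.
by apply: contra prime_gen_neq0 => /eqP w0; apply/eqP/val_inj.
Qed.

(* If l^a were divisible by every power of w, then w^N (1 - w b) = l c would
   force a power of 1 - w b into P. *)
Lemma local_pow_separated x : (forall k, Q k x) -> x = 0.
Proof.
move=> Qx; apply/eqP; apply: contraT => nzx.
have nzvx : val x != 0 by apply: contra nzx => /eqP x0; apply/eqP/val_inj.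
have [d nzd /local_fraction[m [y [fm dE]]]] := denominator pl (val x)^-1.
have [a [m' [fm' dlE]]] := lpart_split pl nzd.
have Ql k : Q k (l%:R ^+ a).
  apply: (local_pow_nondvd (m := m * m')); first by rewrite nondvdM ?fm.
  have -> : (m * m')%:~R * l%:R ^+ a = y * x :> R.
    apply: val_inj; rewrite !rmorphM /= -dE mulrA mulfVK // dlE !val_int.
    have lX : (l%:Z ^+ a)%:~R = val (l%:R ^+ a : R).
      by rewrite [RHS]rmorphXn [X in _ = X ^+ _]val_nat; exact: rmorphXn.
    by rewrite !intrM lX -mulrA.
  exact: local_powMl.
have [N [b [c [Ob Oc E]]]] := field_pi_regular (finite_rankL L) (val_local w).
have [mb [b' [fmb bE]]] := local_fraction Ob; have [mc [c' [fmc cE]]] := local_fraction Oc.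
have [n [z [fn zE]]] := Ql (N * a.+1)%N.
have E1 : w ^+ (N * a.+1) * (mc%:~R ^+ a.+1 * (mb%:~R - w * b') ^+ a.+1 * n%:~R) =
    w ^+ (N * a.+1) * (mb%:~R ^+ a.+1 * c' ^+ a.+1 * z * l%:R) :> R.
  transitivity ((mb%:~R ^+ a.+1 * c' ^+ a.+1 * l%:R) * (n%:~R * l%:R ^+ a)); last first.
    by rewrite zE; ring.
  have E2 : w ^+ N * mc%:~R * (mb%:~R - w * b') = mb%:~R * c' * l%:R.
    apply: val_inj; transitivity (val w ^+ N * mc%:~R * (mb%:~R - val w * val b')).
      by rewrite -(val_int mc) -(val_int mb) -[val w ^+ N](rmorphXn (val : {rmorphism R -> L})).
    transitivity (mb%:~R * val c' * l%:R); last by rewrite -(val_int mb) -(val_nat l).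
    transitivity (mc%:~R * mb%:~R * (val w ^+ N * (1 - val w * b))); first by rewrite -bE; ring.
    by rewrite E -cE; ring.
  rewrite exprM -!mulrA [_ ^+ a.+1 * (_ * n%:~R)]mulrA !mulrA -!exprMn E2 !exprMn.
  by rewrite [l%:R ^+ a.+1]exprS; ring.
have {}E1 := ring_integers_mulI (prime_genX_neq0 _) E1.
have : mb%:~R ^+ a.+1 * c' ^+ a.+1 * z * l%:R \in P by apply: idealMr.
have PX y1 k : y1 \notin P -> y1 ^+ k \notin P.
  move=> nPy; elim: k => [|k IHk]; first by rewrite expr0 idealr1.
  by rewrite exprS prime_idealrM negb_or nPy.
rewrite -E1 !prime_idealrM (negbTE (nondvd_notin_prime fn)) orbF.
rewrite (negbTE (PX _ _ (nondvd_notin_prime fmc))) (negbTE (PX _ _ _)) //.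
apply: contra (nondvd_notin_prime fmb) => Pd.
by rewrite -(subrK (w * b') mb%:~R) rpredD // mulrC idealMr // prime_genP.
Qed.

(** By induction x is w^(k+1) t up to an integer prime to [l]; cancelling w^(k+1) puts c t, hence t,
    in [P]. *)
Lemma local_pow_primary k (c x : R) : c \notin P -> Q k.+1 (c * x) -> Q k.+1 x.
Proof.
move=> nPc; elim: k x => [|k IHk] x Qcx.
  by move/local_pow1: Qcx; rewrite prime_idealrM (negbTE nPc) => /local_pow1.
have [m [t [fm tE]]] := IHk x (local_pow_le (leqnSn _) Qcx).
have [n [z [fn zE]]] := Qcx.
have nzw : w ^+ k.+1 != 0 := prime_genX_neq0 _.
have E : n%:~R * (c * t) = w * (m%:~R * z).
  apply: (ring_integers_mulI nzw); transitivity (n%:~R * c * (m%:~R * x)).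
    by rewrite tE; ring.
  transitivity (m%:~R * (n%:~R * (c * x))); first by ring.
  by rewrite zE exprS; ring.
have /local_pow1 Qt : t \in P.
  have : n%:~R * (c * t) \in P by rewrite E mulrC idealMr // prime_genP.
  by rewrite !prime_idealrM (negbTE nPc) (negbTE (nondvd_notin_prime fn)).
apply: (local_pow_nondvd fm); rewrite tE -addn1; apply: local_powM => //.
by exists 1, 1; rewrite nondvd1 // mul1r mulr1.
Qed.

Lemma local_pow_ideal_pow2 x : Q 2 x -> ideal_pow P 2 x.
Proof.
move=> [m [y [fm mx]]]; have [u [v uv]] := nondvd_bezout pl fm.
(* From u m = 1 + l v follows 1 = (l v)^2 + u m (2 - u m). *)
exists [:: (v%:~R ^+ 2 * x, l%:R * l%:R); (u%:~R * (2 - u%:~R * m%:~R) * y, w * w)].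
  have tup (a b : R) : a \in P -> b \in P ->
      exists2 t : 2.-tuple R, {subset t <= P} & a * b = \prod_(c <- t) c.
    move=> Pa Pb; exists [tuple a; b]; last by rewrite big_cons big_seq1.
    by move=> c; rewrite !inE => /orP[] /eqP->.
  by move=> c; rewrite !inE => /orP[] /eqP-> /=; apply: tup; rewrite ?prime_genP.
rewrite big_cons big_seq1 /=.
have uvR : u%:~R * m%:~R = 1 + l%:R * v%:~R :> R.
  by rewrite -intrM uv rmorphD rmorphM.
have -> : u%:~R * (2 - u%:~R * m%:~R) * y * (w * w) =
    u%:~R * (2 - u%:~R * m%:~R) * (m%:~R * x) by rewrite mx expr2; ring.
have -> : u%:~R * (2 - u%:~R * m%:~R) * (m%:~R * x) =
    (u%:~R * m%:~R) * (2 - u%:~R * m%:~R) * x by ring.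
by rewrite uvR; ring.
Qed.

Lemma local_pow_prod (t : seq R) : {subset t <= P} -> Q (size t) (\prod_(a <- t) a).
Proof.
elim: t => [|y t IHt] tP.
  by rewrite big_nil; exists 1, 1; rewrite nondvd1 // !mul1r.
rewrite big_cons -[size _]/(1 + size t)%N; apply: local_powM.
  by apply/local_pow1/tP/mem_head.
by apply: IHt => z tz; apply: tP; rewrite inE tz orbT.
Qed.

Lemma ideal_pow_local_pow k x : ideal_pow P k x -> Q k x.
Proof.
move=> [s sP ->]; rewrite big_seq; elim/big_ind: _ => [|y z|u /sP[t tP ->]].
- by exists 1, 0; rewrite nondvd1 // !mulr0.
- exact: local_powD.
by apply: local_powMl; rewrite -{1}(size_tuple t); apply: local_pow_prod.
Qed.

Lemma prime_expr_sub (a b : R) : a ^+ l - b ^+ l \in P -> a - b \in P.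
Proof.
pose phi : {rmorphism R -> {ideal_quot P}} := \pi_({ideal_quot P}).
have phi0 x : (x \in P) = (phi x == 0).
  by rewrite -[x in LHS]subr0 Quotient.idealrBE -(rmorph0 phi).
have chl : l \in [pchar {ideal_quot P}].
  by rewrite inE pl -(rmorph_nat phi) -phi0.
rewrite phi0 rmorphB !rmorphXn => E.
have : (a - b) ^+ l \in P.
  rewrite phi0 rmorphXn rmorphB -(pFrobenius_autE chl) pFrobenius_autB_comm.
    by rewrite !pFrobenius_autE.
  exact: mulrC.
elim: l => [|k IHk]; first by rewrite expr0 idealr1.
by rewrite exprS prime_idealrM => /orP[|/IHk].
Qed.

(** Replaces finiteness of the residue field: two powers x^(l^i), x^(l^j) agree modulo [P], and
    injectivity of Frobenius strips l^i. *)
Lemma prime_residue_exponent (x : R) : exists2 f, (0 < f)%N & x ^+ (l ^ f) - x \in P.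
Proof.
have [q mq qx] : exists2 q : {poly int}, q \is monic & zev x q = 0.
  have /asboolP[q mq /eqP qx] := valP x; exists q => //; apply: val_inj.
  by rewrite -[LHS](zev_rmorph (val : {rmorphism R -> L})) zevE qx.
have [i [j [t [ltij _ /(_ _ _ qx) E]]]] := integral_pigeonhole pl mq.
exists (j - i)%N; first by rewrite subn_gt0.
have : (x ^+ (l ^ (j - i))) ^+ (l ^ i) - x ^+ (l ^ i) \in P.
  by rewrite -exprM -expnD subnK 1?ltnW // E addrAC subrr add0r mulrC idealMr.
elim: i {ltij E j t} (x ^+ _) => [|i IHi] y; first by rewrite !expr1.
by rewrite !expnSr !exprM => /prime_expr_sub/IHi.
Qed.

(* A uniformizer fixed by the inertia group forces inertia elements to be
   congruent to 1 modulo every power of P. *)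
Lemma inertia_trivial (g : gT) (pi : 'O_K) :
    (forall x, gal_int g x - x \in P) ->
    (pi%:A : R) \in P -> ~ Q 2 (pi%:A : R) -> g = 1%g.
Proof.
move=> gP Ppi nQpi; pose D x := gal_int g x - x.
have DB x y : D (x - y) = D x - D y.
  rewrite /D -[- y]mulN1r gal_intD gal_intM -[-1 : R]/((-1)%:~R) gal_int_int.
  by rewrite [(-1)%:~R]rmorphN1; ring.
have DM x y : D (x * y) = D x * gal_int g y + x * D y.
  by rewrite /D gal_intM; ring.
have Dint (m : int) x : D (m%:~R * x) = m%:~R * D x.
  by rewrite /D gal_intM gal_int_int mulrBr.
have Dpi x : D (pi%:A * x) = pi%:A * D x.
  rewrite /D gal_intM mulrBr; congr (_ * _ - _); apply: val_inj.
  transitivity (g (val pi *: 1)); first by [].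
  by rewrite gal_scalar rmorph1.
have gPP y : y \in P -> gal_int g y \in P.
  by move=> Py; rewrite -(subrK y (gal_int g y)) rpredD.
have /local_pow1[mpi [c [fmpi cE]]] := Ppi; rewrite expr1 in cE.
have nPc : c \notin P.
  apply/negP=> /local_pow1 Qc; apply: nQpi; apply: (local_pow_nondvd fmpi).
  rewrite cE -[2%N]/(1 + 1)%N; apply: local_powM => //.
  exact/local_pow1/prime_genP.
have QD k : forall x, Q k.+1 (D x).
  elim: k => [|k IHk] x; first by apply/local_pow1; apply: gP.
  (* Up to c and integers prime to [l], y is [pi] times an integer z, and [D] commutes with
     multiplication by the fixed element [pi]. *)
  have QP y : y \in P -> Q k.+2 (D y).
    move=> Py; have /local_pow1[m [z [fm zE]]] := Py; rewrite expr1 in zE.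
    apply: (local_pow_nondvd fm); apply: (local_pow_primary nPc).
    have -> : c * (m%:~R * D y) =
        mpi%:~R * (pi%:A * D z) - gal_int g (m%:~R * y) * D c.
      rewrite -Dpi -Dint -Dint; have -> : mpi%:~R * (pi%:A * z) = c * (m%:~R * y).
        by rewrite zE [LHS]mulrA cE; ring.
      by rewrite [D (c * _)]DM; ring.
    apply: local_powD; last apply: local_powN.
      apply: local_powMl; rewrite -[k.+2]add1n; apply: local_powM => //.
      exact/local_pow1.
    rewrite -[k.+2]add1n; apply: local_powM => //; apply/local_pow1/gPP.
    by rewrite idealMr.
  (* D(y^l) is D y times a sum congruent to l y^(l-1), hence to 0, modulo [P]. *)
  have QX y : Q k.+2 (D (y ^+ l)).
    have -> : D (y ^+ l) = (\sum_(i < l) gal_int g y ^+ (l.-1 - i) * y ^+ i) * D y.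
      rewrite mulrC -subrXX /D; congr (_ - _).
      elim: l => [|n IHn]; last by rewrite !exprS gal_intM IHn.
      by rewrite !expr0 -[1]/(1%:~R) gal_int_int.
    rewrite -[k.+2]add1n; apply: local_powM => //; apply/local_pow1.
    pose phi : {rmorphism R -> {ideal_quot P}} := \pi_({ideal_quot P}).
    have phi0 t : (t \in P) = (phi t == 0).
      by rewrite -[t in LHS]subr0 Quotient.idealrBE -(rmorph0 phi).
    have phig : phi (gal_int g y) = phi y.
      by apply/eqP; rewrite -subr_eq0 -rmorphB -phi0.
    rewrite phi0 rmorph_sum /= (eq_bigr (fun=> phi y ^+ l.-1)) => [|i _].
      rewrite sumr_const card_ord -mulr_natr -(rmorph_nat phi).
      by have := Pl; rewrite phi0 => /eqP->; rewrite mulr0.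
    rewrite rmorphM !rmorphXn /= phig -exprD subnK //.
    by rewrite -ltnS prednK ?prime_gt0.
  (* Every x is an l-th power up to an element of [P]. *)
  have [[|f] // _ Pxf] := prime_residue_exponent x.
  have -> : D x = D (x ^+ (l ^ f.+1)) - D (x ^+ (l ^ f.+1) - x) by rewrite -DB opprB addrC subrK.
  apply: local_powD; first by rewrite expnSr exprM.
  exact/local_powN/QP.
have D0 x : D x = 0.
  by apply: local_pow_separated => -[|k]; [apply: local_pow_le (QD 0%N x) | apply: QD].
apply/eqP/gal_eqP => t _; rewrite gal_id.
have [m nzm /local_fraction[n [x [fn xE]]]] := denominator pl t.
have /eqP := D0 x; rewrite subr_eq0 => /eqP/(congr1 val) /= E.
have nzn : n%:~R != 0 :> L := nondvd_neq0 (finite_rankL L) fn.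
have nzmL : m%:~R != 0 :> L by rewrite (finite_rank_intr_eq0 (finite_rankL L)).
apply: (mulfI nzmL); apply: (mulfI nzn); rewrite xE -[RHS]E -xE !rmorphM /=.
by rewrite !rmorph_int.
Qed.

End Inertia.

(** * Separating pairs from domesticity *)

Section Domestic.
Variables (K : fieldExtType rat) (L : splittingFieldType K).
Hypothesis galL : galois 1 {:L}.
Variables (l : nat) (pl : prime l).
Local Notation gT := (gal_of {:L}).
Local Notation OL := (local_integers pl L).
Local Notation R := ('O_L).

Section Prime.
Variable P : prime_idealr R.
Hypothesis Pl : (l%:R : R) \in P.

Definition contraction : {pred 'O_K} := fun a => (a%:A : R) \in P.

Lemma contraction_ideal : idealr_closed contraction.
Proof.
split=> [||a x y]; rewrite /in_mem /= /contraction.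
- by rewrite scale0r rpred0.
- by rewrite scale1r idealr1.
- by move=> Px Py; rewrite scalerDl rpredD // -scalerA -mulr_algl idealMr.
Qed.

Lemma contraction_prime : prime_idealr_closed contraction.
Proof.
move=> x y; rewrite /in_mem /= /contraction -scalerA -mulr_algl prime_idealrM.
by [].
Qed.

Lemma contraction_lies_above : lies_above (intmul 1 : int -> 'O_K) contraction (dvdz l).
Proof.
move=> m; rewrite [LHS]/((m%:~R%:A : R) \in P) scaler_int.
have [/dvdzP[q ->]|nlm] := boolP (l %| m)%Z.
  by rewrite -[RHS]/true -[LHS]/((q * l)%:~R \in P) intrM idealMr.
by apply: negbTE; exact: nondvd_notin_prime Pl _ nlm.
Qed.

Hypothesis dom : domestic K L.
Hypothesis ldim : (l %| \dim {:L})%N.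

(** Otherwise p O_L would be contained in P^2 for the contraction p of [P], and p would ramify. *)
Lemma unramified_uniformizer :
  exists2 pi : 'O_K, (pi%:A : R) \in P & ~ local_pow pl Pl 2 (pi%:A : R).
Proof.
apply: contrapT => no.
have in2 (pi : 'O_K) : (pi%:A : R) \in P -> ideal_pow P 2 (pi%:A : R).
  move=> Ppi; apply: (local_pow_ideal_pow2 (pl := pl) (Pl := Pl)).
  by apply: contrapT => nQ; apply: no; exists pi.
pose isP := isIdealr.Build _ contraction contraction_ideal.
pose isPP := isPrimeIdealrClosed.Build _ contraction contraction_prime.
pose p : prime_idealr 'O_K := HB.pack contraction isP isPP.
pose ext := ideal_extension (L := L) p.
pose bad k := (1 < k)%N && `[< ~ (ext `<=` ideal_pow P k)%classic >].
have ext2 : (ext `<=` ideal_pow P 2)%classic.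
  move=> _ [s sp ->]; rewrite big_seq; elim/big_ind: _ => [|x y|u /sp[a pa ->]].
  - exact: ideal_span0.
  - exact: ideal_spanD.
  - by apply: ideal_spanM; apply: in2.
have exbad : exists k, bad k.
  apply: contrapT => nb; have : (l%:R : R) = 0.
    apply: (local_pow_separated (Pl := Pl)) => k.
    apply: (local_pow_le (leq_addl 2 k)); apply: ideal_pow_local_pow.
    apply: contrapT => nlk; apply: nb; exists (2 + k)%N; apply/asboolP => sub.
    apply: nlk; apply: sub; exists [:: (1, l%:R)]; last by rewrite big_seq1 mul1r.
    move=> u; rewrite inE => /eqP-> /=; exists l%:R; last by rewrite scaler_nat.
    by rewrite [_ \in _]/((l%:R%:A : R) \in P) scaler_nat.
  move/(congr1 val)/eqP; rewrite val_nat pmulrn.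
  by rewrite (finite_rank_intr_eq0 (finite_rankL L)) eqz_nat eqn0Ngt prime_gt0.
(* By [ext2] the least bad exponent is at least 3; the ramification index is one less. *)
have [[|[|[|e]]] // /andP[_ /asboolP nsub] mink] := ex_minnP exbad.
  exact: nsub.
apply: (dom pl ldim (p := p)); first exact: contraction_lies_above.
exists P; split; first by [].
exists e.+2 => //; split=> //; apply: contrapT => nsub'.
by have /mink : bad e.+2 by [apply/asboolP]; rewrite ltnn.
Qed.

Lemma domestic_inertia (g : gT) :
  (forall x, gal_int g x - x \in P) -> g = 1%g.
Proof.
by move=> gP; have [pi] := unramified_uniformizer; apply: inertia_trivial.
Qed.

End Prime.

Hypothesis dom : domestic K L.
Hypothesis ldim : (l %| \dim {:L})%N.

(** Adding [l] to the ideal of the x - g x ensures that a prime containing it lies over [l]; the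
    price is a value 1 + l c in place of 1, still a unit. *)
Lemma unramified_separating_pairs : exists r mu w,
  [/\ forall p, p \in r -> p.1 \in OL /\ p.2 \in OL,
      forall g, pair_eval r g = if g == 1%g then mu else 0,
      w \in OL & mu * w = 1].
Proof.
have sep (g : gT) : exists c, c \in OL /\ (g != 1%g -> exists2 r : seq (L * L),
    (forall p, p \in r -> p.1 \in OL /\ p.2 \in OL)
    & \sum_(p <- r) p.1 * (p.2 - g p.2) = 1 + l%:R * c).
  have [->|ng1] := eqVneq g 1%g; first by exists 0; rewrite rpred0.
  pose I (x : R) := exists (s : seq (R * R)) c,
    x = \sum_(p <- s) p.1 * (p.2 - gal_int g p.2) + l%:R * c.
  have [[s [c E]]|nI1] := EM (I 1).
    exists (- val c); split=> [|_]; first by rewrite rpredN val_local.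
    exists [seq (val p.1, val p.2) | p <- s] => [_ /mapP[p _ ->]|].
      by split; apply: val_local.
    transitivity (val (\sum_(p <- s) p.1 * (p.2 - gal_int g p.2))).
      by rewrite rmorph_sum big_map; apply: eq_bigr.
    have -> : \sum_(p <- s) p.1 * (p.2 - gal_int g p.2) = 1 - l%:R * c.
      by rewrite [X in X - _]E addrK.
    by rewrite mulrN -val_nat.
  have [|x y [s [c ->]] [s' [c' ->]]|a x [s [c ->]]||P PI] // := exists_prime_over (I := I).
  - by exists [::], 0; rewrite big_nil mulr0 addr0.
  - by exists (s ++ s'), (c + c'); rewrite big_cat mulrDr addrACA.
  - exists [seq (a * p.1, p.2) | p <- s], (a * c).
    rewrite big_map mulrDr mulr_sumr mulrCA; congr (_ + _).
    by apply: eq_bigr => p _; rewrite mulrA.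
  have Pl : l%:R \in P by apply: PI; exists [::], 1; rewrite big_nil add0r mulr1.
  case/eqP: ng1; apply: (domestic_inertia Pl dom ldim) => x.
  rewrite -opprB rpredN; apply: PI; exists [:: (1, x)], 0.
  by rewrite big_seq1 mulr0 addr0 mul1r.
have [c cP] := choice sep.
have [||g ng1|r rO rE] := @separating_pairs _ _ OL (fun g => 1 + l%:R * c g).
- exact: local_integers_subring.
- by move=> g x; apply: gal_local.
- by have [_ /(_ ng1)] := cP g.
have [w Ow muw] : exists2 w, w \in OL & (\prod_(s | s != 1%g) (1 + l%:R * c s)) * w = 1.
  elim/big_ind: _ => [|x y [a Oa xa] [b Ob yb]|s _].
  - by exists 1; rewrite ?rpred1 ?mulr1.
  - by exists (a * b); rewrite ?rpredM // mulrACA xa yb mulr1.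
  - exact: (local_unit1D (finite_rankL L) (cP s).1).
by exists r, (\prod_(s | s != 1%g) (1 + l%:R * c s)), w.
Qed.

End Domestic.

Lemma exists_local_generator (K : fieldExtType rat) (L : splittingFieldType K)
    (galL : galois 1 {:L}) (H : hopfAlgType K) (act : hopf_galois L H)
    (mulHC : commutative (@GRing.mul H)) (l : nat) (pl : prime l) :
  domestic K L -> exists x, local_free_generator galL act mulHC pl x.
Proof.
move=> dom; have [ldim|ldim] := boolP (l %| \dim {:L})%N.
  have [r [mu [w [rO rE Ow muw]]]] := unramified_separating_pairs pl dom ldim.
  exact: unramified_local_generator rO rE Ow muw.
by apply: tame_local_generator; rewrite -(card_gal_full galL).
Qed.

(** * Completions *)

Section Completion.
Variables (R : comNzRingType) (I : idealr R).

Lemma ideal_powX (z : R) n : z \in I -> ideal_pow I n (z ^+ n).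
Proof.
move=> Iz; exists [:: (1, z ^+ n)]; last by rewrite big_seq1 mul1r.
move=> u; rewrite inE => /eqP-> /=; exists (nseq_tuple n z).
  by move=> x /= /nseqP[->].
by rewrite /=; elim: n => [|n IHn]; rewrite ?big_nil ?expr0 // big_cons exprS IHn.
Qed.

Lemma completion_eq (x y : coherent_seq I) :
  (forall n, ideal_pow I n (x n - y n)) -> \pi_(completion I) x = \pi_(completion I) y.
Proof. by move=> xy; apply/eqP; rewrite -Quotient.idealrBE; apply/asboolP. Qed.

(** The inverse is the geometric series. *)
Lemma to_completion_unit1B (z : R) : z \in I -> exists c, c * to_completion I (1 - z) = 1.
Proof.
move=> Iz; pose s n := \sum_(i < n) z ^+ i.
have sc : s \in coherent I.
  apply/asboolP=> n; rewrite /s big_ord_recr /= addrAC subrr add0r.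
  exact: ideal_powX.
exists (\pi_(completion I) (CoherentSeq sc)).
pose pi : {rmorphism _ -> _} := \pi_(completion I).
rewrite -[LHS](rmorphM pi) -[RHS](rmorph1 pi); apply: completion_eq => n.
have -> : s n * (1 - z) - 1 = - z ^+ n.
  by rewrite mulrC -[1 - z]opprB mulNr /s -subrX1 opprB addrAC subrr add0r.
exact/ideal_spanN/ideal_powX.
Qed.

Lemma to_completion_nondvd (l : nat) (m : int) : prime l -> (l%:R : R) \in I ->
  nondvd l m -> exists c, c * to_completion I m%:~R = 1.
Proof.
move=> pl Il fm; have [u [v uv]] := nondvd_bezout pl fm.
have [|c cE] := @to_completion_unit1B (l%:R * - v%:~R); first by rewrite mulrC idealMr.
exists (c * to_completion I u%:~R); rewrite -mulrA -rmorphM -intrM uv.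
by rewrite rmorphD rmorphM /= -[in RHS]cE mulrN opprK.
Qed.

End Completion.

Lemma prime_ideal_prime (F : fieldType) (p : prime_idealr 'O_F) : nonzero_ideal p ->
  exists2 l : nat, prime l & (l%:R : 'O_F) \in p.
Proof.
case=> a pa nza.
have [q nzq qa] : exists2 q : {poly int}, q != 0 & zev a q = 0.
  have /asboolP[q mq /eqP qx] := valP a; exists q; first exact: monic_neq0.
  apply: val_inj.
  by rewrite -[LHS](zev_rmorph (val : {rmorphism 'O_F -> F})) zevE qx.
(* The constant term of a relation for [a] lies in [p]; while it is zero, [a] can be cancelled. *)
have [m nzm pm] : exists2 m : int, m != 0 & (m%:~R : 'O_F) \in p.
  have [n] := ubnP (size q); elim: n q nzq qa => // n IHn q nzq qa ltqn.
  have E := drop_polyS q 0; rewrite drop_poly0l in E.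
  have qaE : zev a (drop_poly 1 q) * a + (q`_0)%:~R = 0.
    by have := qa; rewrite {1}E rmorphD rmorphM /= zevX zevC mulrC.
  have [q0|nzq0] := eqVneq q`_0 0; last first.
    exists q`_0 => //; rewrite -(addKr (zev a (drop_poly 1 q) * a) _%:~R) qaE addr0.
    by rewrite rpredN idealMr.
  apply: (IHn (drop_poly 1 q)).
  - by apply: contraNneq nzq => d0; rewrite E d0 mulr0 q0 add0r.
  - apply: (ring_integers_mulI nza); rewrite mulr0 mulrC.
    by move: qaE; rewrite q0 addr0.
  - rewrite size_drop_poly subn1; move: ltqn nzq; rewrite -size_poly_eq0.
    by case: (size q).
have [n n_gt0 pn] : exists2 n : nat, (0 < n)%N & (n%:R : 'O_F) \in p.
  case: m nzm pm => n nzn pn; first by exists n => //; rewrite lt0n.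
  by exists n.+1 => //; rewrite -rpredN.
have [k] := ubnP n; elim: k n n_gt0 pn => // k IHk n n_gt0 pn ltnk.
have [n1|n_gt1] := leqP n 1; first by rewrite (@anti_leq n 1%N) ?n1 // idealr1 in pn.
have pd := pdiv_prime n_gt1; move: pn; rewrite -(divnK (pdiv_dvd n)) natrM prime_idealrM.
case/orP=> [pn|pn]; last by exists (pdiv n).
apply: IHk pn _; first by rewrite divn_gt0 ?pdiv_gt0 // pdiv_leq.
by rewrite -ltnS (leq_trans _ ltnk) // ltnS ltn_Pdiv // prime_gt1.
Qed.

(** * Freeness over the completed order *)

Section LocalFreeness.
Variables (K : fieldExtType rat) (L : splittingFieldType K).
Variables (H : hopfAlgType K) (act : hopf_galois L H).
Variable p : prime_idealr 'O_K.
Local Notation A := (associated_order act).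
Local Notation Kp := (completion p).
Local Notation tc := (to_completion p).
Variable e : 'O_L.
Hypothesis e_inj : forall h : A, order_act h e = 0 -> h = 0.
Hypothesis e_gen : forall y : 'O_L, exists (m : int) (h : A) (i : Kp),
  i * tc m%:~R = 1 /\ y *~ m = order_act h e.

Let bi := mul_bilinear_action (completion p).
Let biA := order_act_bilinear act.

Lemma tens_intM (M : lmodType 'O_K) (c : Kp) (m : int) (x : M) :
  tens (c * tc m%:~R) x = tens c (x *~ m).
Proof. by rewrite -scaler_int -tensZlr /GRing.scale /= mulrC. Qed.

Lemma order_act_int (h : A) (m : int) x : order_act (h *~ m) x = order_act h x *~ m.
Proof. by rewrite -!scaler_int (actZl biA). Qed.

(** [psi c y] is (c / m) (x) h for any expression y m = h . e, and [e_inj] makes it independent of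
    the choice. It provides an explicit inverse of a |-> a e1, so that no flatness of the completion
    is needed. *)
Lemma generator_coordinate : exists psi : Kp -> 'O_L -> order_at act p,
  forall c y m h i, i * tc m%:~R = 1 -> y *~ m = order_act h e ->
    psi c y = tens (c * i) h.
Proof.
have fam (y : 'O_L) : exists f : int * A * Kp,
    f.2 * tc f.1.1%:~R = 1 /\ y *~ f.1.1 = order_act f.1.2 e.
  by have [m [h [i mhi]]] := e_gen y; exists (m, h, i).
have [f fP] := boolp.choice fam.
exists (fun c y => tens (c * (f y).2) (f y).1.2) => c y m h i im yh.
have [] := fP y; case: (f y) => -[m' h'] i' /= im' yh'.
have hh' : h *~ m' = h' *~ m.
  apply/eqP; rewrite -subr_eq0; apply/eqP/e_inj.
  rewrite -scaleN1r (actDl biA) (actZl biA) scaleN1r !order_act_int -yh -yh'.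
  by rewrite -!mulrzA mulrC subrr.
have -> : c * i = c * i * i' * tc m'%:~R by rewrite -[RHS]mulrA im' mulr1.
have -> : c * i' = c * i * i' * tc m%:~R.
  by rewrite -[c * i * i']mulrA [i * i']mulrC mulrA -mulrA im mulr1.
by rewrite !tens_intM hh'.
Qed.

Lemma free_of_generator : free_module (integers_at L p : lmodType (order_at act p)).
Proof.
have [psi psiE] := generator_coordinate.
pose e1 : integers_at L p := tens 1 e.
have actE (c : Kp) (h : A) : (tens c h : order_at act p) *: e1 = tens c (order_act h e).
  by rewrite /GRing.scale /= /local_act tensor_act_tens // mulr1.
have psi_bal : balanced psi.
  split=> [c c' y|c y y'|a c y].
  - have [m [h [i [im yh]]]] := e_gen y.
    by rewrite !(psiE _ _ _ _ _ im yh) mulrDl tensDl.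
  - have [m [h [i [im yh]]]] := e_gen y; have [m' [h' [i' [im' yh']]]] := e_gen y'.
    rewrite (psiE _ _ _ _ _ im yh) (psiE _ _ _ _ _ im' yh').
    rewrite (psiE c (y + y') (m * m') (h *~ m' + h' *~ m) (i * i')).
    + rewrite tensDr -!tens_intM; congr (tens _ _ + tens _ _).
        by rewrite -!mulrA im' mulr1.
      by rewrite -[RHS]mulr1 -im; ring.
    + by rewrite intrM rmorphM mulrACA im im' mulr1.
    + by rewrite (actDl biA) !order_act_int -yh -yh' mulrzDl -!mulrzA [m' * m]mulrC.
  - have [m [h [i [im yh]]]] := e_gen y.
    rewrite (psiE _ _ _ _ _ im yh) (psiE c (a *: y) m (a *: h) i) //.
      by rewrite -tensZlr scalerAl.
    by rewrite (actZl biA) -yh -!scaler_int !scalerA mulrC.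
have psiK : forall x : order_at act p, tlift psi (x *: e1) = x.
  apply: eq_additive_tensor => [x y|x y //|c h].
    by rewrite scalerDl (tliftD psi_bal).
  by rewrite actE (tlift_tens psi_bal) (psiE _ _ 1 h 1) ?mulr1 // rmorph1 mulr1.
exists unit, (fun=> e1); split=> [x|s c us].
  suff [a ->] : exists a : order_at act p, x = a *: e1.
    by exists [:: tt], (fun=> a); rewrite big_seq1.
  move: x; apply: tensor_ind => [|_ _ [a ->] [b ->]|c y].
  - by exists 0; rewrite scale0r.
  - by exists (a + b); rewrite scalerDl.
  have [m [h [i [im yh]]]] := e_gen y; exists (tens (c * i) h).
  by rewrite actE -yh -tens_intM -mulrA im mulr1.
case: s us => [//|[] [|[] s] //= _]; rewrite big_seq1 => E [] _.
by rewrite -[c tt]psiK E (tlift0 psi_bal).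
Qed.

End LocalFreeness.

Lemma local_order_denominator (K : fieldExtType rat) (L : splittingFieldType K)
    (galL : galois 1 {:L}) (H : hopfAlgType K) (act : hopf_galois L H)
    (l : nat) (pl : prime l) (h : H) :
  h \in coef_in galL act (local_integers pl L) ->
  exists2 n, nondvd l n & h *~ n \in stabilizes_integers act.
Proof.
move=> /coef_inP Oh; pose a := hopf_coef galL act h.
have fam g : exists n, nondvd l n /\ n%:~R * a g \in @algebraic_integer L.
  by have /local_integersP[n fn na] := Oh g; exists n.
have [f fP] := boolp.choice fam; exists (\prod_g f g).
  by elim/big_ind: _ => [|m n fm fn|g _]; rewrite ?nondvd1 ?nondvdM ?fm //; apply: (fP g).1.
apply/asboolP=> x xi; rewrite -scaler_int (actZl (hact_bilinear act)) act_expand.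
rewrite scaler_int -mulrzl mulr_sumr rpred_sum // => g _; rewrite mulrA.
apply: rpredM; last by rewrite (algebraic_integer_rmorph (g : {rmorphism L -> L})).
rewrite (bigD1 g) //= mulrC intrM mulrA [_ * (f g)%:~R]mulrC.
by apply: rpredM; [apply: (fP g).2 | apply: rpred_int].
Qed.

Theorem theorem1p3 (K : fieldExtType rat) (L : splittingFieldType K)
    (H : hopfAlgType K) (act : hopf_galois L H) :
  galois 1 {:L} -> abelian 'Gal({:L} / 1) -> domestic K L ->
  commutative (@GRing.mul H) ->
  locally_free act.
Proof.
move=> galL _ dom mulHC p /prime_ideal_prime[l pl lp].
have [x [Ox xinj xgen]] := exists_local_generator galL act mulHC pl dom.
(* The factor [m], invertible in the completion at p, brings the generator into O_L. *)
have /local_integersP[m fm mx] := Ox; pose e : 'O_L := RingOfIntegers mx.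
have nzm : m%:~R != 0 :> K := nondvd_neq0 (finite_rankK K) fm.
have ex h : act h (val e) = m%:~R *: act h x.
  by rewrite /= mulrzl -scaler_int (actZr (hact_bilinear act)).
apply: (@free_of_generator _ _ _ _ p e) => [h /(congr1 val)|y].
  rewrite /= ex => /eqP; rewrite scaler_eq0 (negbTE nzm) => /eqP/xinj h0.
  exact: val_inj.
have [h Oh yE] := xgen _ (val_local pl y).
have [n fn nh] := local_order_denominator Oh.
have fnm : nondvd l (n * m) by rewrite nondvdM // fn.
have [c cE] := to_completion_nondvd pl lp fnm.
(* [n] clears the denominators of [h], and [m] is the factor between e and x. *)
exists (n * m), (AssociatedOrder nh), c; split=> //; apply: val_inj.
rewrite [RHS]/= -[h *~ n]scaler_int (actZl (hact_bilinear act)) ex -yE.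
rewrite scalerA -intrM scaler_int.
exact: (raddfMz (val : {rmorphism 'O_L -> L})).
Qed.
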